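(* Let $F$ be a field, let $\Gamma$ be a finite directed graph, and suppose that the Leavitt path algebra $L(\Gamma)$ over $F$ has polynomial growth. Then $L(\Gamma)$ has a finite chain of (two-sided) ideals $$(0) \leq I_0 < I_1 < \cdots < I_s = L(\Gamma)$$ such that: (1) $I_0$ is isomorphic to a finite direct sum of algebras, each of which is either a matrix algebra $M_n(F)$ with $n\ge 1$ or the infinite finitary matrix algebra $M_\infty(F)$; (2) for each $i$ with $0\le i\le s-1$ the factor $I_{i+1}/I_i$ is isomorphic to a finite direct sum of algebras, each of which is either a matrix algebra $M_n(F[t^{-1},t])$ with $n\ge 1$ or the infinite finitary matrix algebra $M_\infty(F[t^{-1},t])$ over the Laurent polynomial algebra $F[t^{-1},t]$; (3) every ideal $I_i$, $0\le i\le s$, is invariant under the group $\mathrm{Aut}(L(\Gamma))$ of $F$-algebra automorphisms of $L(\Gamma)$.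
   Context: A finite directed graph $\Gamma=(V,E)$ consists of a finite set $V$ of vertices and a finite set $E$ of edges together with source and range maps $s,r:E\to V$. A vertex $v$ with $s^{-1}(v)=\emptyset$ is called a sink. The Leavitt path algebra $L(\Gamma)$ over $F$ is the associative $F$-algebra presented by generators $\{v : v\in V\}\cup\{e,e^* : e\in E\}$ and relations: (i) $v_iv_j=\delta_{v_i,v_j}v_i$ for all $v_i,v_j\in V$; (ii) $s(e)e=e\,r(e)=e$ and $r(e)e^*=e^*s(e)=e^*$ for all $e\in E$; (iii) $e^*f=\delta_{e,f}\,r(e)$ for all $e,f\in E$; (iv) $v=\sum_{s(e)=v}ee^*$ for every vertex $v$ that is not a sink. It is a finitely generated algebra with identity $\sum_{v\in V}v$. A finitely generated $F$-algebra $A$ has polynomial growth if for a (equivalently, every) finite-dimensional subspace $G$ generating $A$ the dimension of the span of all products of at most $n$ elements of $G$ is bounded above by a polynomial in $n$. For an algebra $R$, $M_n(R)$ is the algebra of $n\times n$ matrices over $R$, and $M_\infty(R)$ is the algebra of infinite $\mathbb{N}\times\mathbb{N}$ matrices over $R$ ($\mathbb N=\{1,2,\ldots\}$) having only finitely many nonzero entries. Isomorphisms are isomorphisms of (not necessarily unital) $F$-algebras, and a finite direct sum may be empty, i.e. zero (so $I_0=(0)$ is allowed). *)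

(* Defs.v *)
From HB Require Import structures.
From mathcomp Require Import all_boot all_order all_algebra.
From mathcomp Require Import generic_quotient ring_quotient fraction.
From mathcomp Require Import boolp classical_sets functions cardinality fsbigop.

Set Implicit Arguments.
Unset Strict Implicit.
Unset Printing Implicit Defensive.

Import GRing.Theory.

Local Open Scope classical_set_scope.
Local Open Scope ring_scope.
Local Open Scope quotient_scope.

Reserved Notation "x ** y" (at level 40, left associativity).

(* Associative algebras over a field, not necessarily unital: ideals, their   *)
(* factors and the finitary matrix algebra have no identity in general.       *)
HB.mixin Record Lmodule_isNuAlgebra (F : fieldType) A of GRing.Lmodule F A := {
  nmul : A -> A -> A;
  nmulA : associative nmul;
  nmulDl : left_distributive nmul +%R;
  nmulDr : right_distributive nmul +%R;
  nscalerAl : forall (c : F) (x y : A), c *: nmul x y = nmul (c *: x) y;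
  nscalerAr : forall (c : F) (x y : A), c *: nmul x y = nmul x (c *: y)
}.

#[short(type="nuAlgType")]
HB.structure Definition NuAlgebra (F : fieldType) :=
  {A of GRing.Lmodule F A & Lmodule_isNuAlgebra F A}.

Notation "x ** y" := (nmul x y) : ring_scope.

Section NuAlgebraTheory.
Variables (F : fieldType) (A : nuAlgType F).
Implicit Types x y : A.

Lemma nmul0r x : 0 ** x = 0.
Proof. by apply: (addrI (0 ** x)); rewrite -nmulDl !addr0. Qed.
Lemma nmulr0 x : x ** 0 = 0.
Proof. by apply: (addrI (x ** 0)); rewrite -nmulDr !addr0. Qed.
Lemma nmulNl x y : (- x) ** y = - (x ** y).
Proof. by apply: (addrI (x ** y)); rewrite -nmulDl !subrr nmul0r. Qed.
Lemma nmulNr x y : x ** (- y) = - (x ** y).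
Proof. by apply: (addrI (x ** y)); rewrite -nmulDr !subrr nmulr0. Qed.

End NuAlgebraTheory.

Definition nu_isomorphism (F : fieldType) (A B : nuAlgType F) (f : A -> B) :=
  [/\ linear f, {morph f : x y / x ** y} & bijective f].

Definition nu_isomorphic (F : fieldType) (A B : nuAlgType F) :=
  exists f : A -> B, nu_isomorphism f.

Record nuIdeal (F : fieldType) (A : nuAlgType F) := NuIdeal {
  ideal_pred :> {pred A};
  ideal_closed : submod_closed ideal_pred;
  absorbl : forall x y : A, y \in ideal_pred -> x ** y \in ideal_pred;
  absorbr : forall x y : A, x \in ideal_pred -> x ** y \in ideal_pred
}.

HB.instance Definition _ (F : fieldType) (A : nuAlgType F) (I : nuIdeal A) :=
  GRing.isSubmodClosed.Build F A (ideal_pred I) (ideal_closed I).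

Section IdealAlgebra.
Variables (F : fieldType) (A : nuAlgType F) (I : nuIdeal A).

Definition ideal_alg := {x : A | x \in I}.
Local Notation J := ideal_alg.

HB.instance Definition _ := SubChoice.on J.
HB.instance Definition _ := [SubChoice_isSubLmodule of J by <:].

Definition ideal_mul (x y : J) : J :=
  exist _ (val x ** val y) (absorbr (val y) (valP x)).

Fact ideal_mulA : associative ideal_mul.
Proof. by move=> x y z; apply: val_inj; rewrite /= nmulA. Qed.
Fact ideal_mulDl : left_distributive ideal_mul +%R.
Proof. by move=> x y z; apply: val_inj; rewrite /= nmulDl. Qed.
Fact ideal_mulDr : right_distributive ideal_mul +%R.
Proof. by move=> x y z; apply: val_inj; rewrite /= nmulDr. Qed.
Fact ideal_scaleAl (c : F) (x y : J) :
  c *: ideal_mul x y = ideal_mul (c *: x) y.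
Proof. by apply: val_inj; rewrite /= nscalerAl. Qed.
Fact ideal_scaleAr (c : F) (x y : J) :
  c *: ideal_mul x y = ideal_mul x (c *: y).
Proof. by apply: val_inj; rewrite /= nscalerAr. Qed.

HB.instance Definition _ := Lmodule_isNuAlgebra.Build F J
  ideal_mulA ideal_mulDl ideal_mulDr ideal_scaleAl ideal_scaleAr.

End IdealAlgebra.

Section QuotientAlgebra.
Variables (F : fieldType) (A : nuAlgType F) (I : nuIdeal A).

Definition quot_alg := Quotient.quot (ideal_pred I : zmodClosed A).
Local Notation Q := quot_alg.

HB.instance Definition _ := GRing.Zmodule.on Q.
HB.instance Definition _ := EqQuotient.on Q.

Fact quot_eqP (x y : A) : (\pi_Q x == \pi_Q y) = (x - y \in I).
Proof. by rewrite (@Quotient.idealrBE A (ideal_pred I : zmodClosed A)). Qed.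

Fact quot_piD (x y : A) : \pi_Q (x + y) = \pi_Q x + \pi_Q y.
Proof. exact: Quotient.pi_add. Qed.

Definition quot_scale (c : F) (x : Q) : Q := \pi_Q (c *: repr x).
Definition quot_mul (x y : Q) : Q := \pi_Q (repr x ** repr y).

Fact quot_reprB (x : A) : repr (\pi_Q x) - x \in I.
Proof. by rewrite -quot_eqP reprK. Qed.

Fact quot_piZ (c : F) (x : A) : quot_scale c (\pi_Q x) = \pi_Q (c *: x).
Proof.
apply/eqP; rewrite /quot_scale quot_eqP -scalerBr.
by apply: rpredZ; apply: quot_reprB.
Qed.

Fact quot_piM (x y : A) : quot_mul (\pi_Q x) (\pi_Q y) = \pi_Q (x ** y).
Proof.
apply/eqP; rewrite /quot_mul quot_eqP.
have -> : repr (\pi_Q x) ** repr (\pi_Q y) - x ** y =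
    (repr (\pi_Q x) - x) ** repr (\pi_Q y) + x ** (repr (\pi_Q y) - y).
  by rewrite nmulDl nmulDr nmulNl nmulNr addrA subrK.
by apply: rpredD; [apply: absorbr | apply: absorbl]; apply: quot_reprB.
Qed.

Fact quot_ind (P : Q -> Prop) : (forall x : A, P (\pi_Q x)) -> forall x, P x.
Proof. by move=> PP x; rewrite -[x]reprK. Qed.

Fact quot_scalerA (a b : F) (x : Q) :
  quot_scale a (quot_scale b x) = quot_scale (a * b) x.
Proof. by elim/quot_ind: x => x; rewrite !quot_piZ scalerA. Qed.
Fact quot_scale1r : left_id 1 quot_scale.
Proof. by elim/quot_ind=> x; rewrite quot_piZ scale1r. Qed.
Fact quot_scalerDr : right_distributive quot_scale +%R.
Proof.
move=> c; elim/quot_ind=> x; elim/quot_ind=> y.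
by rewrite -quot_piD !quot_piZ scalerDr quot_piD.
Qed.
Fact quot_scalerDl (x : Q) : {morph quot_scale^~ x : a b / a + b}.
Proof.
by elim/quot_ind: x => x a b; rewrite !quot_piZ scalerDl quot_piD.
Qed.

HB.instance Definition _ := GRing.Zmodule_isLmodule.Build F Q
  quot_scalerA quot_scale1r quot_scalerDr quot_scalerDl.

Fact quot_mulA : associative quot_mul.
Proof.
elim/quot_ind=> x; elim/quot_ind=> y; elim/quot_ind=> z.
by rewrite !quot_piM nmulA.
Qed.
Fact quot_mulDl : left_distributive quot_mul +%R.
Proof.
elim/quot_ind=> x; elim/quot_ind=> y; elim/quot_ind=> z.
by rewrite -quot_piD !quot_piM nmulDl quot_piD.
Qed.
Fact quot_mulDr : right_distributive quot_mul +%R.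
Proof.
elim/quot_ind=> x; elim/quot_ind=> y; elim/quot_ind=> z.
by rewrite -quot_piD !quot_piM nmulDr quot_piD.
Qed.
Fact quot_scaleAl (c : F) (x y : Q) : c *: quot_mul x y = quot_mul (c *: x) y.
Proof.
elim/quot_ind: x => x; elim/quot_ind: y => y.
by rewrite /GRing.scale /= quot_piM !quot_piZ quot_piM nscalerAl.
Qed.
Fact quot_scaleAr (c : F) (x y : Q) : c *: quot_mul x y = quot_mul x (c *: y).
Proof.
elim/quot_ind: x => x; elim/quot_ind: y => y.
by rewrite /GRing.scale /= quot_piM !quot_piZ quot_piM nscalerAr.
Qed.

HB.instance Definition _ := Lmodule_isNuAlgebra.Build F Q
  quot_mulA quot_mulDl quot_mulDr quot_scaleAl quot_scaleAr.

End QuotientAlgebra.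

Section Factor.
Variables (F : fieldType) (A : nuAlgType F) (J I : nuIdeal A).

Definition trace_pred : {pred ideal_alg J} := fun x => val x \in I.

Fact trace_closed : submod_closed trace_pred.
Proof.
split=> [|c x y xI yI]; first exact: (ideal_closed I).1.
exact: (ideal_closed I).2.
Qed.
Fact trace_absorbl (x y : ideal_alg J) :
  y \in trace_pred -> x ** y \in trace_pred.
Proof. exact: absorbl. Qed.
Fact trace_absorbr (x y : ideal_alg J) :
  x \in trace_pred -> x ** y \in trace_pred.
Proof. exact: absorbr. Qed.

(* The intersection of [I] and [J] as an ideal of the algebra [J], that is    *)
(* [I] itself when [I] is contained in [J].                                   *)
Definition trace_ideal : nuIdeal (ideal_alg J) :=
  NuIdeal trace_closed trace_absorbl trace_absorbr.

Definition factor_alg : nuAlgType F := quot_alg trace_ideal.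

End Factor.

Section DirectSum.
Variables (F : fieldType) (k : nat) (A : 'I_k -> nuAlgType F).

Definition dsum := forall i, A i.

HB.instance Definition _ := Choice.on dsum.

Definition dsum_add (x y : dsum) : dsum := fun i => x i + y i.
Definition dsum_opp (x : dsum) : dsum := fun i => - x i.
Definition dsum_scale (c : F) (x : dsum) : dsum := fun i => c *: x i.
Definition dsum_mul (x y : dsum) : dsum := fun i => x i ** y i.

Fact dsum_addA : associative dsum_add.
Proof. by move=> x y z; apply: functional_extensionality_dep=> i; apply: addrA. Qed.
Fact dsum_addC : commutative dsum_add.
Proof. by move=> x y; apply: functional_extensionality_dep=> i; apply: addrC. Qed.
Fact dsum_add0 : left_id (fun i => 0) dsum_add.
Proof. by move=> x; apply: functional_extensionality_dep=> i; apply: add0r. Qed.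
Fact dsum_addN : left_inverse (fun i => 0) dsum_opp dsum_add.
Proof. by move=> x; apply: functional_extensionality_dep=> i; apply: addNr. Qed.

HB.instance Definition _ :=
  GRing.isZmodule.Build dsum dsum_addA dsum_addC dsum_add0 dsum_addN.

Fact dsum_scalerA (a b : F) (x : dsum) :
  dsum_scale a (dsum_scale b x) = dsum_scale (a * b) x.
Proof. by apply: functional_extensionality_dep=> i; apply: scalerA. Qed.
Fact dsum_scale1r : left_id 1 dsum_scale.
Proof. by move=> x; apply: functional_extensionality_dep=> i; apply: scale1r. Qed.
Fact dsum_scalerDr : right_distributive dsum_scale +%R.
Proof.
by move=> c x y; apply: functional_extensionality_dep=> i; apply: scalerDr.
Qed.
Fact dsum_scalerDl (x : dsum) : {morph dsum_scale^~ x : a b / a + b}.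
Proof. by move=> a b; apply: functional_extensionality_dep=> i; apply: scalerDl. Qed.

HB.instance Definition _ := GRing.Zmodule_isLmodule.Build F dsum
  dsum_scalerA dsum_scale1r dsum_scalerDr dsum_scalerDl.

Fact dsum_mulA : associative dsum_mul.
Proof. by move=> x y z; apply: functional_extensionality_dep=> i; apply: nmulA. Qed.
Fact dsum_mulDl : left_distributive dsum_mul +%R.
Proof. by move=> x y z; apply: functional_extensionality_dep=> i; apply: nmulDl. Qed.
Fact dsum_mulDr : right_distributive dsum_mul +%R.
Proof. by move=> x y z; apply: functional_extensionality_dep=> i; apply: nmulDr. Qed.
Fact dsum_scaleAl (c : F) (x y : dsum) :
  c *: dsum_mul x y = dsum_mul (c *: x) y.
Proof. by apply: functional_extensionality_dep=> i; apply: nscalerAl. Qed.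
Fact dsum_scaleAr (c : F) (x y : dsum) :
  c *: dsum_mul x y = dsum_mul x (c *: y).
Proof. by apply: functional_extensionality_dep=> i; apply: nscalerAr. Qed.

HB.instance Definition _ := Lmodule_isNuAlgebra.Build F dsum
  dsum_mulA dsum_mulDl dsum_mulDr dsum_scaleAl dsum_scaleAr.

End DirectSum.

Section MatrixAlgebra.
Variables (F : fieldType) (R : algType F) (n : nat).

(* An alias of ['M[R]_n] carrying the [F]-linear structure instead of the     *)
(* canonical [R]-linear one.                                                  *)
Definition mx_alg := 'M[R]_n.

HB.instance Definition _ := GRing.Zmodule.on mx_alg.

Definition mx_alg_scale (c : F) (M : mx_alg) : mx_alg := \matrix_(i, j) (c *: M i j).

Fact mx_alg_scalerA (a b : F) (M : mx_alg) :
  mx_alg_scale a (mx_alg_scale b M) = mx_alg_scale (a * b) M.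
Proof. by apply/matrixP=> i j; rewrite !mxE scalerA. Qed.
Fact mx_alg_scale1r : left_id 1 mx_alg_scale.
Proof. by move=> M; apply/matrixP=> i j; rewrite !mxE scale1r. Qed.
Fact mx_alg_scalerDr : right_distributive mx_alg_scale +%R.
Proof. by move=> c M N; apply/matrixP=> i j; rewrite !mxE scalerDr. Qed.
Fact mx_alg_scalerDl (M : mx_alg) : {morph mx_alg_scale^~ M : a b / a + b}.
Proof. by move=> a b; apply/matrixP=> i j; rewrite !mxE scalerDl. Qed.

HB.instance Definition _ := GRing.Zmodule_isLmodule.Build F mx_alg
  mx_alg_scalerA mx_alg_scale1r mx_alg_scalerDr mx_alg_scalerDl.

Definition mx_alg_mul (M N : mx_alg) : mx_alg := M *m N.

Fact mx_alg_mulA : associative mx_alg_mul.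
Proof. by move=> L M N; apply: mulmxA. Qed.
Fact mx_alg_mulDl : left_distributive mx_alg_mul +%R.
Proof. by move=> L M N; apply: mulmxDl. Qed.
Fact mx_alg_mulDr : right_distributive mx_alg_mul +%R.
Proof. by move=> L M N; apply: mulmxDr. Qed.
Fact mx_alg_scaleAl (c : F) (M N : mx_alg) :
  c *: mx_alg_mul M N = mx_alg_mul (c *: M) N.
Proof.
apply/matrixP=> i j; rewrite !mxE scaler_sumr; apply: eq_bigr => k _.
by rewrite mxE scalerAl.
Qed.
Fact mx_alg_scaleAr (c : F) (M N : mx_alg) :
  c *: mx_alg_mul M N = mx_alg_mul M (c *: N).
Proof.
apply/matrixP=> i j; rewrite !mxE scaler_sumr; apply: eq_bigr => k _.
by rewrite mxE scalerAr.
Qed.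

HB.instance Definition _ := Lmodule_isNuAlgebra.Build F mx_alg
  mx_alg_mulA mx_alg_mulDl mx_alg_mulDr mx_alg_scaleAl mx_alg_scaleAr.

End MatrixAlgebra.

Section FinitaryMatrixAlgebra.
Variables (F : fieldType) (R : algType F).

Definition mx_support (f : nat -> nat -> R) : set (nat * nat) :=
  [set ij | f ij.1 ij.2 != 0].

Definition finitary (f : nat -> nat -> R) : bool := `[< finite_set (mx_support f) >].

Fact finitaryP (f : nat -> nat -> R) :
  reflect (exists N, forall i j, (N <= i)%N || (N <= j)%N -> f i j = 0)
          (f \in finitary).
Proof.
apply: (iffP (asboolP _)) => [/finite_seqP [s sE]|[N fN]].
  exists (\max_(ij <- s) (maxn ij.1 ij.2)).+1 => i j Nij.
  apply: contraPeq Nij => fij.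
  have ijs : (i, j) \in s.
    by have : mx_support f (i, j) by []; rewrite sE.
  have := @leq_bigmax_seq _ s xpredT (fun ij => maxn ij.1 ij.2) (i, j) ijs isT.
  by rewrite /= geq_max => /andP[le_i le_j]; rewrite !ltnNge le_i le_j.
apply: (@sub_finite_set _ _
  [set` [seq (i, j) | i <- iota 0 N, j <- iota 0 N]]) => [[i j]|]; last first.
  exact: finite_seq.
rewrite /mx_support /= => fij; apply/allpairsP; exists (i, j); rewrite /=.
by rewrite !mem_iota /= !add0n; split=> //; rewrite ltnNge;
  apply: contraNN fij => le; rewrite fN // le ?orbT.
Qed.

Fact finitary_closed : submod_closed finitary.
Proof.
split=> [|c f g /finitaryP[N fN] /finitaryP[M gM]]; apply/finitaryP.
  by exists 0%N.
exists (maxn N M) => i j; rewrite !geq_max => ij.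
have -> : (c *: f + g) i j = c *: f i j + g i j by [].
rewrite fN ?gM ?scaler0 ?addr0 //; case/orP: ij => /andP[Ni Mi];
  by rewrite ?Ni ?Mi ?orbT.
Qed.

HB.instance Definition _ :=
  GRing.isSubmodClosed.Build F (nat -> nat -> R) finitary finitary_closed.

(* Rows and columns are indexed from [0].                                     *)
Definition mxoo_alg := {f : nat -> nat -> R | f \in finitary}.

HB.instance Definition _ := SubChoice.on mxoo_alg.
HB.instance Definition _ := [SubChoice_isSubLmodule of mxoo_alg by <:].

Definition mxoo_mulf (f g : nat -> nat -> R) (i j : nat) : R :=
  \sum_(k \in [set: nat]) f i k * g k j.

Fact mxoo_mulfE N (f g : nat -> nat -> R) i j :
    (forall k, (N <= k)%N -> f i k = 0) ->
  mxoo_mulf f g i j = \sum_(k < N) f i k * g k j.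
Proof.
move=> fN; rewrite (fsbig_ord _ _ (fun k => f i k * g k j)).
apply/esym/fsbig_widen => // k [_ /negP]; rewrite -leqNgt => Nk.
by rewrite /preimage /= fN ?mul0r.
Qed.

Fact mxoo_mulf_finitary (f g : mxoo_alg) : mxoo_mulf (val f) (val g) \in finitary.
Proof.
have [N fN] := finitaryP _ (valP f); have [M gM] := finitaryP _ (valP g).
apply/finitaryP; exists (maxn N M) => i j ij.
rewrite (@mxoo_mulfE N); last by move=> k Nk; rewrite fN ?Nk ?orbT.
apply: big1 => k _; move: ij; rewrite !geq_max => /orP[/andP[Ni _]|/andP[_ Mj]].
  by rewrite fN ?Ni ?mul0r.
by rewrite gM ?Mj ?orbT ?mulr0.
Qed.

Definition mxoo_mul (f g : mxoo_alg) : mxoo_alg :=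
  exist _ (mxoo_mulf (val f) (val g)) (mxoo_mulf_finitary f g).

Fact mxoo_mulE N (f g : mxoo_alg) i j :
    (forall i k, (N <= i)%N || (N <= k)%N -> val f i k = 0) ->
  val (mxoo_mul f g) i j = \sum_(k < N) val f i k * val g k j.
Proof.
by move=> fN; rewrite /= (@mxoo_mulfE N) // => k Nk; rewrite fN ?Nk ?orbT.
Qed.

Fact mxoo_valP (f : mxoo_alg) :
  exists N, forall i j, (N <= i)%N || (N <= j)%N -> val f i j = 0.
Proof. exact/finitaryP/(valP f). Qed.

Fact mxoo_eqP (f g : mxoo_alg) : (forall i j, val f i j = val g i j) -> f = g.
Proof. by move=> fg; apply: val_inj; apply/funext=> i; apply/funext=> j. Qed.

Fact mxoo_addE (f g : mxoo_alg) i j : val (f + g) i j = val f i j + val g i j.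
Proof. by []. Qed.
Fact mxoo_scaleE (c : F) (f : mxoo_alg) i j : val (c *: f) i j = c *: val f i j.
Proof. by []. Qed.

Fact mxoo_mulA : associative mxoo_mul.
Proof.
move=> f g h; have [N fN] := mxoo_valP f; have [M gM] := mxoo_valP g.
have fgN : forall i k, (maxn N M <= i)%N || (maxn N M <= k)%N ->
    val (mxoo_mul f g) i k = 0.
  move=> i k; rewrite !geq_max => ik; rewrite (@mxoo_mulE N) //.
  apply: big1 => l _; case/orP: ik => /andP[Ni Mk].
    by rewrite fN ?Ni ?mul0r.
  by rewrite gM ?Mk ?orbT ?mulr0.
apply: mxoo_eqP => i j; rewrite (@mxoo_mulE N) // (@mxoo_mulE (maxn N M)) //.
under eq_bigr => k _ do rewrite (@mxoo_mulE M) // mulr_sumr.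
under [RHS]eq_bigr => k _ do rewrite (@mxoo_mulE N) // mulr_suml.
rewrite [RHS]exchange_big /=; apply: eq_bigr => k _.
rewrite (big_ord_widen_cond _ xpredT (fun l => val f i k * (val g k l * val h l j))
  (leq_maxr N M)) big_mkcond /=.
apply: eq_bigr => l _; rewrite mulrA; case: ltnP => // Ml.
by rewrite gM ?Ml ?orbT // mulr0 mul0r.
Qed.

Fact mxoo_mulDl : left_distributive mxoo_mul +%R.
Proof.
move=> f g h; have [N fN] := mxoo_valP f; have [M gM] := mxoo_valP g.
have wf i k : (maxn N M <= i)%N || (maxn N M <= k)%N -> val f i k = 0.
  by rewrite !geq_max => /orP[]/andP[Nx _]; rewrite fN ?Nx ?orbT.
have wg i k : (maxn N M <= i)%N || (maxn N M <= k)%N -> val g i k = 0.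
  by rewrite !geq_max => /orP[]/andP[_ Mx]; rewrite gM ?Mx ?orbT.
apply: mxoo_eqP => i j; rewrite mxoo_addE !(@mxoo_mulE (maxn N M)) //; last first.
  by move=> {}i k ik; rewrite mxoo_addE wf ?wg ?addr0.
by rewrite -big_split; apply: eq_bigr => k _; rewrite mxoo_addE mulrDl.
Qed.

Fact mxoo_mulDr : right_distributive mxoo_mul +%R.
Proof.
move=> f g h; have [N fN] := mxoo_valP f.
apply: mxoo_eqP => i j; rewrite mxoo_addE !(@mxoo_mulE N) // -big_split.
by apply: eq_bigr => k _; rewrite mxoo_addE mulrDr.
Qed.

Fact mxoo_scaleAl (c : F) (f g : mxoo_alg) :
  c *: mxoo_mul f g = mxoo_mul (c *: f) g.
Proof.
have [N fN] := mxoo_valP f.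
apply: mxoo_eqP => i j; rewrite mxoo_scaleE !(@mxoo_mulE N) //; last first.
  by move=> {}i k ik; rewrite mxoo_scaleE fN ?scaler0.
by rewrite scaler_sumr; apply: eq_bigr => k _; rewrite mxoo_scaleE scalerAl.
Qed.

Fact mxoo_scaleAr (c : F) (f g : mxoo_alg) :
  c *: mxoo_mul f g = mxoo_mul f (c *: g).
Proof.
have [N fN] := mxoo_valP f.
apply: mxoo_eqP => i j; rewrite mxoo_scaleE !(@mxoo_mulE N) // scaler_sumr.
by apply: eq_bigr => k _; rewrite mxoo_scaleE scalerAr.
Qed.

HB.instance Definition _ := Lmodule_isNuAlgebra.Build F mxoo_alg
  mxoo_mulA mxoo_mulDl mxoo_mulDr mxoo_scaleAl mxoo_scaleAr.

End FinitaryMatrixAlgebra.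

Section Laurent.
Variable F : fieldType.
Local Notation K := {fraction {poly F}}.

(* F[t^-1, t], realized as the subring of the fractions p / t^n in F(t).      *)
Definition laurent_pred : {pred K} :=
  fun x => `[< exists (p : {poly F}) (n : nat), x = tofrac p / tofrac 'X^n >].

Fact laurentP x :
  reflect (exists (p : {poly F}) (n : nat), x = tofrac p / tofrac 'X^n)
          (x \in laurent_pred).
Proof. exact: asboolP. Qed.

Fact laurent_closed : subring_closed laurent_pred.
Proof.
have Xn0 n : tofrac 'X^n != 0 :> K by rewrite tofrac_eq0 monic_neq0 ?monicXn.
split=> [|x y /laurentP[p [n ->]] /laurentP[q [m ->]]
         |x y /laurentP[p [n ->]] /laurentP[q [m ->]]]; apply/laurentP.
- by exists 1, 0%N; rewrite expr0 tofrac1 divr1.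
- exists (p * 'X^m - q * 'X^n), (n + m)%N.
  rewrite exprD tofracB !tofracM mulrBl invfM; congr (_ - _).
    by rewrite mulrACA divff ?mulr1.
  by rewrite [(tofrac _)^-1 * _]mulrC mulrACA divff ?mulr1.
- by exists (p * q), (n + m)%N; rewrite exprD !tofracM invfM mulrACA.
Qed.

HB.instance Definition _ :=
  GRing.isSubringClosed.Build K laurent_pred laurent_closed.

Definition laurent := {x : K | x \in laurent_pred}.

HB.instance Definition _ := SubChoice.on laurent.
HB.instance Definition _ := [SubChoice_isSubComNzRing of laurent by <:].

Fact laurent_polyC_subproof (c : F) : tofrac c%:P \in laurent_pred.
Proof. by apply/laurentP; exists c%:P, 0%N; rewrite expr0 tofrac1 divr1. Qed.

Definition laurentC (c : F) : laurent :=
  exist _ (tofrac c%:P) (laurent_polyC_subproof c).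

Definition laurent_scale (c : F) (x : laurent) : laurent := laurentC c * x.

Fact laurent_scaleE c x : val (laurent_scale c x) = tofrac c%:P * val x.
Proof. by []. Qed.

Fact laurent_scalerA (a b : F) (x : laurent) :
  laurent_scale a (laurent_scale b x) = laurent_scale (a * b) x.
Proof.
by apply: val_inj; rewrite !laurent_scaleE polyCM tofracM mulrA.
Qed.
Fact laurent_scale1r : left_id 1 laurent_scale.
Proof. by move=> x; apply: val_inj; rewrite laurent_scaleE tofrac1 mul1r. Qed.
Fact laurent_scalerDr : right_distributive laurent_scale +%R.
Proof. by move=> c x y; apply: mulrDr. Qed.
Fact laurent_scalerDl (x : laurent) : {morph laurent_scale^~ x : a b / a + b}.
Proof.
move=> a b; apply: val_inj.
by rewrite laurent_scaleE polyCD tofracD mulrDl.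
Qed.

HB.instance Definition _ := GRing.Zmodule_isLmodule.Build F laurent
  laurent_scalerA laurent_scale1r laurent_scalerDr laurent_scalerDl.

Fact laurent_scalerAl (c : F) (x y : laurent) : c *: (x * y) = (c *: x) * y.
Proof. exact: mulrA. Qed.

HB.instance Definition _ :=
  GRing.Lmodule_isLalgebra.Build F laurent laurent_scalerAl.
HB.instance Definition _ := GRing.Lalgebra_isComAlgebra.Build F laurent.

End Laurent.

(* [Some n] stands for the size [n.+1], and [None] for the size [oo].         *)
Definition mx_block (F : fieldType) (R : algType F) (sz : option nat) :
    nuAlgType F :=
  if sz is Some n then mx_alg R n.+1 else mxoo_alg R.

Definition sum_of_mx_blocks (F : fieldType) (R : algType F) (A : nuAlgType F) :=
  exists (k : nat) (sz : 'I_k -> option nat),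
    nu_isomorphic A (dsum (fun i => mx_block R (sz i))).

Section Presentation.
Variables (F : fieldType) (X : Type).

Inductive term :=
| Gen of X
| Zero
| Opp of term
| Add of term & term
| Scale of F & term
| Mul of term & term.

HB.instance Definition _ := gen_eqMixin term.
HB.instance Definition _ := gen_choiceMixin term.

Variable R : term -> term -> Prop.

(* The least congruence containing [R] and the axioms of associative,         *)
(* possibly non-unital algebras.                                              *)
Inductive pcongr : term -> term -> Prop :=
| pc_rel t u : R t u -> pcongr t u
| pc_refl t : pcongr t t
| pc_sym t u : pcongr t u -> pcongr u t
| pc_trans t u v : pcongr t u -> pcongr u v -> pcongr t v
| pc_opp t u : pcongr t u -> pcongr (Opp t) (Opp u)
| pc_add t t' u u' : pcongr t t' -> pcongr u u' -> pcongr (Add t u) (Add t' u')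
| pc_scale c t u : pcongr t u -> pcongr (Scale c t) (Scale c u)
| pc_mul t t' u u' : pcongr t t' -> pcongr u u' -> pcongr (Mul t u) (Mul t' u')
| pc_addA t u v : pcongr (Add t (Add u v)) (Add (Add t u) v)
| pc_addC t u : pcongr (Add t u) (Add u t)
| pc_add0 t : pcongr (Add Zero t) t
| pc_addN t : pcongr (Add (Opp t) t) Zero
| pc_scaleA a b t : pcongr (Scale a (Scale b t)) (Scale (a * b) t)
| pc_scale1 t : pcongr (Scale 1 t) t
| pc_scaleDr c t u : pcongr (Scale c (Add t u)) (Add (Scale c t) (Scale c u))
| pc_scaleDl a b t : pcongr (Scale (a + b) t) (Add (Scale a t) (Scale b t))
| pc_mulA t u v : pcongr (Mul t (Mul u v)) (Mul (Mul t u) v)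
| pc_mulDl t u v : pcongr (Mul (Add t u) v) (Add (Mul t v) (Mul u v))
| pc_mulDr t u v : pcongr (Mul t (Add u v)) (Add (Mul t u) (Mul t v))
| pc_scaleAl c t u : pcongr (Scale c (Mul t u)) (Mul (Scale c t) u)
| pc_scaleAr c t u : pcongr (Scale c (Mul t u)) (Mul t (Scale c u)).

Definition pcongrb (t u : term) : bool := `[< pcongr t u >].

Fact pcongrb_is_equiv : equiv_class_of pcongrb.
Proof.
split=> [t|t u|u t v]; first exact/asboolP/pc_refl.
  by apply/asboolP/asboolP; apply: pc_sym.
by move=> /asboolP tu /asboolP uv; apply/asboolP; apply: pc_trans tu uv.
Qed.

Canonical pcongrb_equiv := EquivRelPack pcongrb_is_equiv.
Canonical pcongrb_encModRel := defaultEncModRel pcongrb.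

Definition presented := {eq_quot pcongrb}.
Local Notation P := presented.

HB.instance Definition _ : EqQuotient term pcongrb P := EqQuotient.on P.
HB.instance Definition _ := Choice.on P.

Fact pres_piP (t u : term) : \pi_P t = \pi_P u <-> pcongr t u.
Proof.
split=> [/eqP|tu]; first by rewrite piE => /asboolP.
by apply/eqP; rewrite piE; apply/asboolP.
Qed.

Definition pres_opp (x : P) : P := \pi_P (Opp (repr x)).
Definition pres_add (x y : P) : P := \pi_P (Add (repr x) (repr y)).
Definition pres_scale (c : F) (x : P) : P := \pi_P (Scale c (repr x)).
Definition pres_mul (x y : P) : P := \pi_P (Mul (repr x) (repr y)).

Fact pres_repr t : pcongr (repr (\pi_P t)) t.
Proof. by apply/pres_piP; rewrite reprK. Qed.

Fact pres_piN t : pres_opp (\pi_P t) = \pi_P (Opp t).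
Proof. by apply/pres_piP/pc_opp/pres_repr. Qed.
Fact pres_piD t u : pres_add (\pi_P t) (\pi_P u) = \pi_P (Add t u).
Proof. by apply/pres_piP; apply: pc_add; apply: pres_repr. Qed.
Fact pres_piZ c t : pres_scale c (\pi_P t) = \pi_P (Scale c t).
Proof. by apply/pres_piP/pc_scale/pres_repr. Qed.
Fact pres_piM t u : pres_mul (\pi_P t) (\pi_P u) = \pi_P (Mul t u).
Proof. by apply/pres_piP; apply: pc_mul; apply: pres_repr. Qed.

Let piE := (pres_piN, pres_piD, pres_piZ, pres_piM).

Fact pres_ind (Q : P -> Prop) : (forall t, Q (\pi_P t)) -> forall x, Q x.
Proof. by move=> Qpi x; rewrite -[x]reprK. Qed.

Fact pres_addA : associative pres_add.
Proof.
elim/pres_ind=> t; elim/pres_ind=> u; elim/pres_ind=> v.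
by rewrite !piE; apply/pres_piP/pc_addA.
Qed.
Fact pres_addC : commutative pres_add.
Proof.
by elim/pres_ind=> t; elim/pres_ind=> u; rewrite !piE; apply/pres_piP/pc_addC.
Qed.
Fact pres_add0 : left_id (\pi_P Zero) pres_add.
Proof. by elim/pres_ind=> t; rewrite !piE; apply/pres_piP/pc_add0. Qed.
Fact pres_addN : left_inverse (\pi_P Zero) pres_opp pres_add.
Proof. by elim/pres_ind=> t; rewrite !piE; apply/pres_piP/pc_addN. Qed.

HB.instance Definition _ :=
  GRing.isZmodule.Build P pres_addA pres_addC pres_add0 pres_addN.

Fact pres_scalerA (a b : F) (x : P) :
  pres_scale a (pres_scale b x) = pres_scale (a * b) x.
Proof. by elim/pres_ind: x => t; rewrite !piE; apply/pres_piP/pc_scaleA. Qed.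
Fact pres_scale1r : left_id 1 pres_scale.
Proof. by elim/pres_ind=> t; rewrite !piE; apply/pres_piP/pc_scale1. Qed.
Fact pres_scalerDr : right_distributive pres_scale +%R.
Proof.
move=> c; elim/pres_ind=> t; elim/pres_ind=> u.
by rewrite /GRing.add /= !piE; apply/pres_piP/pc_scaleDr.
Qed.
Fact pres_scalerDl (x : P) : {morph pres_scale^~ x : a b / a + b}.
Proof.
elim/pres_ind: x => t a b.
by rewrite /(_ + _ : P) /= !piE; apply/pres_piP/pc_scaleDl.
Qed.

HB.instance Definition _ := GRing.Zmodule_isLmodule.Build F P
  pres_scalerA pres_scale1r pres_scalerDr pres_scalerDl.

Fact pres_mulA : associative pres_mul.
Proof.
elim/pres_ind=> t; elim/pres_ind=> u; elim/pres_ind=> v.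
by rewrite !piE; apply/pres_piP/pc_mulA.
Qed.
Fact pres_mulDl : left_distributive pres_mul +%R.
Proof.
elim/pres_ind=> t; elim/pres_ind=> u; elim/pres_ind=> v.
by rewrite /GRing.add /= !piE; apply/pres_piP/pc_mulDl.
Qed.
Fact pres_mulDr : right_distributive pres_mul +%R.
Proof.
elim/pres_ind=> t; elim/pres_ind=> u; elim/pres_ind=> v.
by rewrite /GRing.add /= !piE; apply/pres_piP/pc_mulDr.
Qed.
Fact pres_scaleAl (c : F) (x y : P) : c *: pres_mul x y = pres_mul (c *: x) y.
Proof.
elim/pres_ind: x => t; elim/pres_ind: y => u.
by rewrite /GRing.scale /= !piE; apply/pres_piP/pc_scaleAl.
Qed.
Fact pres_scaleAr (c : F) (x y : P) : c *: pres_mul x y = pres_mul x (c *: y).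
Proof.
elim/pres_ind: x => t; elim/pres_ind: y => u.
by rewrite /GRing.scale /= !piE; apply/pres_piP/pc_scaleAr.
Qed.

HB.instance Definition _ := Lmodule_isNuAlgebra.Build F P
  pres_mulA pres_mulDl pres_mulDr pres_scaleAl pres_scaleAr.

End Presentation.

Arguments Zero {F X}.

Record digraph := Digraph {
  vertex : finType;
  edge : finType;
  esource : edge -> vertex;
  erange : edge -> vertex
}.

Section Leavitt.
Variables (F : fieldType) (G : digraph).

Inductive leavitt_gen :=
| Vertex of vertex G
| Edge of edge G
| Ghost of edge G.

Local Notation T := (term F leavitt_gen).

Definition tv (v : vertex G) : T := Gen F (Vertex v).
Definition te (e : edge G) : T := Gen F (Edge e).
Definition ts (e : edge G) : T := Gen F (Ghost e).

Inductive leavitt_rel : T -> T -> Prop :=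
| lr_vertex v w :
    leavitt_rel (Mul (tv v) (tv w)) (if v == w then tv v else Zero)
| lr_source_edge e : leavitt_rel (Mul (tv (esource e)) (te e)) (te e)
| lr_edge_range e : leavitt_rel (Mul (te e) (tv (erange e))) (te e)
| lr_range_ghost e : leavitt_rel (Mul (tv (erange e)) (ts e)) (ts e)
| lr_ghost_source e : leavitt_rel (Mul (ts e) (tv (esource e))) (ts e)
| lr_ghost_edge e f :
    leavitt_rel (Mul (ts e) (te f)) (if e == f then tv (erange e) else Zero)
| lr_not_sink v : (exists e : edge G, esource e = v) ->
    leavitt_rel (tv v)
      (\big[@Add F leavitt_gen/Zero]_(e : edge G | esource e == v)
         Mul (te e) (ts e)).

Definition leavitt : nuAlgType F := presented leavitt_rel.

End Leavitt.

Section Growth.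
Variables (F : fieldType) (A : nuAlgType F).
Implicit Types S W : set A.

Definition is_subspace W :=
  W 0 /\ forall (c : F) (x y : A), W x -> W y -> W (c *: x + y).

Definition lin_span S : set A :=
  [set x | forall W, is_subspace W -> S `<=` W -> W x].

Definition has_dim W (d : nat) := exists b : 'I_d -> A,
  (forall c : 'I_d -> F, \sum_i c i *: b i = 0 -> forall i, c i = 0) /\
  W = [set x | exists c : 'I_d -> F, x = \sum_i c i *: b i].

Definition generates S := forall B : set A,
  is_subspace B -> (forall x y, B x -> B y -> B (x ** y)) -> S `<=` B -> B = setT.

(* Products of at least one and at most [n] elements of [S].                  *)
Definition products S (n : nat) : set A :=
  [set z | exists (x : A) (s : seq A), [/\ (size s < n)%N, S x,
     {in s, forall y, S y} & z = foldl (fun y y' => y ** y') x s]].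

Definition polynomial_growth := exists S : set A,
  [/\ exists m, has_dim S m, generates S &
      exists p : {poly rat}, forall n, exists d,
        has_dim (lin_span (products S n)) d /\ d%:R <= p.[n%:R]].

End Growth.

(* Main.v *)
Require Import Defs.
From mathcomp Require Import all_boot all_order all_algebra.
From mathcomp Require Import generic_quotient fraction zify.
From mathcomp Require Import boolp classical_sets functions cardinality.

(** The growth hypothesis enters only through [growth_disjoint_cycles]: if two
    cycles had a common vertex, two closed paths would generate a free monoid
    and the algebra would grow exponentially. So distinct cycles have no common
    vertex, and each class of mutually reachable vertices is a single vertex or
    the set of vertices of a cycle.

    A hereditary set [H] of vertices generates an ideal, [videal], spanned by
    the monomials p q^* whose paths p and q end at the same vertex of [H]. The
    chain consists of such ideals. It is built from the top: [lower H] removes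
    from [H] what leads to a maximal cycle of [H], and the sets [layer j],
    obtained from the set of all vertices by iterating [lower], shrink until no
    cycle is left. Their ideals, in reverse order, are the ideals of the
    theorem.

    Modulo the ideal of [lower H], a maximal cycle c of [H] has no exit, hence
    c c^* = v at its base v, and every monomial of the ideal of [H] reduces to a
    combination of elements p c^m q^* with m an integer and c one of these
    cycles, where the paths p and q reach v only at their end. For each c these elements
      multiply like matrix units times powers of t, so
    they should form a matrix algebra over Laurent polynomials, of size the
    number of paths p. Their independence comes from a representation: the
    algebra acts on functions of maximal paths, and turning around c is made to
    act as t. The entries of this action on the maximal paths p c c c ... give
    the isomorphism; [matrix_units] isolates what is needed, [leavitt_units]
    proves it, and [matrix_units_factor] draws the conclusion. In the last
    layer the same argument, with sinks in place of cycles and scalars in place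
    of Laurent polynomials, describes the smallest ideal.

    Invariance holds because each ideal of the chain has a description in terms
    of the algebra alone. The smallest one is the span of the elements x with
    x L x contained in F x: a nonzero Laurent coefficient of such an x would
    be a scalar, and so would its product with t. Given a term J, the next term
    is the smallest ideal K that contains the last term of the chain and makes
    J Dedekind finite: x y = v implies y x = v modulo K for x, y in the corner
    of an idempotent v of J. The next term has this property since matrices
    over a commutative ring are Dedekind finite ([chain_dedekind]); conversely
    c^* c = v forces c c^* = v modulo K for each cycle c in J, which puts the
    ranges of all exits into K ([vert_exit], [chain_min]). *)

Set Implicit Arguments.
Unset Strict Implicit.
Unset Printing Implicit Defensive.

Import GRing.Theory.

Local Open Scope classical_set_scope.
Local Open Scope ring_scope.
Local Open Scope quotient_scope.

(** * Linear spans in algebras without unit *)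

Section Spans.
Variables (F : fieldType) (A : nuAlgType F).
Implicit Types (S W : set A) (x y : A).

Lemma subspace0 W : is_subspace W -> W 0.
Proof. by case. Qed.

Lemma subspaceD W x y : is_subspace W -> W x -> W y -> W (x + y).
Proof. by move=> [_ WP] Wx Wy; rewrite -[x]scale1r; apply: WP. Qed.

Lemma subspaceZ W c x : is_subspace W -> W x -> W (c *: x).
Proof. by move=> [W0 WP] Wx; rewrite -[c *: x]addr0; apply: WP. Qed.

Lemma subspaceN W x : is_subspace W -> W x -> W (- x).
Proof. by move=> sW Wx; rewrite -scaleN1r; apply: subspaceZ. Qed.

Lemma subspace_sum W (I : Type) (r : seq I) (P : pred I) (f : I -> A) :
  is_subspace W -> (forall i, P i -> W (f i)) -> W (\sum_(i <- r | P i) f i).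
Proof.
by move=> sW Wf; elim/big_ind: _ => //;
  [apply: subspace0 | move=> x y; apply: subspaceD].
Qed.

Lemma lin_span_subspace S : is_subspace (lin_span S).
Proof.
split=> [W [] //|c x y Sx Sy W sW SW].
by apply: sW.2; [apply: Sx | apply: Sy].
Qed.

Lemma lin_span_in S : S `<=` lin_span S.
Proof. by move=> x Sx W _; apply. Qed.

Lemma lin_span_min S W : is_subspace W -> S `<=` W -> lin_span S `<=` W.
Proof. by move=> sW SW x; apply. Qed.

Lemma lin_spanS S S' : S `<=` S' -> lin_span S `<=` lin_span S'.
Proof.
move=> SS'; apply: lin_span_min; first exact: lin_span_subspace.
by move=> x /SS'; apply: lin_span_in.
Qed.

Lemma ideal_subspace (I : nuIdeal A) : is_subspace [set x | x \in I].
Proof. by split=> [|c x y xI yI] /=; [apply: rpred0|apply: rpredD => //; apply: rpredZ]. Qed.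

Lemma nmulBr x y z : z ** (x - y) = z ** x - z ** y.
Proof. by rewrite nmulDr nmulNr. Qed.

Lemma nmul_suml (I : Type) (r : seq I) (P : pred I) (f : I -> A) x :
  (\sum_(i <- r | P i) f i) ** x = \sum_(i <- r | P i) f i ** x.
Proof. by apply: (big_morph (fun y => y ** x)) => [y z|]; rewrite ?nmulDl ?nmul0r. Qed.

Lemma nmul_sumr (I : Type) (r : seq I) (P : pred I) (f : I -> A) x :
  x ** (\sum_(i <- r | P i) f i) = \sum_(i <- r | P i) x ** f i.
Proof. by apply: (big_morph (fun y => x ** y)) => [y z|]; rewrite ?nmulDr ?nmulr0. Qed.

Lemma nmul_subspacel W x : is_subspace W -> is_subspace [set y | W (x ** y)].
Proof.
move=> sW; split=> [|c y z Wy Wz] /=; first by rewrite nmulr0; apply: subspace0.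
by rewrite nmulDr -nscalerAr; apply: sW.2.
Qed.

Lemma nmul_subspacer W x : is_subspace W -> is_subspace [set y | W (y ** x)].
Proof.
move=> sW; split=> [|c y z Wy Wz] /=; first by rewrite nmul0r; apply: subspace0.
by rewrite nmulDl -nscalerAl; apply: sW.2.
Qed.

End Spans.

(** * Paths, reachability and hereditary sets *)

Section Paths.
Variable G : digraph.
Local Notation V := (vertex G).
Local Notation E := (edge G).
Implicit Types (u v w : V) (e f : E) (p q r : seq E).

(** Paths are lists of edges with a given end [w], which is also the source
    of the empty path. *)
Definition src p w := if p is e :: _ then esource e else w.
Fixpoint ispath p w := if p is e :: q then (erange e == src q w) && ispath q w else true.

Definition adj u v := [exists e, (esource e == u) && (erange e == v)].
Definition reach := connect adj.
Definition cyclic v := [exists e, (esource e == v) && reach (erange e) v].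

Lemma src_cat p q w : src (p ++ q) w = src p (src q w).
Proof. by case: p. Qed.

Lemma ispath_cat p q w : ispath (p ++ q) w = ispath p (src q w) && ispath q w.
Proof. by elim: p => //= e p ->; rewrite src_cat andbA. Qed.

Lemma ispath_rcons p e w : ispath (rcons p e) w = ispath p (esource e) && (erange e == w).
Proof. by rewrite -cats1 ispath_cat /= andbT. Qed.

Lemma reach_refl v : reach v v. Proof. exact: connect0. Qed.
Lemma reach_trans : transitive reach. Proof. exact: connect_trans. Qed.

Lemma reach_edge e : reach (esource e) (erange e).
Proof. by apply: connect1; apply/existsP; exists e; rewrite !eqxx. Qed.

Lemma reach_edge_trans e v : reach (erange e) v -> reach (esource e) v.
Proof. exact/reach_trans/reach_edge. Qed.

Lemma ispath_reach p w : ispath p w -> reach (src p w) w.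
Proof.
elim: p => [|e p IH] /=; first by rewrite reach_refl.
by move=> /andP[/eqP ep /IH rp]; apply: reach_edge_trans; rewrite ep.
Qed.

Lemma reachP u w : reflect (exists2 p, ispath p w & src p w = u) (reach u w).
Proof.
apply: (iffP idP) => [/connectP[p]|[p pp <-]]; last exact: ispath_reach.
elim: p u => [|x p IH] u /=; first by move=> _ ->; exists [::].
move=> /andP[/existsP[e /andP[/eqP <- /eqP ex]] /IH{}IH /IH[q qp qx]].
by exists (e :: q); rewrite //= ex qx eqxx qp.
Qed.

Lemma reach_step u w : reach u w -> u = w \/ exists2 e, esource e = u & reach (erange e) w.
Proof.
move=> /reachP[[|e p] /= pp <-]; first by left.
by right; exists e => //; case/andP: pp => /eqP -> /ispath_reach.
Qed.

Lemma cyclicP v : reflect (exists2 e, esource e = v & reach (erange e) v) (cyclic v).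
Proof.
by apply: (iffP existsP) => [[e /andP[/eqP]]|[e ? ?]]; exists e => //; apply/andP; split=> //;
  apply/eqP.
Qed.

Lemma cyclic_back u w : reach u w -> reach w u -> cyclic u || (u == w).
Proof.
move=> /reach_step[->|[e <- ew] wu]; first by rewrite eqxx orbT.
by apply/orP; left; apply/cyclicP; exists e => //; apply: reach_trans wu.
Qed.

Lemma cyclic_class u w : reach u w -> reach w u -> cyclic w -> cyclic u.
Proof. by move=> uw wu cw; case/orP: (cyclic_back uw wu) => // /eqP->. Qed.

Lemma reach_lt e : ~~ cyclic (esource e) ->
  (#|[pred x | reach (erange e) x]| < #|[pred x | reach (esource e) x]|)%N.
Proof.
move=> nc; apply: proper_card; apply/properP; split.
  by apply/fintype.subsetP=> x; rewrite !inE; apply: reach_edge_trans.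
exists (esource e); rewrite !inE ?reach_refl //; apply: contra nc => ?.
by apply/cyclicP; exists e.
Qed.

Definition hereditary (H : {set V}) := forall e, esource e \in H -> erange e \in H.

Lemma hereditary_reach (H : {set V}) u w : hereditary H -> reach u w -> u \in H -> w \in H.
Proof.
move=> hH /reachP[p pp <-]; elim: p pp => //= e p IH /andP[/eqP ep /IH{}IH] /hH.
by rewrite ep.
Qed.

Definition sink v := [forall e : E, esource e != v].

Lemma sinkP v : reflect (forall e, esource e <> v) (sink v).
Proof. by apply: (iffP forallP) => vs e; apply/eqP. Qed.

Lemma not_sink v : ~~ sink v -> exists e, esource e = v.
Proof. by move=> /forallPn[e]; rewrite negbK => /eqP; exists e. Qed.

Lemma sink_path p w v : sink v -> src p w = v -> p = [::].
Proof. by move=> /sinkP vs; case: p => //= e p /vs. Qed.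

End Paths.

(** * Monomials and the ideals generated by vertices *)

Section Monomials.
Variables (F : fieldType) (G : digraph).
Local Notation V := (vertex G).
Local Notation E := (edge G).
Local Notation L := (leavitt F G).
Implicit Types (u v w : V) (e f : E) (p q r : seq E) (x y z : L) (H : {set V}).

Definition vert v : L := \pi_L (tv F v).
Definition arrow e : L := \pi_L (te F e).
Definition ghost e : L := \pi_L (ts F e).

Lemma pi_rel (t u : term F (leavitt_gen G)) : leavitt_rel t u -> \pi_L t = \pi_L u.
Proof. by move=> tu; apply/pres_piP/pc_rel. Qed.
Lemma piM (t u : term F (leavitt_gen G)) : \pi_L (Mul t u) = \pi_L t ** \pi_L u.
Proof. by rewrite -pres_piM. Qed.
Lemma piD (t u : term F (leavitt_gen G)) : \pi_L (Add t u) = \pi_L t + \pi_L u.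
Proof. by rewrite -pres_piD. Qed.
Lemma piZ c (t : term F (leavitt_gen G)) : \pi_L (Scale c t) = c *: \pi_L t.
Proof. by rewrite -pres_piZ. Qed.
Lemma piN (t : term F (leavitt_gen G)) : \pi_L (Opp t) = - \pi_L t.
Proof. by rewrite -pres_piN. Qed.
Lemma pi0 : \pi_L Zero = 0 :> L. Proof. by []. Qed.

Lemma vertM v w : vert v ** vert w = if v == w then vert v else 0.
Proof. by rewrite -piM (pi_rel (lr_vertex F v w)); case: ifP. Qed.
Lemma vert_idem v : vert v ** vert v = vert v.
Proof. by rewrite vertM eqxx. Qed.
Lemma vert_arrow_src e : vert (esource e) ** arrow e = arrow e.
Proof. by rewrite -piM (pi_rel (lr_source_edge F e)). Qed.
Lemma arrow_vert_rng e : arrow e ** vert (erange e) = arrow e.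
Proof. by rewrite -piM (pi_rel (lr_edge_range F e)). Qed.
Lemma vert_ghost_rng e : vert (erange e) ** ghost e = ghost e.
Proof. by rewrite -piM (pi_rel (lr_range_ghost F e)). Qed.
Lemma ghost_vert_src e : ghost e ** vert (esource e) = ghost e.
Proof. by rewrite -piM (pi_rel (lr_ghost_source F e)). Qed.
Lemma ghost_arrow e f : ghost e ** arrow f = if e == f then vert (erange e) else 0.
Proof. by rewrite -piM (pi_rel (lr_ghost_edge F e f)); case: ifP. Qed.
Lemma vert_sum v : ~~ sink v -> vert v = \sum_(e | esource e == v) arrow e ** ghost e.
Proof.
move=> /not_sink vs; rewrite /vert (pi_rel (lr_not_sink F vs)).
rewrite (big_morph (\pi_L) piD pi0); apply: eq_bigr => e _; exact: piM.
Qed.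

Lemma leavitt_ind (W : set L) : is_subspace W ->
  (forall x y, W x -> W y -> W (x ** y)) ->
  (forall v, W (vert v)) -> (forall e, W (arrow e)) -> (forall e, W (ghost e)) ->
  forall x, W x.
Proof.
move=> sW WM Wv We Wg; apply: pres_ind; elim=> [[]//||t Wt|t Wt u Wu|c t Wt|t Wt u Wu].
- exact: subspace0 sW.
- by rewrite piN; apply: subspaceN.
- by rewrite piD; apply: subspaceD.
- by rewrite piZ; apply: subspaceZ.
- by rewrite piM; apply: WM.
Qed.

(** The end [w] tells which vertex the empty path stands for. *)
Fixpoint real_path p w : L := if p is e :: q then arrow e ** real_path q w else vert w.
Fixpoint ghost_path p w : L := if p is e :: q then ghost_path q w ** ghost e else vert w.
Definition mon p q w : L := real_path p w ** ghost_path q w.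

Lemma real_path_end p w : real_path p w ** vert w = real_path p w.
Proof. by elim: p => [|e p IH] /=; rewrite ?vert_idem // -nmulA IH. Qed.
Lemma ghost_path_end p w : vert w ** ghost_path p w = ghost_path p w.
Proof. by elim: p => [|e p IH] /=; rewrite ?vert_idem // nmulA IH. Qed.

Lemma vert_arrow v e : vert v ** arrow e = if v == esource e then arrow e else 0.
Proof. by rewrite -{1}vert_arrow_src nmulA vertM; case: eqP => [->|];
  rewrite ?vert_arrow_src ?nmul0r. Qed.
Lemma ghost_vert v e : ghost e ** vert v = if v == esource e then ghost e else 0.
Proof.
by rewrite -{1}ghost_vert_src -nmulA vertM [v == _]eq_sym; case: eqP => _;
  rewrite ?ghost_vert_src ?nmulr0.
Qed.

Lemma vert_real_path v p w : ispath p w ->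
  vert v ** real_path p w = if v == src p w then real_path p w else 0.
Proof.
case: p => [|e p] /= _; first by rewrite vertM; case: eqP => // ->.
by rewrite nmulA vert_arrow; case: eqP; rewrite ?nmul0r.
Qed.
Lemma ghost_path_vert v p w : ispath p w ->
  ghost_path p w ** vert v = if v == src p w then ghost_path p w else 0.
Proof.
case: p => [|e p] /= _; first by rewrite vertM eq_sym; case: eqP => // ->.
by rewrite -nmulA ghost_vert; case: eqP; rewrite ?nmulr0.
Qed.

Lemma arrow_real_path e p w : ispath p w ->
  arrow e ** real_path p w = if erange e == src p w then real_path (e :: p) w else 0.
Proof. by move=> pp; rewrite -{1}arrow_vert_rng -nmulA vert_real_path //; case: ifP;
  rewrite ?nmulr0. Qed.
Lemma ghost_path_ghost e p w : ispath p w ->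
  ghost_path p w ** ghost e = if erange e == src p w then ghost_path (e :: p) w else 0.
Proof. by move=> pp; rewrite -{1}vert_ghost_rng nmulA ghost_path_vert //; case: ifP;
  rewrite ?nmul0r. Qed.

Lemma real_path_cat p q w : ispath q w ->
  real_path (p ++ q) w = real_path p (src q w) ** real_path q w.
Proof. by move=> qp; elim: p => [|e p IH] /=; rewrite ?vert_real_path ?eqxx // IH nmulA. Qed.
Lemma ghost_path_cat p q w : ispath q w ->
  ghost_path (p ++ q) w = ghost_path q w ** ghost_path p (src q w).
Proof. by move=> qp; elim: p => [|e p IH] /=; rewrite ?ghost_path_vert ?eqxx // IH nmulA. Qed.

Lemma real_path_rcons p e : real_path (rcons p e) (erange e) = real_path p (esource e) ** arrow e.
Proof. by rewrite -cats1 real_path_cat /= ?eqxx // arrow_vert_rng. Qed.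
Lemma ghost_path_rcons p e :
  ghost_path (rcons p e) (erange e) = ghost e ** ghost_path p (esource e).
Proof. by rewrite -cats1 ghost_path_cat /= ?eqxx // vert_ghost_rng. Qed.

Lemma ghost_real_path e f p w : ispath (f :: p) w ->
  ghost e ** real_path (f :: p) w = if e == f then real_path p w else 0.
Proof.
move=> /= /andP[/eqP fp pp]; rewrite nmulA ghost_arrow.
by case: eqP => [->|_]; rewrite ?nmul0r // fp vert_real_path // eqxx.
Qed.
Lemma ghost_path_arrow e f p w : ispath (f :: p) w ->
  ghost_path (f :: p) w ** arrow e = if f == e then ghost_path p w else 0.
Proof.
move=> /= /andP[/eqP fp pp]; rewrite -nmulA ghost_arrow.
by case: eqP => _; rewrite ?nmulr0 // fp ghost_path_vert // eqxx.
Qed.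

Lemma ghost_path_real_path p w : ispath p w -> ghost_path p w ** real_path p w = vert w.
Proof.
elim: p => [|e p IH] /=; first by rewrite vert_idem.
move=> /andP[/eqP ep pp]; rewrite -nmulA -[ghost e ** _]/(ghost e ** real_path (e :: p) w).
by rewrite ghost_real_path /= ?ep ?eqxx // IH.
Qed.

(** The expansion of a vertex into the products [e e^*], inserted between
    the two halves of a monomial, pushes their meeting vertex one step
    forward along every edge that leaves it. *)
Lemma mon_expand p q w : ~~ sink w ->
  mon p q w = \sum_(e | esource e == w) mon (rcons p e) (rcons q e) (erange e).
Proof.
move=> ws; rewrite /mon -{1}real_path_end -nmulA vert_sum // nmul_suml nmul_sumr.
by apply: eq_bigr => e /eqP es; rewrite real_path_rcons ghost_path_rcons es !nmulA.
Qed.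

Definition mons H : set L :=
  [set x | exists p q w, [/\ w \in H, ispath p w, ispath q w & x = mon p q w]].

Lemma monsP H p q w : w \in H -> ispath p w -> ispath q w -> lin_span (mons H) (mon p q w).
Proof. by move=> wH pp qp; apply: lin_span_in; exists p, q, w. Qed.

(** On the left an edge lengthens the real path and a ghost edge shortens
    it. Only when the real path is empty does a ghost edge move the meeting
    vertex, namely to the range of an edge that leaves it: this is where
    heredity enters. *)
Lemma mons_absorbl H x y : hereditary H -> lin_span (mons H) y -> lin_span (mons H) (x ** y).
Proof.
move=> hH; have sH := lin_span_subspace (mons H).
move: x y; apply: leavitt_ind.
- split=> [y _|c x y Wx Wy z Wz]; first by rewrite nmul0r; apply: subspace0.
  by rewrite nmulDl -nscalerAl; apply: sH.2; [apply: Wx | apply: Wy].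
- by move=> x y Wx Wy z Wz; rewrite -nmulA; apply: Wx; apply: Wy.
- move=> v; apply: lin_span_min; first exact: nmul_subspacel.
  move=> _ [p [q [w [wH pp qp ->]]]] /=; rewrite nmulA vert_real_path //.
  by case: ifP => _; rewrite ?nmul0r; [apply: monsP | apply: subspace0].
- move=> e; apply: lin_span_min; first exact: nmul_subspacel.
  move=> _ [p [q [w [wH pp qp ->]]]] /=; rewrite nmulA arrow_real_path //.
  case: ifP => epp; rewrite ?nmul0r; last exact: subspace0.
  by apply: monsP => //=; rewrite epp.
- move=> e; apply: lin_span_min; first exact: nmul_subspacel.
  move=> _ [[|f p] [q [w [wH pp qp ->]]]] /=; rewrite nmulA; last first.
    rewrite ghost_real_path //; case: ifP => _; rewrite ?nmul0r; last exact: subspace0.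
    by apply: monsP => //; case/andP: pp.
  rewrite /= ghost_vert; case: eqP => [we|]; rewrite ?nmul0r; last by move=> _; apply: subspace0.
  have -> : ghost e ** ghost_path q w = mon [::] (rcons q e) (erange e).
    by rewrite /mon /= ghost_path_end ghost_path_rcons we.
  by apply: monsP => //; [apply: hH; rewrite -we | rewrite ispath_rcons -we qp eqxx].
Qed.

Lemma mons_absorbr H x y : hereditary H -> lin_span (mons H) x -> lin_span (mons H) (x ** y).
Proof.
move=> hH; have sH := lin_span_subspace (mons H).
move: y x; apply: leavitt_ind.
- split=> [y _|c x y Wx Wy z Wz]; first by rewrite nmulr0; apply: subspace0.
  by rewrite nmulDr -nscalerAr; apply: sH.2; [apply: Wx | apply: Wy].
- by move=> x y Wx Wy z Wz; rewrite nmulA; apply: Wy; apply: Wx.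
- move=> v; apply: lin_span_min; first exact: nmul_subspacer.
  move=> _ [p [q [w [wH pp qp ->]]]] /=; rewrite -nmulA ghost_path_vert //.
  by case: ifP => _; rewrite ?nmulr0; [apply: monsP | apply: subspace0].
- move=> e; apply: lin_span_min; first exact: nmul_subspacer.
  move=> _ [p [[|f q] [w [wH pp qp ->]]]] /=; rewrite -nmulA; last first.
    rewrite ghost_path_arrow //; case: ifP => _; rewrite ?nmulr0; last exact: subspace0.
    by apply: monsP => //; case/andP: qp.
  rewrite /= vert_arrow; case: eqP => [we|]; rewrite ?nmulr0; last by move=> _; apply: subspace0.
  have -> : real_path p w ** arrow e = mon (rcons p e) [::] (erange e).
    by rewrite /mon /= real_path_end real_path_rcons we.
  by apply: monsP => //; [apply: hH; rewrite -we | rewrite ispath_rcons -we pp eqxx].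
- move=> e; apply: lin_span_min; first exact: nmul_subspacer.
  move=> _ [p [q [w [wH pp qp ->]]]] /=; rewrite -nmulA ghost_path_ghost //.
  case: ifP => epp; rewrite ?nmulr0; last exact: subspace0.
  by apply: monsP => //=; rewrite epp.
Qed.

Definition vpred H : {pred L} := fun x => `[< lin_span (mons H) x >].

Lemma vpredP H x : reflect (lin_span (mons H) x) (x \in vpred H).
Proof. exact: asboolP. Qed.

Lemma vpred_closed H : submod_closed (vpred H).
Proof.
have [s0 sP] := lin_span_subspace (mons H).
split=> [|c x y /vpredP Hx /vpredP Hy]; apply/vpredP; [exact: s0 | exact: sP].
Qed.

(** The ideal generated by the vertices of [H]: when [H] is hereditary, the
    monomials that meet in [H] already span it. *)
Definition videal H (hH : hereditary H) : nuIdeal L.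
Proof.
apply: (@NuIdeal F L (vpred H) (vpred_closed H)) => x y /vpredP Hx; apply/vpredP.
- exact: mons_absorbl.
- exact: mons_absorbr.
Defined.

Lemma videalP H (hH : hereditary H) x : reflect (lin_span (mons H) x) (x \in videal hH).
Proof. exact: asboolP. Qed.

Lemma hereditaryT : hereditary [set: V]. Proof. by move=> e _; rewrite inE. Qed.
Lemma hereditary0 : hereditary (finset.set0 : {set V}). Proof. by move=> e; rewrite inE. Qed.

Lemma videalT x : x \in videal hereditaryT.
Proof.
apply/videalP; move: x; apply: leavitt_ind.
- exact: lin_span_subspace.
- by move=> x y _; apply: mons_absorbl hereditaryT.
- by move=> v; rewrite -vert_idem; apply: (@monsP _ [::] [::]); rewrite ?inE.
- by move=> e; rewrite -arrow_vert_rng -[_ ** _](@real_path_end [:: e]);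
    apply: (@monsP _ [:: e] [::]); rewrite ?inE //= eqxx.
- by move=> e; rewrite -vert_ghost_rng -[_ ** _](@ghost_path_end [:: e]);
    apply: (@monsP _ [::] [:: e]); rewrite ?inE //= eqxx.
Qed.

Lemma videal0 x : x \in videal hereditary0 -> x = 0.
Proof.
move/videalP; apply: (lin_span_min (W := [set 0])).
  by split=> // c y z /= -> ->; rewrite scaler0 addr0.
by move=> y [p [q [w []]]]; rewrite inE.
Qed.

Lemma videalS H H' (hH : hereditary H) (hH' : hereditary H') :
  H \subset H' -> {subset videal hH <= videal hH'}.
Proof.
move=> /fintype.subsetP HH' x /videalP Hx; apply/videalP; apply: lin_spanS Hx.
by move=> y [p [q [w [wH pp qp ->]]]]; exists p, q, w; split=> //; apply: HH'.
Qed.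

Lemma vert_videal H (hH : hereditary H) v : v \in H -> vert v \in videal hH.
Proof. by move=> vH; rewrite -vert_idem; apply/videalP; apply: (@monsP _ [::] [::]). Qed.

Lemma videal_min H (hH : hereditary H) (K : nuIdeal L) :
  (forall v, v \in H -> vert v \in K) -> {subset videal hH <= K}.
Proof.
move=> HK x /videalP; apply: (lin_span_min (W := [set x | x \in K])); first exact: ideal_subspace.
move=> y [p [q [w [/HK wK _ _ ->]]]] /=.
by rewrite /mon -real_path_end -nmulA; apply: (absorbl (n := K)); apply: (absorbr (n := K)).
Qed.

End Monomials.

(* Unfolding this ideal during simplification would hide that it is one: its
   membership predicate alone does not carry the closure properties. *)
#[global] Opaque videal.

(** * Maximal paths *)

Section Streams.
Variable G : digraph.
Local Notation V := (vertex G).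
Local Notation E := (edge G).

(** A maximal path as an infinite sequence: each term holds the current
    vertex and the edge taken from there. At a sink the edge is [None], and
    the path stays there for ever. *)
Definition stream := nat -> V * option E.
Implicit Types (x y : stream) (e : E) (p q : seq E) (w : V).

Definition stream_step (a b : V * option E) :=
  if a.2 is Some e then (esource e == a.1) && (b.1 == erange e)
  else sink a.1 && (b == a).

Definition maximal x := `[< forall n, stream_step (x n) (x n.+1) >].
Definition sdom x := (x 0%N).1.
Definition shd x := (x 0%N).2.
Definition stl x : stream := fun n => x n.+1.
Definition scons e x : stream := fun n => if n is m.+1 then x m else (esource e, Some e).
Definition scat p x := foldr scons x p.

Lemma maximalP x : reflect (forall n, stream_step (x n) (x n.+1)) (maximal x).
Proof. exact: asboolP. Qed.

Lemma maximal_stl x : maximal x -> maximal (stl x).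
Proof. by move=> /maximalP xm; apply/maximalP=> n; apply: xm. Qed.

Lemma maximal_scons e x : sdom x = erange e -> maximal (scons e x) = maximal x.
Proof.
move=> xe; apply/maximalP/maximalP => xm n; first exact: (xm n.+1).
case: n => [|n]; last exact: xm.
by rewrite /stream_step /= eqxx -xe /sdom eqxx.
Qed.

Lemma shd_some x e : maximal x -> shd x = Some e ->
  [/\ sdom x = esource e, sdom (stl x) = erange e & scons e (stl x) = x].
Proof.
move=> /maximalP /(_ 0%N); rewrite /stream_step /shd /sdom /stl.
case x0: (x 0%N) => [v o] /= so oe; move: so; rewrite oe => /andP[/eqP ev /eqP ->].
by split=> //; apply/funext=> -[|n] //=; rewrite x0 ev oe.
Qed.

Lemma shd_none x : maximal x -> shd x = None -> sink (sdom x) /\ stl x = x.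
Proof.
move=> /maximalP xm x0; have xn n : x n = (sdom x, None).
  elim: n => [|n IH]; first by rewrite /sdom -x0 /shd; case: (x 0%N).
  by move: (xm n); rewrite IH /stream_step /= => /andP[_ /eqP].
move: (xm 0%N); rewrite /stream_step {1}xn /= => /andP[sx _]; split; first by rewrite xn in sx.
by apply/funext=> n; rewrite /stl !xn.
Qed.

Lemma scons_inj e f x y : scons e x = scons f y -> e = f /\ x = y.
Proof.
move=> exy; split; first by have /(congr1 snd) := congr1 (fun s => s 0%N) exy => -[].
by apply/funext=> n; apply: (congr1 (fun s => s n.+1) exy).
Qed.

Lemma stl_scons e x : stl (scons e x) = x. Proof. exact/funext. Qed.

Lemma scat_cat p q x : scat (p ++ q) x = scat p (scat q x).
Proof. exact: foldr_cat. Qed.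

Lemma sdom_scat p x : sdom (scat p x) = src p (sdom x).
Proof. by case: p. Qed.

Lemma maximal_scat p x : ispath p (sdom x) -> maximal (scat p x) = maximal x.
Proof.
elim: p => //= e p IH /andP[/eqP ep pp].
by rewrite maximal_scons ?IH // sdom_scat.
Qed.

Lemma scat_inj p x y : scat p x = scat p y -> x = y.
Proof. by elim: p => //= e p IH /scons_inj[_ /IH]. Qed.

Lemma scat_prefix p q x y : scat p x = scat q y ->
  (exists2 r, q = p ++ r & x = scat r y) \/ (exists2 r, p = q ++ r & y = scat r x).
Proof.
elim: p q => [|e p IH] q; first by left; exists q.
case: q => [|f q] /=; first by move=> <-; right; exists (e :: p).
by move=> /scons_inj[<- /IH[]] [r -> ->]; [left|right]; exists r.
Qed.

End Streams.

(** * The twisted action on functions of maximal paths *)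

Section Representation.
Variables (F : fieldType) (G : digraph) (R : algType F).
Variables (tau : int -> R) (wt : edge G -> int).
Hypotheses (tau0 : tau 0 = 1) (tauD : forall m n, tau (m + n) = tau m * tau n).
Local Notation V := (vertex G).
Local Notation E := (edge G).
Local Notation L := (leavitt F G).
Local Notation T := (term F (leavitt_gen G)).
Local Notation X := (stream G).
Implicit Types (t u : T) (x y : X) (phi psi : X -> R) (a b : L) (p q : seq E) (w : V).

(** An edge maps the function that is concentrated at a maximal path [x] to
    a multiple of the one concentrated at the path [scons e x], and the
    ghost edge does the opposite. Working with all functions, and not with
    finite sums of maximal paths, avoids every finiteness condition. The
    factors [tau (wt e)] let a turn around a cycle act as a power of the
    Laurent variable. *)
Fixpoint eval t phi x : R :=
  match t with
  | Gen (Vertex v) => if maximal x && (sdom x == v) then phi x else 0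
  | Gen (Edge e) => if maximal x && (shd x == Some e) then tau (wt e) * phi (stl x) else 0
  | Gen (Ghost e) =>
      if maximal x && (sdom x == erange e) then tau (- wt e) * phi (scons e x) else 0
  | Zero => 0
  | Opp t => - eval t phi x
  | Add t u => eval t phi x + eval u phi x
  | Scale c t => c *: eval t phi x
  | Mul t u => eval t (eval u phi) x
  end.

Lemma tauNK m : tau m * tau (- m) = 1. Proof. by rewrite -tauD subrr. Qed.
Lemma tauKN m : tau (- m) * tau m = 1. Proof. by rewrite -tauD addNr. Qed.

Lemma eval_linear t c phi psi :
  eval t (fun x => c *: phi x + psi x) = fun x => c *: eval t phi x + eval t psi x.
Proof.
elim: t phi psi => [[v|e|e]||t IHt|t IHt u IHu|d t IHt|t IHt u IHu] phi psi;
  apply/funext=> x /=.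
- by case: ifP; rewrite // scaler0 addr0.
- by case: ifP; rewrite ?scaler0 ?addr0 // mulrDr scalerAr.
- by case: ifP; rewrite ?scaler0 ?addr0 // mulrDr scalerAr.
- by rewrite scaler0 addr0.
- by rewrite IHt opprD scalerN.
- by rewrite IHt IHu scalerDr addrACA.
- by rewrite IHt scalerDr !scalerA mulrC.
- by rewrite IHu IHt.
Qed.

(** The action is on the left and the coefficients may also act on the
    right. So a value taken by the image of a concentrated function behaves
    like a matrix entry. *)
Lemma eval_mulr t phi r : eval t (fun x => phi x * r) = fun x => eval t phi x * r.
Proof.
elim: t phi => [[v|e|e]||t IHt|t IHt u IHu|d t IHt|t IHt u IHu] phi; apply/funext=> x /=.
- by case: ifP; rewrite // mul0r.
- by case: ifP; rewrite ?mul0r // mulrA.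
- by case: ifP; rewrite ?mul0r // mulrA.
- by rewrite mul0r.
- by rewrite IHt mulNr.
- by rewrite IHt IHu mulrDl.
- by rewrite IHt scalerAl.
- by rewrite IHu IHt.
Qed.

Lemma eval_sum (r : seq E) (P : pred E) (f : E -> T) phi x :
  eval (\big[@Add F _/Zero]_(e <- r | P e) f e) phi x = \sum_(e <- r | P e) eval (f e) phi x.
Proof. by apply: (big_morph (fun t => eval t phi x)). Qed.

Lemma eval_scale t c phi : eval t (fun x => c *: phi x) = fun x => c *: eval t phi x.
Proof.
have := eval_linear t c phi (fun=> 0).
have -> : eval t (fun=> 0) = fun=> 0.
  have := eval_linear t (-1) (fun=> 0) (fun=> 0).
  by under [X in eval t X]eq_fun do rewrite scaler0 addr0; move=> ->;
    apply/funext=> x; rewrite scaleN1r addNr.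
by under [X in eval t X]eq_fun do rewrite addr0; move=> ->; apply/funext=> x; rewrite addr0.
Qed.

Lemma eval_rel t u : leavitt_rel t u -> eval t = eval u.
Proof.
move=> tu; apply/funext=> phi; apply/funext=> x; case: tu => [v w|e|e|e|e|e f|v vs] /=.
- case: (v =P w) => [<-|vw] /=; first by case: (maximal x && _).
  by case: andP => // -[_ /eqP ->]; case: andP => // -[_ /eqP].
- case: andP => [[xm /eqP xe]|]; last first.
    by case: andP => // -[xm /eqP xe] []; have [-> _ _] := shd_some xm xe.
  by rewrite xm.
- case: andP => [[xm /eqP xe]|//]; have [_ -> _] := shd_some xm xe.
  by rewrite maximal_stl // eqxx.
- by case: (maximal x && _).
- case: andP => // -[xm /eqP xe].
  by rewrite maximal_scons // xm /= eqxx.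
- case: andP => [[xm /eqP xe]|xme].
    rewrite maximal_scons // xm /= /shd /= (inj_eq Some_inj); case: (e =P f) => [<-|_] /=.
      by rewrite xm xe eqxx mulrA tauKN mul1r stl_scons.
    by rewrite mulr0.
  by case: (e =P f) => //= _; case: andP.
- rewrite eval_sum /=; case: andP => [[xm /eqP xv]|xmv].
    case xe: (shd x) => [e|]; last first.
      have [/sinkP sx _] := shd_none xm xe.
      by case: vs => e ev; case: (sx e); rewrite xv.
    have [se re xE] := shd_some xm xe.
    rewrite (bigD1 e) -?se ?xv //= xm eqxx /= maximal_stl //= re eqxx mulrA tauNK mul1r xE.
    rewrite big1 ?addr0 // => f /andP[_ fe]; case: eqP => // -[ef].
    by rewrite ef eqxx in fe.
  rewrite big1 // => f /eqP fv; case: andP => // -[xm /eqP xf].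
  by case: xmv; rewrite xm -fv; have [-> _ _] := shd_some xm xf.
Qed.

(** The operators satisfy the defining relations, so the action descends to
    the Leavitt path algebra. *)
Lemma eval_congr t u : pcongr (@leavitt_rel F G) t u -> eval t = eval u.
Proof.
have ext (f g : (X -> R) -> X -> R) : (forall phi x, f phi x = g phi x) -> f = g.
  by move=> fg; apply/funext=> phi; apply/funext.
elim=> {t u}.
- exact: eval_rel.
- by [].
- by [].
- by move=> t u v _ -> _ ->.
- by move=> t u _ tu; apply: ext => phi x /=; rewrite tu.
- by move=> t t' u u' _ tt _ uu; apply: ext => phi x /=; rewrite tt uu.
- by move=> c t u _ tu; apply: ext => phi x /=; rewrite tu.
- by move=> t t' u u' _ tt _ uu; apply: ext => phi x /=; rewrite tt uu.
- by move=> t u v; apply: ext => phi x /=; apply: addrA.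
- by move=> t u; apply: ext => phi x /=; apply: addrC.
- by move=> t; apply: ext => phi x /=; apply: add0r.
- by move=> t; apply: ext => phi x /=; apply: addNr.
- by move=> a b t; apply: ext => phi x /=; apply: scalerA.
- by move=> t; apply: ext => phi x /=; apply: scale1r.
- by move=> c t u; apply: ext => phi x /=; apply: scalerDr.
- by move=> a b t; apply: ext => phi x /=; apply: scalerDl.
- by [].
- by [].
- move=> t u v; apply: ext => phi x /=.
  have := eval_linear t 1 (eval u phi) (eval v phi).
  move/(congr1 (fun f => f x)); rewrite scale1r => <-.
  by congr (eval t _ x); apply/funext=> y /=; rewrite scale1r.
- by [].
- by move=> c t u; apply: ext => phi x /=; rewrite eval_scale.
Qed.

Definition act a phi x := eval (repr a) phi x.

Lemma act_pi t : act (\pi_L t) = eval t.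
Proof. by apply: eval_congr; apply: pres_repr. Qed.

Lemma act_linear c a b phi x : act (c *: a + b) phi x = c *: act a phi x + act b phi x.
Proof.
by rewrite -[a]reprK -[b]reprK -piZ -piD !act_pi.
Qed.

Lemma act_mul a b phi : act (a ** b) phi = act a (act b phi).
Proof. by rewrite -[a]reprK -[b]reprK -piM !act_pi. Qed.

Lemma act_mulr a phi r : act a (fun x => phi x * r) = fun x => act a phi x * r.
Proof. exact: eval_mulr. Qed.

Lemma act_vert v phi x : act (vert F v) phi x = if maximal x && (sdom x == v) then phi x else 0.
Proof. by rewrite act_pi. Qed.

Lemma act_0 phi x : act 0 phi x = 0.
Proof. by rewrite -pi0 act_pi. Qed.

Definition pwt p : int := \sum_(e <- p) wt e.

Lemma act_real_path p w phi y : ispath p w -> maximal y -> sdom y = w ->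
  act (real_path F p w) phi (scat p y) = tau (pwt p) * phi y.
Proof.
move=> pp ym yw; elim: p pp phi => [|e p IH] /= pp phi.
  by rewrite act_vert ym yw eqxx /pwt big_nil tau0 mul1r.
case/andP: pp => /eqP ep pp; rewrite act_mul act_pi /=.
have spw : sdom (scat p y) = erange e by rewrite sdom_scat yw.
by rewrite maximal_scons // maximal_scat ?yw // ym eqxx /= stl_scons IH // mulrA -tauD /pwt
  big_cons.
Qed.

Lemma act_real_path0 p w phi x : (forall y, maximal y -> sdom y = w -> x <> scat p y) ->
  act (real_path F p w) phi x = 0.
Proof.
elim: p x phi => [|e p IH] x phi xy /=.
  by rewrite act_vert; case: andP => // -[xm /eqP xw]; case: (xy x).
rewrite act_mul act_pi /=; case: andP => // -[xm /eqP xe]; rewrite IH ?mulr0 // => y ym yw xpy.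
by apply: (xy y) => //=; have [_ _ <-] := shd_some xm xe; rewrite xpy.
Qed.

Lemma act_ghost_path q w phi y : ispath q w -> maximal y -> sdom y = w ->
  act (ghost_path F q w) phi y = tau (- pwt q) * phi (scat q y).
Proof.
move=> qp ym yw; elim: q qp phi => [|e q IH] /= qp phi.
  by rewrite act_vert ym yw eqxx /pwt big_nil oppr0 tau0 mul1r.
case/andP: qp => /eqP eq qp; rewrite act_mul IH // act_pi /=.
rewrite sdom_scat yw eq eqxx maximal_scat ?yw // ym /= mulrA -tauD /pwt big_cons.
by rewrite opprD addrC.
Qed.

Lemma act_mon p q w phi y : ispath p w -> ispath q w -> maximal y -> sdom y = w ->
  act (mon F p q w) phi (scat p y) = tau (pwt p - pwt q) * phi (scat q y).
Proof. by move=> pp qp ym yw; rewrite act_mul act_real_path // act_ghost_path // mulrA -tauD. Qed.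

Lemma act_mon0 p q w phi x : (forall y, maximal y -> sdom y = w -> x <> scat p y) ->
  act (mon F p q w) phi x = 0.
Proof. by move=> xy; rewrite act_mul act_real_path0. Qed.

End Representation.

(** * Entries of finite and infinite matrix blocks *)

Section BlockEntries.
Variables (F : fieldType) (R : algType F).

Definition in_block (sz : option nat) (i : nat) := if sz is Some n then (i < n.+1)%N else true.

(** Blocks of both kinds are read as matrices indexed by all natural
    numbers, padded with zeros. Finite and infinite sizes then need no
    separate treatment. *)
Definition block_entry (sz : option nat) : mx_block R sz -> nat -> nat -> R :=
  match sz with
  | Some n => fun (M : mx_alg R n.+1) i j =>
      if (i < n.+1)%N && (j < n.+1)%N then (M : 'M_n.+1) (inord i) (inord j) else 0
  | None => fun M : mxoo_alg R => val M
  end.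

Variable sz : option nat.
Implicit Types M : mx_block R sz.

Lemma block_entry_lin c M (N : mx_block R sz) i j :
  block_entry (c *: M + N) i j = c *: block_entry M i j + block_entry N i j.
Proof.
case: sz M N => [n|] M N //=; case: ifP => _; last by rewrite scaler0 addr0.
by rewrite !mxE.
Qed.

Lemma block_entry_inj M (N : mx_block R sz) :
  (forall i j, block_entry M i j = block_entry N i j) -> M = N.
Proof.
case: sz M N => [n|] M N /= MN; last exact: mxoo_eqP.
by apply/matrixP=> i j; move: (MN i j); rewrite !ltn_ord !inord_val.
Qed.

Lemma block_entry0 i j : block_entry (0 : mx_block R sz) i j = 0.
Proof.
have := block_entry_lin (-1) (0 : mx_block R sz) 0 i j.
by rewrite scaleN1r addNr scaleN1r addNr.
Qed.

Lemma block_entry_out M i j : ~~ (in_block sz i && in_block sz j) -> block_entry M i j = 0.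
Proof. by case: sz M => //= n M /negbTE ->. Qed.

Lemma block_entry_fin M : exists N, forall i j, (N <= i)%N || (N <= j)%N -> block_entry M i j = 0.
Proof.
case: sz M => [n|] M /=; last exact: mxoo_valP.
by exists n.+1 => i j; case: ifP => // /andP[ni nj]; rewrite !(leqNgt n.+1) ni nj.
Qed.

Lemma sum_ord_stable (f : nat -> R) N N' :
  (forall k, (N <= k)%N -> f k = 0) -> (forall k, (N' <= k)%N -> f k = 0) ->
  \sum_(k < N) f k = \sum_(k < N') f k.
Proof.
wlog le : N N' / (N <= N')%N => [hw fN fN'|fN _].
  by case: (leqP N N') => [|/ltnW] le; [|symmetry]; apply: hw.
rewrite (big_ord_widen _ _ le) big_mkcond; apply: eq_bigr => k _.
by case: ltnP => // /fN.
Qed.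

Lemma block_entry_mul M M' N i j : (forall i k, (N <= k)%N -> block_entry M i k = 0) ->
  block_entry (M ** M') i j = \sum_(k < N) block_entry M i k * block_entry M' k j.
Proof.
case: sz M M' => [n|] M M' /= MN; last exact: mxoo_mulfE (MN i).
rewrite (sum_ord_stable (N' := n.+1)
  (f := fun k => (if (i < n.+1)%N && (k < n.+1)%N then (M : 'M_n.+1) (inord i) (inord k) else 0)
       * (if (k < n.+1)%N && (j < n.+1)%N then (M' : 'M_n.+1) (inord k) (inord j) else 0))).
- case: (ltnP i n.+1) => /= ni; last by rewrite big1 // => k _; rewrite mul0r.
  case: (ltnP j n.+1) => /= nj; last by rewrite big1 // => k _; rewrite andbF mulr0.
  by rewrite !mxE; apply: eq_bigr => k _; rewrite ltn_ord inord_val.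
- by move=> k /MN ->; rewrite mul0r.
- by move=> k; rewrite leqNgt => /negbTE ->; rewrite andbF mul0r.
Qed.

Lemma block_entry_surj (h : nat -> nat -> R) :
  (forall i j, ~~ (in_block sz i && in_block sz j) -> h i j = 0) ->
  (exists N, forall i j, (N <= i)%N || (N <= j)%N -> h i j = 0) ->
  exists M : mx_block R sz, block_entry M = h.
Proof.
move=> h0 hN; case: sz h0 => [n|] /= h0; last first.
  have hf : h \in finitary (R:=R) by apply/finitaryP.
  by exists (exist _ h hf).
exists (\matrix_(i, j) h i j); apply/funext=> i; apply/funext=> j /=.
case: ifP => [/andP[ni nj]|/negbT /h0 -> //].
by rewrite mxE !inordK.
Qed.

End BlockEntries.

(** The set of indices of a block determines its size: a finite set gives a
    finite matrix algebra, an infinite countable one gives the finitary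
    matrices. *)
Lemma enum_block (T : countType) (P : pred T) : (exists p, P p) ->
  exists (sz : option nat) (g : nat -> T),
  [/\ forall i, in_block sz i -> P (g i),
      forall i j, in_block sz i -> in_block sz j -> g i = g j -> i = j &
      forall p, P p -> exists2 i, in_block sz i & g i = p].
Proof.
move=> [p0 Pp0]; have [Pf|Pi] := pselect (finite_set [set p | P p]).
  have [s0 s0E] := (finite_seqP _).1 Pf; pose s := undup s0.
  have sP p : (p \in s) = P p.
    have : [set p | P p] p = [set` s0] p by rewrite s0E.
    by rewrite mem_undup /= => Pps; apply/idP/idP; rewrite -Pps.
  have : (0 < size s)%N by case: s sP => // /(_ p0); rewrite Pp0.
  case sn: (size s) => [//|n] _; exists (Some n), (nth p0 s); split=> /=.
  - by move=> i; rewrite -sn => /(mem_nth p0); rewrite sP.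
  - by move=> i j; rewrite -sn => si sj /eqP; rewrite nth_uniq ?undup_uniq // => /eqP.
  - move=> p; rewrite -sP => ps; exists (index p s); first by rewrite -sn index_mem.
    exact: nth_index.
have /card_set_bijP[f [_ fi fs]] := eq_card_nat (countableP [set p | P p]) Pi.
have /choice[g gP] : forall n, exists p, P p /\ f p = n.
  by move=> n; have [|p Pp <-] := fs n; [|exists p].
exists None, g; split=> /=.
- by move=> i _; case: (gP i).
- by move=> i j _ _ gij; rewrite -(gP i).2 gij (gP j).2.
- move=> p Pp; exists (f p) => //; apply: fi; rewrite ?inE //.
  + by case: (gP (f p)).
  + by case: (gP (f p)).
Qed.

(** * Matrix units modulo an ideal *)

Section MatrixUnits.
Variables (F : fieldType) (A : nuAlgType F) (R : algType F) (J I : nuIdeal A).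
Variables (k : nat) (T : countType) (P : 'I_k -> pred T).
Variables (ok : pred int) (tau : int -> R).
Variables (u : 'I_k -> T -> T -> int -> A) (ent : 'I_k -> T -> T -> A -> R).
Implicit Types (b d : 'I_k) (p q : T) (x y : A) (m n : int).

Definition unit_set : set A :=
  [set x | exists b p q m, [/\ P b p, P b q, ok m & x = u b p q m]].

(** The element [u b p q m] plays the role of the matrix unit at [(p, q)]
    in the block [b], multiplied by the [m]-th power [tau m] of the
    variable, and [ent b p q] reads the entry at [(p, q)]. The exponents
    that occur are those in [ok]: all of them for Laurent polynomials, only
    [0] for scalars. The units span [J] only up to [I], and no
    multiplication table for them is asked for: [mu_mul] states it through
    the entries, in the form in which a representation provides it. *)
Record matrix_units : Prop := MatrixUnits {
  mu_lin b p q c x y : ent b p q (c *: x + y) = c *: ent b p q x + ent b p q y;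
  mu_nonempty b : exists p, P b p;
  mu_sub : {subset I <= J};
  mu_in b p q m : P b p -> P b q -> ok m -> u b p q m \in J;
  mu_span x : x \in J -> exists2 y, y \in I & lin_span unit_set (x - y);
  mu_ideal b p q x : P b p -> P b q -> x \in I -> ent b p q x = 0;
  mu_ent b d p q p' q' m : P b p -> P b q -> P d p' -> P d q' -> ok m ->
    ent b p q (u d p' q' m) = if [&& b == d, p == p' & q == q'] then tau m else 0;
  mu_mul b d p q p' q' m x : P b p -> P b q -> P d p' -> P d q' -> ok m ->
    ent b p q (x ** u d p' q' m) = if (b == d) && (q == q') then ent b p p' x * tau m else 0;
  mu_free (s : seq int) (a : int -> F) : uniq s -> all ok s ->
    \sum_(m <- s) a m *: tau m = 0 -> forall m, m \in s -> a m = 0;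
  mu_gen (r : R) : exists (s : seq int) (a : int -> F),
    all ok s /\ r = \sum_(m <- s) a m *: tau m
}.

Hypothesis mu : matrix_units.

Lemma ent0 b p q : ent b p q 0 = 0.
Proof.
by have := mu_lin mu b p q (-1) 0 0; rewrite scaleN1r addNr scaleN1r addNr.
Qed.

Lemma entD b p q x y : ent b p q (x + y) = ent b p q x + ent b p q y.
Proof. by have := mu_lin mu b p q 1 x y; rewrite !scale1r. Qed.

Lemma entB b p q x y : ent b p q (x - y) = ent b p q x - ent b p q y.
Proof. by rewrite addrC -scaleN1r mu_lin // scaleN1r addrC. Qed.

Lemma entZ b p q c x : ent b p q (c *: x) = c *: ent b p q x.
Proof. by have := mu_lin mu b p q c x 0; rewrite ent0 !addr0. Qed.

Lemma ent_sum b p q (K : Type) (s : seq K) (Q : pred K) (f : K -> A) :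
  ent b p q (\sum_(i <- s | Q i) f i) = \sum_(i <- s | Q i) ent b p q (f i).
Proof. by apply: (big_morph (ent b p q)) => [x y|]; [apply: entD | apply: ent0]. Qed.

Lemma mu_ind (W : set A) : is_subspace W -> (forall x, x \in I -> W x) ->
  (forall b p q m, P b p -> P b q -> ok m -> W (u b p q m)) ->
  forall x, x \in J -> W x.
Proof.
move=> sW WI Wu x /(mu_span mu)[y /WI Wy xy].
rewrite -[x](subrK y); apply: subspaceD => //.
by apply: lin_span_min xy => // _ [b [p [q [m [pP qP mo ->]]]]]; apply: Wu.
Qed.

Let K := ('I_k * T * T * int)%type.
Let uK (i : K) : A := u i.1.1.1 i.1.1.2 i.1.2 i.2.
Let okK (i : K) := [&& P i.1.1.1 i.1.1.2, P i.1.1.1 i.1.2 & ok i.2].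

(** A combination of units without repetitions, so that the independence of
    the powers [tau m] can be applied entry by entry. *)
Lemma span_units_normal x : lin_span unit_set x ->
  exists (s : seq K) (a : K -> F), [/\ uniq s, all okK s & x = \sum_(i <- s) a i *: uK i].
Proof.
pose W := [set x | exists (s : seq K) (a : K -> F),
  [/\ uniq s, all okK s & x = \sum_(i <- s) a i *: uK i]].
apply: (lin_span_min (W := W)); last first.
  move=> _ [b [p [q [m [pP qP mo ->]]]]].
  exists [:: (b, p, q, m)], (fun=> 1); split=> //=; first by rewrite /okK /= pP qP mo.
  by rewrite big_seq1 scale1r.
split; first by exists [::], (fun=> 0); rewrite big_nil.
move=> c x1 x2 [s1 [a1 [us1 os1 ->]]] [s2 [a2 [us2 os2 ->]]].
pose z (s : seq K) (a : K -> F) i := if i \in s then a i else 0.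
have zE s a s' : uniq s -> uniq s' -> {subset s <= s'} ->
    \sum_(i <- s) a i *: uK i = \sum_(i <- s') z s a i *: uK i.
  move=> us us' ss'; rewrite [RHS](bigID (mem s)) /= [X in _ + X]big1 ?addr0; last first.
    by move=> i /negbTE is_; rewrite /z is_ scale0r.
  rewrite -[RHS]big_filter.
  have -> : \sum_(i <- s) a i *: uK i = \sum_(i <- s) z s a i *: uK i.
    by apply: eq_big_seq => i is_; rewrite /z is_.
  apply: perm_big; apply: uniq_perm => //; first exact: filter_uniq.
  by move=> i; rewrite mem_filter; case: (boolP (i \in s)) => //= /ss'.
pose s := undup (s1 ++ s2).
exists s, (fun i => c * z s1 a1 i + z s2 a2 i); split.
- exact: undup_uniq.
- apply/allP=> i; rewrite mem_undup mem_cat => /orP[].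
    by move/(allP os1).
  by move/(allP os2).
rewrite (zE s1 a1 s) ?undup_uniq //; last first.
  by move=> i is_; rewrite mem_undup mem_cat is_.
rewrite (zE s2 a2 s) ?undup_uniq //; last first.
  by move=> i is_; rewrite mem_undup mem_cat is_ orbT.
rewrite scaler_sumr -big_split; apply: eq_bigr => i _.
by rewrite scalerDl scalerA.
Qed.

(** An element of [J] is, up to [I], a combination of distinct units. Those
    units that share a block and a position contribute a combination of
    distinct powers of the variable to one entry, and such powers are
    linearly independent. *)
Lemma mu_kernel x : x \in J ->
  (forall b p q, P b p -> P b q -> ent b p q x = 0) -> x \in I.
Proof.
move=> /(mu_span mu)[y yI xy] x0; rewrite -[x](subrK y).
apply: rpredD => //; have : forall b p q, P b p -> P b q -> ent b p q (x - y) = 0.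
  by move=> b p q pP qP; rewrite entB x0 // (mu_ideal mu) // subrr.
move: xy => /span_units_normal[s [a [us os ->]]] s0.
suff a0 i : i \in s -> a i = 0.
  by rewrite big_seq big1 ?rpred0 // => i /a0 ->; rewrite scale0r.
case: i => [[[b p] q] m] is_; have /and3P[/= pP qP mo] := allP os _ is_.
have := s0 b p q pP qP; rewrite ent_sum.
pose t := [seq i <- s | [&& b == i.1.1.1, p == i.1.1.2 & q == i.1.2]].
have tE i : i \in t -> i = (b, p, q, i.2).
  by rewrite mem_filter; case: i => [[[b' p'] q'] m'] /= /andP[/and3P[/eqP<- /eqP<- /eqP<-]].
have -> : \sum_(i <- s) ent b p q (a i *: uK i)
    = \sum_(m <- [seq i.2 | i <- t]) a (b, p, q, m) *: tau m.
  rewrite [RHS]big_map [RHS]big_filter [RHS]big_mkcond /= [LHS]big_seq [RHS]big_seq.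
  apply: eq_bigr => i is'.
  have /and3P[iP1 iP2 io] := allP os _ is'; rewrite entZ (mu_ent mu) //.
  case: ifP => [|_]; last by rewrite scaler0.
  by case: i {is' iP1 iP2 io} => [[[b' p'] q'] m'] /= /and3P[/eqP<- /eqP<- /eqP<-].
move/(mu_free mu); apply.
- rewrite map_inj_in_uniq ?filter_uniq // => i j /tE -> /tE -> /=.
  by move=> ->.
- apply/allP=> _ /mapP[i it ->]; move: it; rewrite mem_filter => /andP[_ /(allP os)].
  by case/and3P.
- by apply/mapP; exists (b, p, q, m) => //; rewrite mem_filter /= !eqxx.
Qed.

Lemma mu_single b p q (r : R) : P b p -> P b q ->
  exists2 y, y \in J & forall d p' q', P d p' -> P d q' ->
    ent d p' q' y = if [&& d == b, p' == p & q' == q] then r else 0.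
Proof.
move=> pP qP; have [s [a [os ->]]] := mu_gen mu r.
exists (\sum_(m <- s) a m *: u b p q m).
  rewrite big_seq; apply: rpred_sum => m /(allP os) mo; apply: rpredZ.
  exact: (mu_in mu).
move=> d p' q' p'P q'P; rewrite ent_sum.
transitivity (\sum_(m <- s) if [&& d == b, p' == p & q' == q] then a m *: tau m else 0).
  rewrite [LHS]big_seq [RHS]big_seq; apply: eq_bigr => m /(allP os) mo.
  by rewrite entZ (mu_ent mu) //; case: ifP => _ //; rewrite scaler0.
by case: ifP => // _; rewrite big1.
Qed.

(** A unit at [(q, p)] picks the entry at [(p, q)] out of each of its
    neighbours. Thus a condition on the products of the form [x ** y ** x]
    becomes a condition on a single coefficient of [x]. *)
Lemma mu_sandwich b p q m x y : P b p -> P b q -> ok m -> x \in J -> y \in J ->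
  ent b p q ((x ** u b q p m) ** y) = ent b p q x * tau m * ent b p q y.
Proof.
move=> pP qP mo xJ; move: y.
apply: (mu_ind (W := [set y | ent b p q ((x ** u b q p m) ** y) =
  ent b p q x * tau m * ent b p q y])) => /=.
- split=> [|c y z /= Wy Wz] /=; first by rewrite nmulr0 ent0 mulr0.
  by rewrite nmulDr -nscalerAr !(mu_lin mu) Wy Wz mulrDr scalerAr.
- move=> y yI; by rewrite (mu_ideal mu pP qP (absorbl _ yI)) (mu_ideal mu pP qP yI) mulr0.
- move=> d p' q' n p'P q'P no; rewrite (mu_mul mu) // (mu_ent mu) //.
  case: eqP => [bd|_] /=; last by rewrite mulr0.
  rewrite andbC; case: eqP => [_|_] /=; last by rewrite mulr0.
  move: p'P; rewrite -bd => p'P; rewrite (mu_mul mu) // eqxx /= eq_sym.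
  by case: ifP => _; rewrite ?mul0r ?mulr0.
Qed.

Variables (sz : 'I_k -> option nat) (g : 'I_k -> nat -> T).
Hypotheses (gP : forall b i, in_block (sz b) i -> P b (g b i))
  (gi : forall b i j, in_block (sz b) i -> in_block (sz b) j -> g b i = g b j -> i = j)
  (gs : forall b p, P b p -> exists2 i, in_block (sz b) i & g b i = p).

Definition index_entry b x i j : R :=
  if in_block (sz b) i && in_block (sz b) j then ent b (g b i) (g b j) x else 0.

Lemma index_entry_fin b x : x \in J ->
  exists N, forall i j, (N <= i)%N || (N <= j)%N -> index_entry b x i j = 0.
Proof.
apply: (mu_ind (W := [set x | exists N, forall i j,
  (N <= i)%N || (N <= j)%N -> index_entry b x i j = 0])).
- split=> [|c y z [N yN] [N' zN]].
    by exists 0%N => i j _; rewrite /index_entry ent0 if_same.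
  exists (maxn N N') => i j Nij; move: (yN i j) (zN i j); rewrite /index_entry.
  case: ifP => // _; rewrite (mu_lin mu) => -> //; last first.
    by case/orP: Nij => /(leq_trans (leq_maxl _ _)) ->; rewrite ?orbT.
  rewrite scaler0 add0r => -> //.
  by case/orP: Nij => /(leq_trans (leq_maxr _ _)) ->; rewrite ?orbT.
- move=> y yI; exists 0%N => i j _; rewrite /index_entry; case: andP => // -[iP jP].
  by rewrite (mu_ideal mu) //; apply: gP.
- move=> d p q m pP qP mo; have [bd|bd] := eqVneq b d; last first.
    exists 0%N => i j _; rewrite /index_entry; case: andP => // -[iP jP].
    by rewrite (mu_ent mu) ?(negbTE bd) //; apply: gP.
  move: pP qP; rewrite -bd => pP qP; have [i0 i0v <-] := gs pP; have [j0 j0v <-] := gs qP.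
  exists (maxn i0 j0).+1 => i j Nij; rewrite /index_entry; case: andP => // -[iP jP].
  rewrite (mu_ent mu) ?eqxx /=; do ?[exact: gP | by []].
  case: andP => // -[/eqP/(gi iP i0v) ii /eqP/(gi jP j0v) jj].
  by move: Nij; rewrite ii jj !ltnNge leq_maxl leq_maxr.
Qed.

(** The formula for the product of matrices. It is linear in [y], so it is
    enough to take for [y] an element of [I], where both sides vanish, or a
    unit, where at most one term of the sum is not zero. *)
Lemma index_entry_mul b x y i j : y \in J ->
  exists N0, forall N, (N0 <= N)%N ->
    index_entry b (x ** y) i j = \sum_(l < N) index_entry b x i l * index_entry b y l j.
Proof.
move: y; apply: (mu_ind (W := [set y | exists N0, forall N, (N0 <= N)%N ->
    index_entry b (x ** y) i j = \sum_(l < N) index_entry b x i l * index_entry b y l j])).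
- split=> [|c y z [N yN] [N' zN]].
    exists 0%N => N _; rewrite nmulr0 /index_entry ent0 if_same big1 // => l _.
    by rewrite ent0 if_same mulr0.
  exists (maxn N N') => N0; rewrite geq_max => /andP[/yN yE /zN zE].
  have mE w l : index_entry b (c *: y + z) l w = c *: index_entry b y l w + index_entry b z l w.
    by rewrite /index_entry; case: ifP => _; rewrite ?(mu_lin mu) // scaler0 addr0.
  have -> : index_entry b (x ** (c *: y + z)) i j =
      c *: index_entry b (x ** y) i j + index_entry b (x ** z) i j.
    rewrite /index_entry; case: ifP => _; last by rewrite scaler0 addr0.
    by rewrite nmulDr -nscalerAr (mu_lin mu).
  rewrite yE zE scaler_sumr -big_split; apply: eq_bigr => l _.
  by rewrite mE mulrDr scalerAr.
- move=> y yI; exists 0%N => N _; rewrite big1; last first.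
    move=> l _; rewrite [X in _ * X]/index_entry; case: andP => [[lP jP]|]; last by rewrite mulr0.
    by rewrite (mu_ideal mu) ?mulr0 //; apply: gP.
  rewrite /index_entry; case: andP => // -[iP jP].
  by rewrite (mu_ideal mu) //; do ?[exact: gP | exact: absorbl].
- move=> d p q m pP qP mo.
  case: (boolP (in_block (sz b) i && in_block (sz b) j)) => [/andP[iP jP]|ij]; last first.
    exists 0%N => N _; rewrite {1}/index_entry (negbTE ij) big1 // => l _.
    move: ij; rewrite negb_and /index_entry => /orP[/negbTE->|/negbTE->]; rewrite ?mul0r //.
    by rewrite andbF mulr0.
  have [bd|bd] := eqVneq b d; last first.
    exists 0%N => N _; rewrite /index_entry iP jP /= (mu_mul mu) ?(negbTE bd) /=;
      do ?[exact: gP | by []].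
    rewrite big1 // => l _; case: ifP => [lP|_]; last by rewrite mul0r.
    by rewrite (mu_ent mu) ?(negbTE bd) ?mulr0 //; apply: gP.
  move: pP qP; rewrite -bd => pP qP; have [l0 l0v l0E] := gs pP.
  exists l0.+1 => N l0N; rewrite {1}/index_entry iP jP /= (mu_mul mu) ?eqxx /=;
    do ?[exact: gP | by []].
  rewrite (bigD1 (Ordinal l0N)) //= big1 ?addr0 => [|l ll0].
    rewrite /index_entry iP jP l0v /= (mu_ent mu) ?eqxx ?l0E ?eqxx /=; do ?[exact: gP | by []].
    by case: ifP => _; rewrite ?mulr0.
  rewrite [X in _ * X]/index_entry; case: andP => [[lP _]|]; last by rewrite mulr0.
  rewrite (mu_ent mu) ?eqxx /=; do ?[exact: gP | by []].
  case: andP => [[/eqP gl _]|]; last by rewrite mulr0.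
  case/eqP: ll0; apply: val_inj => /=; apply: gi lP l0v _; by rewrite gl l0E.
Qed.

Local Notation D := (dsum (fun b => mx_block R (sz b))).

Definition to_block b x : mx_block R (sz b) :=
  if pselect (exists M, block_entry M = index_entry b x) is left e then projT1 (cid e) else 0.

Lemma to_blockE b x : x \in J -> block_entry (to_block b x) = index_entry b x.
Proof.
move=> xJ; rewrite /to_block; case: pselect => [e|[]]; first by case: cid.
apply: block_entry_surj; last exact: index_entry_fin.
by move=> i j /negbTE ij; rewrite /index_entry ij.
Qed.

Definition to_blocks x : D := fun b => to_block b x.

Lemma to_blocks_lin c x y : x \in J -> y \in J ->
  to_blocks (c *: x + y) = c *: to_blocks x + to_blocks y.
Proof.
move=> xJ yJ; apply: functional_extensionality_dep => b; apply: block_entry_inj => i j.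
have -> : (c *: to_blocks x + to_blocks y) b = c *: to_block b x + to_block b y by [].
rewrite block_entry_lin !to_blockE ?rpredD ?rpredZ // /index_entry.
by case: ifP => _; rewrite ?(mu_lin mu) // scaler0 addr0.
Qed.

Lemma to_blocks_mul x y : x \in J -> y \in J ->
  to_blocks (x ** y) = to_blocks x ** to_blocks y.
Proof.
move=> xJ yJ; apply: functional_extensionality_dep => b; apply: block_entry_inj => i j.
have -> : (to_blocks x ** to_blocks y) b = to_block b x ** to_block b y by [].
have [N xN] := index_entry_fin b xJ; have [N0 N0E] := index_entry_mul b x i j yJ.
rewrite (@block_entry_mul _ _ _ _ _ (maxn N N0)); last first.
  by move=> i' l; rewrite geq_max to_blockE // => /andP[Nl _]; rewrite xN ?Nl ?orbT.
by rewrite !to_blockE ?(absorbr y xJ) // (N0E (maxn N N0)) ?leq_maxr.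
Qed.

Lemma to_blocks_eq0 x : x \in J -> to_blocks x = 0 <-> x \in I.
Proof.
move=> xJ; split=> [x0|xI].
  apply: mu_kernel => // b p q /gs[i iv <-] /gs[j jv <-].
  have := congr1 (fun M : D => block_entry (M b) i j) x0.
  rewrite /to_blocks to_blockE // /index_entry iv jv /= => ->; exact: block_entry0.
apply: functional_extensionality_dep => b; apply: block_entry_inj => i j.
rewrite block_entry0 to_blockE // /index_entry; case: andP => // -[iv jv].
by rewrite (mu_ideal mu) //; apply: gP.
Qed.

Lemma to_blocks_surj (M : D) : exists2 x, x \in J & to_blocks x = M.
Proof.
have /choice[Y YP] : forall c : 'I_k * T * T * R, exists y, P c.1.1.1 c.1.1.2 ->
  P c.1.1.1 c.1.2 ->
    y \in J /\ forall d p' q', P d p' -> P d q' ->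
    ent d p' q' y = if [&& d == c.1.1.1, p' == c.1.1.2 & q' == c.1.2] then c.2 else 0.
  move=> [[[b p] q] r] /=; have [[pP qP]|n] := pselect (P b p /\ P b q).
    by have [y yJ yE] := mu_single r pP qP; exists y.
  by exists 0 => pP qP; case: n.
have /choice[N NP] : forall b, exists N, forall i j, (N <= i)%N || (N <= j)%N ->
  block_entry (M b) i j = 0.
  by move=> b; apply: block_entry_fin.
pose x := \sum_b \sum_(i < N b | in_block (sz b) i) \sum_(j < N b | in_block (sz b) j)
  Y (b, g b i, g b j, block_entry (M b) i j).
have xJ : x \in J.
  apply: rpred_sum => b _; apply: rpred_sum => i iv; apply: rpred_sum => j jv.
  by have [] := YP (b, g b i, g b j, block_entry (M b) i j) (gP iv) (gP jv).
exists x => //; apply: functional_extensionality_dep => b; apply: block_entry_inj => i j.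
rewrite to_blockE // /index_entry; case: ifP => [/andP[iv jv]|/negbT ij];
  last by rewrite block_entry_out.
have YE d (i' j' : nat) : in_block (sz d) i' -> in_block (sz d) j' ->
    ent b (g b i) (g b j) (Y (d, g d i', g d j', block_entry (M d) i' j'))
    = if [&& b == d, i == i' & j == j'] then block_entry (M b) i j else 0.
  move=> iv' jv'; have [_ ->] := YP (d, g d i', g d j', block_entry (M d) i' j') (gP iv')
    (gP jv');
    do ?[exact: gP].
  rewrite /=; case: eqP => //= bd; move: iv' jv'; rewrite -bd => iv' jv'.
  have -> : (g b i == g b i') = (i == i').
    by apply/eqP/eqP=> [/(gi iv iv')|->].
  have -> : (g b j == g b j') = (j == j').
    by apply/eqP/eqP=> [/(gi jv jv')|->].
  by case: andP => // -[/eqP-> /eqP->].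
rewrite /x ent_sum (bigD1 b) //= [X in _ + X]big1 ?addr0; last first.
  move=> d db; rewrite ent_sum big1 // => i' iv'; rewrite ent_sum big1 // => j' jv'.
  by rewrite YE // eq_sym (negbTE db).
case: (boolP ((N b <= i)%N || (N b <= j)%N)) => Nij.
  rewrite NP // ent_sum big1 // => i' iv'; rewrite ent_sum big1 // => j' jv'.
  by rewrite YE // NP // if_same.
move: Nij; rewrite negb_or -!ltnNge => /andP[iN jN].
rewrite ent_sum (bigD1 (Ordinal iN)) //= [X in _ + X]big1 ?addr0; last first.
  move=> i' /andP[iv' ii']; rewrite ent_sum big1 // => j' jv'.
  rewrite YE // eqxx /= -(inj_eq val_inj) /= eq_sym in ii' *.
  by rewrite (negbTE ii').
rewrite ent_sum (bigD1 (Ordinal jN)) //= YE // !eqxx /= big1 ?addr0 // => j' /andP[jv' jj'].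
rewrite YE // -(inj_eq val_inj) /= eq_sym in jj' *.
by rewrite (negbTE jj') !andbF.
Qed.

End MatrixUnits.

(** * Isomorphisms with sums of blocks *)

Section BlockQuotients.
Variables (F : fieldType) (A : nuAlgType F) (R : algType F) (J I : nuIdeal A).

(** An isomorphism of [J] modulo [I] with a sum of blocks, as a map on the
    whole algebra that is only controlled on [J]. This form avoids the
    subtype of [J] and the quotient until the very end. *)
Definition factor_blocks := exists (k : nat) (sz : 'I_k -> option nat)
    (f : A -> dsum (fun i => mx_block R (sz i))),
  [/\ forall c x y, x \in J -> y \in J -> f (c *: x + y) = c *: f x + f y,
      forall x y, x \in J -> y \in J -> f (x ** y) = f x ** f y,
      forall M, exists2 x, x \in J & f x = M &
      forall x, x \in J -> f x = 0 <-> x \in I].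

Lemma matrix_units_factor k (T : countType) (P : 'I_k -> pred T) ok (tau : int -> R)
    (u : 'I_k -> T -> T -> int -> A) ent :
  matrix_units J I P ok tau u ent -> factor_blocks.
Proof.
move=> mu.
have /choice[sz szP] : forall b, exists sz, exists g : nat -> T,
  [/\ forall i, in_block sz i -> P b (g i),
      forall i j, in_block sz i -> in_block sz j -> g i = g j -> i = j &
      forall p, P b p -> exists2 i, in_block sz i & g i = p].
  by move=> b; apply: enum_block; apply: (mu_nonempty mu).
have /choice[g gP] := szP.
have g1 b i : in_block (sz b) i -> P b (g b i) by case: (gP b) => H _ _; apply: H.
have g2 b i j : in_block (sz b) i -> in_block (sz b) j -> g b i = g b j -> i = j.
  by case: (gP b) => _ H _; apply: H.
have g3 b p : P b p -> exists2 i, in_block (sz b) i & g b i = p.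
  by case: (gP b) => _ _; apply.
exists k, sz, (to_blocks ent sz g); split.
- exact: (to_blocks_lin mu g1 g2 g3).
- exact: (to_blocks_mul mu g1 g2 g3).
- exact: (to_blocks_surj mu g1 g2 g3).
- exact: (to_blocks_eq0 mu g1 g2 g3).
Qed.

Lemma factor_blocks_quot : factor_blocks -> sum_of_mx_blocks R (factor_alg J I).
Proof.
move=> [k [sz [f [flin fmul fsurj fker]]]]; exists k, sz.
have fB x y : x \in J -> y \in J -> f (x - y) = f x - f y.
  by move=> xJ yJ; rewrite addrC -scaleN1r flin // scaleN1r addrC.
pose Q := factor_alg J I; pose h (X : Q) := f (val (repr X : ideal_alg J)).
have hpi (x : ideal_alg J) : h (\pi_Q x) = f (val x).
  apply/eqP; rewrite -subr_eq0 /h -fB; try exact: valP.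
  apply/eqP/fker; first by apply: rpredB; apply: valP.
  exact: (@quot_reprB F (ideal_alg J) (trace_ideal J I) x).
have h0 X : h X = 0 -> X = 0.
  elim/quot_ind: X => x; rewrite hpi => /(fker _ (valP x)) xI.
  have -> : 0 = \pi_Q (0 : ideal_alg J) by apply: (addIr (\pi_Q 0));
    rewrite add0r -quot_piD addr0.
  apply/eqP; rewrite (@quot_eqP F (ideal_alg J) (trace_ideal J I)) subr0.
  exact: xI.
have hlin : linear h.
  move=> c; elim/quot_ind => x; elim/quot_ind => y.
  have -> : c *: \pi_Q x + \pi_Q y = \pi_Q (c *: x + y).
    by rewrite quot_piD -quot_piZ.
  by rewrite !hpi /= flin //; apply: valP.
have hB X Y : h (X - Y) = h X - h Y by rewrite addrC -scaleN1r hlin scaleN1r addrC.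
exists h; split=> //.
  elim/quot_ind => x; elim/quot_ind => y.
  have -> : \pi_Q x ** \pi_Q y = \pi_Q (x ** y) by rewrite -quot_piM.
  by rewrite !hpi /= fmul //; apply: valP.
have /choice[x xP] : forall M, exists x : ideal_alg J, f (val x) = M.
  by move=> M; have [x xJ <-] := fsurj M; exists (exist _ x xJ).
exists (fun M => \pi_Q (x M)) => [X|M]; last by rewrite hpi.
by apply/eqP; rewrite -subr_eq0; apply/eqP/h0; rewrite hB hpi xP subrr.
Qed.

Lemma factor_blocks_ideal : (forall x, x \in I -> x = 0) ->
  factor_blocks -> sum_of_mx_blocks R (ideal_alg J).
Proof.
move=> I0 [k [sz [f [flin fmul fsurj fker]]]]; exists k, sz.
exists (fun x : ideal_alg J => f (val x)); split.
- by move=> c x y /=; apply: flin; apply: valP.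
- by move=> x y /=; apply: fmul; apply: valP.
have /choice[x xP] : forall M, exists x : ideal_alg J, f (val x) = M.
  by move=> M; have [x xJ <-] := fsurj M; exists (exist _ x xJ).
exists x => [y|M] //; apply/eqP; rewrite -subr_eq0 -val_eqE; apply/eqP/I0.
apply/(fker _ (valP (x _ - y))) => /=.
rewrite addrC -scaleN1r flin; try exact: valP.
by rewrite xP scaleN1r addNr.
Qed.

End BlockQuotients.

(** * Dedekind finiteness of matrix blocks *)

Section DedekindFinite.
Variables (F : fieldType).

(** One-sided inverses in the corner of an idempotent [v]. A cycle [c] at
    the vertex [v] provides the instance with [x] the ghost of [c] and [y]
    the cycle itself; there [y ** x = v] says that the cycle has no exit. *)
Definition corner_inverse (A : nuAlgType F) (v x y : A) :=
  [/\ v ** v = v, v ** x = x /\ x ** v = x, v ** y = y /\ y ** v = y & x ** y = v].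

(** Adding the complementary idempotent turns one-sided inverses in the
    corner into one-sided inverses in the full matrix ring, where they are
    two-sided because the coefficients commute. *)
Lemma mulmx_corner (R : comAlgType F) N (W M M' : 'M[R]_N) :
  W *m W = W -> W *m M = M /\ M *m W = M -> W *m M' = M' /\ M' *m W = M' ->
  M *m M' = W -> M' *m M = W.
Proof.
move=> WW [WM MW] [WM' M'W] MM'.
have UX (X : 'M_N) : W *m X = X -> (1%:M - W) *m X = 0.
  by move=> WX; rewrite mulmxBl mul1mx WX subrr.
have XU (X : 'M_N) : X *m W = X -> X *m (1%:M - W) = 0.
  by move=> XW; rewrite mulmxBr mulmx1 XW subrr.
have UU : (1%:M - W) *m (1%:M - W) = 1%:M - W.
  by rewrite mulmxBr mulmx1 UX // subr0.
have inv (X Y : 'M_N) : X *m W = X -> W *m Y = Y ->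
    (X + (1%:M - W)) *m (Y + (1%:M - W)) = X *m Y + (1%:M - W).
  by move=> XW WY; rewrite mulmxDl [X *m _]mulmxDr [(_ - _) *m _]mulmxDr UU XU // UX // addr0
    add0r.
have : (M + (1%:M - W)) *m (M' + (1%:M - W)) = 1%:M by rewrite inv // MM' addrC subrK.
move/mulmx1C; rewrite inv // => /(congr1 (fun X => X - (1%:M - W))).
by rewrite addrK opprB addrCA subrr addr0.
Qed.

Lemma block_corner (R : comAlgType F) sz (v x y : mx_block R sz) :
  corner_inverse v x y -> y ** x = v.
Proof.
move=> [vv [vx xv] [vy yv] xy].
(* The three matrices lie in a finite corner, even in an infinite block. *)
have [N1 N1P] := block_entry_fin v; have [N2 N2P] := block_entry_fin x;
  have [N3 N3P] := block_entry_fin y.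
pose N := maxn N1 (maxn N2 N3).
pose fits (z : mx_block R sz) := forall i j, (N <= i)%N || (N <= j)%N -> block_entry z i j = 0.
have weak N' (z : mx_block R sz) : (N' <= N)%N ->
    (forall i j, (N' <= i)%N || (N' <= j)%N -> block_entry z i j = 0) -> fits z.
  by move=> le zP i j /orP[] /(leq_trans le) le'; apply: zP; rewrite le' ?orbT.
have vN : fits v by apply: weak N1P; rewrite leq_maxl.
have xN : fits x by apply: weak N2P; rewrite /N leq_max leq_maxl orbT.
have yN : fits y by apply: weak N3P; rewrite /N !leq_max leqnn !orbT.
pose m (z : mx_block R sz) : 'M[R]_N := \matrix_(i, j) block_entry z i j.
have mM z z' : fits z -> m (z ** z') = m z *m m z'.
  move=> zN; apply/matrixP=> i j; rewrite !mxE (@block_entry_mul _ _ _ _ _ N); last first.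
    by move=> i' k Nk; rewrite zN // Nk orbT.
  by apply: eq_bigr => k _; rewrite !mxE.
have myx : m y *m m x = m v.
  by apply: (@mulmx_corner R N _ (m x)); rewrite -?mM // ?vv ?vx ?xv ?vy ?yv ?xy.
have fM z z' : fits z -> fits z' -> fits (z ** z').
  move=> zN z'N i j ij; rewrite (@block_entry_mul _ _ _ _ _ N); last first.
    by move=> i' k Nk; rewrite zN // Nk orbT.
  by apply: big1 => k _; case/orP: ij => Nij;
    [rewrite zN ?Nij ?mul0r | rewrite z'N ?Nij ?orbT ?mulr0].
apply: block_entry_inj => i j; case: (ltnP i N) => iN; last by rewrite fM ?vN ?iN.
case: (ltnP j N) => jN; last by rewrite fM ?vN ?jN ?orbT.
have := congr1 (fun X : 'M_N => X (Ordinal iN) (Ordinal jN)) myx.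
by rewrite -mM // !mxE.
Qed.

Lemma factor_blocks_corner (A : nuAlgType F) (R : comAlgType F) (J I : nuIdeal A) :
  factor_blocks R J I -> forall v x y, v \in J -> x \in J -> y \in J ->
  corner_inverse v x y -> y ** x - v \in I.
Proof.
move=> [k [sz [f [flin fmul fsurj fker]]]] v x y vJ xJ yJ [vv [vx xv] [vy yv] xy].
have yxJ : y ** x \in J by apply: absorbl.
apply/fker; first by apply: rpredB.
rewrite addrC -scaleN1r flin // scaleN1r fmul // addrC.
apply/eqP; rewrite subr_eq0; apply/eqP.
apply: functional_extensionality_dep => b.
have fb z t w : z \in J -> t \in J -> z ** t = w -> f z b ** f t b = f w b.
  by move=> zJ tJ <-; rewrite fmul.
apply: (@block_corner R (sz b) (f v b)); split.
- exact: fb.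
- by split; apply: fb.
- by split; apply: fb.
- exact: fb.
Qed.

End DedekindFinite.

(** * Cycles without common vertices *)

Section Orbits.
Variable G : digraph.
Local Notation V := (vertex G).
Local Notation E := (edge G).
Implicit Types (b u v w : V) (e f : E) (p q r : seq E).

(** Distinct cycles have no common vertex. *)
Definition disjoint_cycles := forall e f, esource e = esource f ->
  reach (erange e) (esource e) -> reach (erange f) (esource f) -> e = f.

(** An edge from which the path can return to [v] is preferred. When cycles
    are disjoint, the maximal path [follow v] of a vertex [v] on a cycle then
    runs around that cycle for ever. *)
Definition chosen_edge v : option E :=
  if [pick e | (esource e == v) && reach (erange e) v] is Some e then Some e
  else [pick e | esource e == v].

Lemma chosen_edge_src v e : chosen_edge v = Some e -> esource e = v.
Proof.
rewrite /chosen_edge; case: pickP => [f /andP[/eqP fv _] [<-] //|_].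
by case: pickP => // f /eqP fv [<-].
Qed.

Lemma chosen_edge_none v : chosen_edge v = None -> sink v.
Proof.
rewrite /chosen_edge; case: pickP => // _; case: pickP => // vs _.
by apply/sinkP=> e /eqP; rewrite vs.
Qed.

Definition next v := if chosen_edge v is Some e then erange e else v.
Definition follow v : stream G := fun n => (iter n next v, chosen_edge (iter n next v)).

Lemma maximal_follow v : maximal (follow v).
Proof.
apply/maximalP=> n; rewrite /stream_step /= {2}/next.
case ve: (chosen_edge (iter n next v)) => [e|].
  by rewrite (chosen_edge_src ve) /next ve !eqxx.
by rewrite (chosen_edge_none ve) /follow /= /next ve ve eqxx.
Qed.

Lemma stl_follow v : stl (follow v) = follow (next v).
Proof. by apply/funext=> n; rewrite /stl /follow iterSr. Qed.

Lemma sdom_follow v : sdom (follow v) = v. Proof. by []. Qed.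
Lemma follow_scons v e : chosen_edge v = Some e -> follow v = scons e (follow (erange e)).
Proof.
move=> ve; have [_ _ <-] := shd_some (maximal_follow v) ve.
by rewrite stl_follow /next ve.
Qed.

(** These paths are the row and column indices of the block of [b]. *)
Definition first_path b p := ispath p b && all (fun e => esource e != b) p.

Lemma first_path_exists u b : reach u b -> exists2 p, first_path b p & src p b = u.
Proof.
move=> /reachP[p pp <-]; elim: p pp => [|e p IH] /=; first by exists [::].
move=> /andP[/eqP ep /IH[q /andP[qp qb] qs]].
have [eb|eb] := eqVneq (esource e) b; first by exists [::]; rewrite /= ?eb.
by exists (e :: q); rewrite /first_path //= ep qs eqxx qp eb.
Qed.

Hypothesis nx : disjoint_cycles.

Lemma chosen_edge_cycle e : reach (erange e) (esource e) -> chosen_edge (esource e) = Some e.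
Proof.
move=> ee; rewrite /chosen_edge; case: pickP => [f /andP[/eqP fe ff]|/(_ e)];
  last by rewrite eqxx ee.
by congr Some; apply: nx => //; rewrite fe.
Qed.

(** As long as the two paths have not reached [b], they run along the cycle
    of [b], which leaves no choice for the next edge. *)
Lemma first_path_unique b p q : first_path b p -> first_path b q ->
  src p b = src q b -> reach b (src p b) -> p = q.
Proof.
elim: p q => [|e p IH] [|f q] //=.
- by move=> _ /andP[_ /= /andP[/eqP fb _]] /esym.
- by move=> /andP[_ /= /andP[/eqP fb _]] _ /fb.
move=> /andP[/= /andP[/eqP ep pp] /andP[eb pb]] /andP[/= /andP[/eqP fq qp] /andP[fb qb]] ef be.
have eE : e = f.
  apply: nx => //.
    by rewrite ep; apply: reach_trans be; apply: ispath_reach.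
  by rewrite -ef fq; apply: reach_trans be; apply: ispath_reach.
rewrite -eE; congr (_ :: _); apply: IH; rewrite /first_path ?pp ?qp //.
  by rewrite -ep -fq eE.
by rewrite -ep; apply: reach_trans be _; apply: reach_edge.
Qed.

Lemma scat_follow b p : ispath p b -> reach b (src p b) -> scat p (follow b) = follow (src p b).
Proof.
elim: p => //= e p IH /andP[/eqP ep pp] be.
have eb : reach (erange e) b by rewrite ep; apply: ispath_reach.
rewrite IH -?ep //; last by apply: reach_trans be _; apply: reach_edge.
by rewrite -(@follow_scons (esource e)) //; apply: chosen_edge_cycle; apply: reach_trans be.
Qed.

Lemma cycle_exists b : exists c, [/\ ispath c b, src c b = b, ~~ cyclic b -> c = [::] &
   cyclic b -> exists e c', [/\ c = e :: c', esource e = b & first_path b c']].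
Proof.
case: (boolP (cyclic b)) => [/cyclicP[e eb /first_path_exists[p pp ps]]|_]; last by exists [::].
exists (e :: p); rewrite /= ps eqxx; split=> //.
- by case/andP: pp.
- by exists e, p.
Qed.

(** The empty path when [b] lies on no cycle, which makes sinks a
    degenerate case of cycles. *)
Definition cycle_at b : seq E := projT1 (cid (cycle_exists b)).
Fixpoint cpow b n : seq E := if n is n'.+1 then cycle_at b ++ cpow b n' else [::].

Lemma cycle_path b : ispath (cycle_at b) b. Proof. by rewrite /cycle_at; case: cid => c []. Qed.
Lemma cycle_src b : src (cycle_at b) b = b. Proof. by rewrite /cycle_at; case: cid => c []. Qed.
Lemma cycle_cyclic b : cyclic b ->
  exists e c', [/\ cycle_at b = e :: c', esource e = b & first_path b c'].
Proof. by rewrite /cycle_at; case: cid => c []. Qed.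

Lemma cpow_src b n : src (cpow b n) b = b.
Proof. by elim: n => //= n IH; rewrite src_cat IH cycle_src. Qed.
Lemma cpow_path b n : ispath (cpow b n) b.
Proof. by elim: n => //= n IH; rewrite ispath_cat cpow_src cycle_path. Qed.
Lemma cpowSr b n : cpow b n.+1 = cpow b n ++ cycle_at b.
Proof. by elim: n => [|n IH]; rewrite /= ?cats0 // -catA -IH. Qed.

Lemma cpow_follow b n : scat (cpow b n) (follow b) = follow b.
Proof. by rewrite scat_follow ?cpow_path // cpow_src // reach_refl. Qed.

(** Each visit to [b] before the last one begins a full turn around the
    cycle of [b], since no other path leads from [b] back to [b]. *)
Lemma path_factor b p : cyclic b -> ispath p b ->
  exists p0 n, first_path b p0 /\ p = p0 ++ cpow b n.
Proof.
move=> cb; have [f [c' [cE fb c'P]]] := cycle_cyclic cb.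
have := cycle_path b; rewrite cE /= => /andP[/eqP fc c'p].
have frb : reach (erange f) b by rewrite fc; apply: ispath_reach.
elim: p => [|e p IH] /=; first by exists [::], 0%N.
move=> /andP[/eqP ep /IH[p0 [n [p0P pE]]]].
have ep0 : erange e = src p0 b by rewrite ep pE src_cat cpow_src.
have [eb|eb] := eqVneq (esource e) b; last first.
  exists (e :: p0), n; rewrite pE; split=> //; case/andP: p0P => p0p p0b.
  by rewrite /first_path /= p0p eb p0b ep0 eqxx.
exists [::], n.+1; split=> //=; rewrite cE pE /=.
have erb : reach (erange e) b by rewrite ep0; apply: ispath_reach; case/andP: p0P.
have -> : e = f by apply: nx; rewrite ?eb ?fb.
congr (_ :: (_ ++ _)); apply: (@first_path_unique b) => //; rewrite -ep0.
  by rewrite -fc; congr erange; apply: nx; rewrite ?eb ?fb.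
by rewrite -eb; apply: reach_edge.
Qed.

Lemma next_class b u : cyclic b || sink b -> reach b u -> reach u b ->
  reach b (next u) /\ reach (next u) b.
Proof.
case/orP=> [cb|/sinkP sb] bu ub.
  have /cyclicP[e eu er] := cyclic_class ub bu cb.
  have := @chosen_edge_cycle e; rewrite eu => /(_ er) uE; rewrite /next uE; split.
    by apply: reach_trans bu _; rewrite -eu; apply: reach_edge.
  exact: reach_trans ub.
case/reach_step: (bu) => [bE|[e /sb //]]; rewrite -bE /next.
by case be: (chosen_edge b) => [e|]; [case: (sb e (chosen_edge_src be)) | rewrite reach_refl].
Qed.

Lemma follow_tail b u r y : cyclic b || sink b -> reach b u -> reach u b ->
  follow u = scat r y -> reach (sdom y) b.
Proof.
move=> cb; elim: r u => [|e r IH] u bu ub /=; first by move=> <-.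
move=> /(congr1 (@stl G)); rewrite stl_scons stl_follow.
by have [? ?] := next_class cb bu ub; apply: IH.
Qed.

Lemma tail_reach b p q y : cyclic b || sink b -> ispath q b ->
  scat p y = scat q (follow b) -> reach (sdom y) b.
Proof.
move=> cb qp /scat_prefix[][r rE yE].
  rewrite yE sdom_scat sdom_follow; apply: ispath_reach.
  by move: qp; rewrite rE ispath_cat => /andP[].
exact: follow_tail (reach_refl b) (reach_refl b) yE.
Qed.

(** If one of the two paths were a proper prefix of the other, the longer
    one would leave [b] before its end. *)
Lemma first_path_scat b q q' y : first_path b q -> first_path b q' -> sdom y = b ->
  scat q y = scat q' (follow b) -> q = q' /\ y = follow b.
Proof.
move=> /andP[qp qb] /andP[q'p q'b] yb /scat_prefix[][r rE yE].
  case: r rE yE => [|e r] rE yE; first by rewrite rE cats0.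
  move: q'b; rewrite rE all_cat => /andP[_ /= /andP[/eqP[]]].
  by rewrite -yb yE.
case: r rE yE => [|e r] rE yE; first by rewrite rE cats0.
move: qb; rewrite rE all_cat => /andP[_ /= /andP[/eqP[]]].
by have := congr1 (@sdom G) yE; rewrite sdom_follow.
Qed.

End Orbits.

(** * Matrix units attached to cycles and to sinks *)

Section LeavittUnits.
Variables (F : fieldType) (G : digraph) (R : algType F).
Variables (tau : int -> R) (ok : pred int).
Hypotheses (tau0 : tau 0 = 1) (tauD : forall m n, tau (m + n) = tau m * tau n).
Hypothesis tau_free : forall (s : seq int) (a : int -> F), uniq s -> all ok s ->
    \sum_(m <- s) a m *: tau m = 0 -> forall m, m \in s -> a m = 0.
Hypothesis tau_gen : forall r : R, exists (s : seq int) (a : int -> F),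
    all ok s /\ r = \sum_(m <- s) a m *: tau m.
Local Notation V := (vertex G).
Local Notation E := (edge G).
Local Notation L := (leavitt F G).
Implicit Types (b d v w : V) (e f : E) (p q r : seq E) (m : int) (x y : stream G).

Hypothesis nx : disjoint_cycles G.

(** One layer of the graph: [H'] is cut down to [H]. The set [B] contains
    one vertex on each cycle of the layer and all its sinks. A cycle of the
    layer can only be left towards [H], so it has no exit modulo the ideal
    of [H]. The hypothesis [B_ok] covers the two uses of the section,
    layers of cycles over Laurent polynomials and a layer of sinks over the
    ground field. *)
Variables (H H' B : {set V}).
Hypotheses (hH : hereditary H) (hH' : hereditary H') (HH' : H \subset H').
Hypothesis B_sub : forall b, b \in B -> b \in H' /\ b \notin H.
Hypothesis B_sink : forall w, w \in H' -> w \notin H -> sink w -> w \in B.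
Hypothesis B_cyclic : forall w, w \in H' -> w \notin H -> cyclic w ->
  exists2 b, b \in B & reach w b /\ reach b w.
Hypothesis B_exit : forall b e, b \in B -> reach b (esource e) -> reach (esource e) b ->
  erange e \in H \/ reach (erange e) (esource e).
Hypothesis B_indep : forall b d, b \in B -> d \in B -> reach b d -> b = d.
Hypothesis B_ok : forall b, b \in B ->
  (cyclic b /\ forall m, ok m) \/ (sink b /\ forall m, ok m = (m == 0)).

(** Counts the departures from [b]: a path in [first_path b] has weight [0]
    and a turn around the cycle has weight [1]. *)
Definition base_wt b e : int := (esource e == b)%:R.
Definition delta x y : R := if `[< x = y >] then 1 else 0.
Definition base_act b := act tau (base_wt b) (F := F).

(** The functions concentrated at the maximal paths [scat q (follow b)]
    span a free module on which the algebra acts; this is a coefficient of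
    the action there. *)
Definition leavitt_entry b p q (x : L) : R :=
  base_act b x (delta (scat q (follow b))) (scat p (follow b)).

Definition leavitt_unit b p q m : L :=
  match m with
  | Posz n => mon F (p ++ cpow b n) q b
  | Negz n => mon F p (q ++ cpow b n.+1) b
  end.

Lemma delta_refl x : delta x x = 1.
Proof. by rewrite /delta asboolT. Qed.
Lemma delta_neq x y : x <> y -> delta x y = 0.
Proof. by move=> xy; rewrite /delta asboolF. Qed.

Lemma pwt_first b p : first_path b p -> pwt (base_wt b) p = 0.
Proof.
move=> /andP[_ /allP pb]; rewrite /pwt big_seq big1 // => e /pb.
by rewrite /base_wt => /negbTE ->.
Qed.

Lemma pwt_cat b p q : pwt (base_wt b) (p ++ q) = pwt (base_wt b) p + pwt (base_wt b) q.
Proof. exact: big_cat. Qed.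

Lemma pwt_cpow b n : cyclic b -> pwt (base_wt b) (cpow b n) = n%:Z.
Proof.
move=> cb; elim: n => [|n IH] /=; first by rewrite /pwt big_nil.
have [e [c' [cE eb c'P]]] := cycle_cyclic cb.
rewrite pwt_cat IH cE -cat1s pwt_cat (pwt_first c'P) addr0 {1}/pwt big_seq1.
by rewrite /base_wt eb eqxx -PoszD.
Qed.

Lemma base_end b : b \in B -> cyclic b || sink b.
Proof. by case/B_ok => [[-> _]|[-> _]]; rewrite ?orbT. Qed.

(** A maximal path that ends by circling at [b], or by stopping there, only
    visits vertices from which [b] can be reached. *)
Lemma act_apart b p q q' d : b \in B -> ispath q' b -> ispath p d -> ispath q d ->
  ~~ reach d b -> base_act b (mon F p q d) (delta (scat q' (follow b))) = fun=> 0.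
Proof.
move=> bB q'p pp qp db; apply/funext=> x.
have [[y ym [yd ->]]|nx0] := pselect (exists2 y, maximal y & sdom y = d /\ x = scat p y).
  rewrite /base_act (act_mon _ tau0 tauD) // delta_neq ?mulr0 // => /esym qy.
  by move: db; rewrite -yd (tail_reach nx (base_end bB) q'p qy).
by apply: (act_mon0 _ tau0 tauD) => y ym yd xp; apply: nx0; exists y.
Qed.

(** On concentrated functions the monomials act exactly as matrix units
    times powers of the variable: [q'] and [q] have to agree by
    [first_path_scat], and turns around the cycle are absorbed by [follow
    b]. *)
Lemma act_units b p q q' n n' : b \in B -> first_path b p -> first_path b q ->
  first_path b q' -> cyclic b \/ (n = 0 /\ n' = 0)%N ->
  base_act b (mon F (p ++ cpow b n) (q ++ cpow b n') b) (delta (scat q' (follow b))) =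
  fun x => delta (scat p (follow b)) x * (if q == q' then tau (n%:Z - n'%:Z) else 0).
Proof.
move=> bB pP qP q'P cb.
have wtE r k : first_path b r -> k = n \/ k = n' ->
    pwt (base_wt b) (r ++ cpow b k) = k%:Z.
  move=> rP kn; rewrite pwt_cat (pwt_first rP) add0r; case: cb => [cb|[n0 n'0]].
    exact: pwt_cpow.
  by have -> : k = 0%N by [case: kn => ->]; rewrite /pwt big_nil.
have pathP r k : first_path b r -> ispath (r ++ cpow b k) b.
  by move=> /andP[rp _]; rewrite ispath_cat cpow_src rp cpow_path.
have fold r k : scat (r ++ cpow b k) (follow b) = scat r (follow b).
  by rewrite scat_cat cpow_follow.
apply/funext=> x.
have [[y ym [yb ->]]|nx0] :=
    pselect (exists2 y, maximal y & sdom y = b /\ x = scat (p ++ cpow b n) y); last first.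
  rewrite /base_act (act_mon0 _ tau0 tauD); last by move=> y ym yd xp; apply: nx0; exists y.
  rewrite delta_neq ?mul0r // => xp; apply: nx0; exists (follow b); first exact: maximal_follow.
  by rewrite fold.
rewrite /base_act (act_mon _ tau0 tauD) ?pathP // !wtE //; do ?[by left | by right].
have [yE|yE] := pselect (y = follow b).
  rewrite yE !fold delta_refl mul1r; case: eqP => [<-|qq']; first by rewrite delta_refl mulr1.
  rewrite delta_neq ?mulr0 // => /esym.
  by case/(first_path_scat qP q'P (sdom_follow b)).
rewrite [delta (scat p _) _]delta_neq ?mul0r; last first.
  by rewrite -(fold p n) => /scat_inj /esym.
rewrite delta_neq ?mulr0 // => /esym; rewrite scat_cat.
case/(first_path_scat qP q'P); first by rewrite sdom_scat yb cpow_src.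
by rewrite -(cpow_follow nx b n') => _ /scat_inj.
Qed.

Lemma act_leavitt_unit b p q q' m : b \in B -> first_path b p -> first_path b q ->
  first_path b q' -> ok m ->
  base_act b (leavitt_unit b p q m) (delta (scat q' (follow b))) =
  fun x => delta (scat p (follow b)) x * (if q == q' then tau m else 0).
Proof.
move=> bB pP qP q'P mo; case: m mo => n mo /=.
  have := @act_units b p q q' n 0; rewrite /= cats0 subr0; apply=> //.
  by case: (B_ok bB) => [[cb _]|[_ okE]]; [left | right; move: mo; rewrite okE => /eqP[]].
have := @act_units b p q q' 0 n.+1; rewrite [p ++ _]cats0 sub0r NegzE; apply=> //.
by case: (B_ok bB) => [[cb _]|[_ okE]]; [left | move: mo; rewrite okE].
Qed.

Lemma leavitt_unit_mon b p q m : first_path b p -> first_path b q ->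
  exists p' q', [/\ ispath p' b, ispath q' b & leavitt_unit b p q m = mon F p' q' b].
Proof.
have pathP r k : first_path b r -> ispath (r ++ cpow b k) b.
  by move=> /andP[rp _]; rewrite ispath_cat cpow_src rp cpow_path.
move=> pP qP; case: m => n; [exists (p ++ cpow b n), q | exists p, (q ++ cpow b n.+1)];
  by split=> //; rewrite ?pathP //; case/andP: pP; case/andP: qP.
Qed.

Lemma act_leavitt_unit_apart b d p q q' m : b \in B -> d \in B -> b != d -> first_path b q' ->
  first_path d p -> first_path d q ->
  base_act b (leavitt_unit d p q m) (delta (scat q' (follow b))) = fun=> 0.
Proof.
move=> bB dB bd /andP[q'p _] pP qP; have [p1 [q1 [p1p q1p ->]]] := leavitt_unit_mon m pP qP.
apply: act_apart => //; apply: contra bd => db; apply/eqP/esym; exact: B_indep.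
Qed.

Lemma act_delta0 b (x : L) : base_act b x (fun=> 0) = fun=> 0.
Proof.
have := act_mulr tau (base_wt b) x (fun=> 0) 0.
rewrite /base_act; under [X in act _ _ _ X]eq_fun do rewrite mulr0.
by move=> ->; apply/funext=> y; rewrite mulr0.
Qed.

Lemma delta_first b p q : first_path b p -> first_path b q ->
  delta (scat p (follow b)) (scat q (follow b)) = (q == p)%:R.
Proof.
move=> pP qP; case: eqP => [->|qp]; first by rewrite delta_refl.
by rewrite delta_neq // => /(first_path_scat pP qP (sdom_follow b))[/esym].
Qed.

Local Notation I := (videal F hH).
Local Notation J := (videal F hH').

Definition spanned_mod (x : L) := exists2 y, y \in I &
  lin_span [set x | exists b p q m, [/\ b \in B, first_path b p /\ first_path b q,
    ok m & x = leavitt_unit b p q m]] (x - y).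

Lemma spanned_mod_subspace : is_subspace [set x | spanned_mod x].
Proof.
have sS := @lin_span_subspace F L.
split=> [|c x1 x2 [y1 y1I x1S] [y2 y2I x2S]].
  by exists 0; rewrite ?rpred0 // subrr; apply: subspace0.
exists (c *: y1 + y2); first by apply: rpredD => //; apply: rpredZ.
rewrite opprD addrACA -scalerBr; exact: (sS _).2.
Qed.

Lemma spanned_mod_cong (x y : L) : x - y \in I -> spanned_mod y -> spanned_mod x.
Proof.
move=> xyI [z zI yz]; exists ((x - y) + z); first exact: rpredD.
by rewrite opprD opprB addrA addrCA subrr addr0.
Qed.

Lemma spanned_mod_ideal (x : L) : x \in I -> spanned_mod x.
Proof.
move=> xI; apply: (@spanned_mod_cong x 0); rewrite ?subr0 //.
exact: subspace0 spanned_mod_subspace.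
Qed.

(** Expanding the meeting vertex once along a cycle yields one term for the
    edge on the cycle; all other edges lead into [H] and contribute
    elements of the ideal of [H]. *)
Lemma mon_shift b p q r : b \in B -> ispath r b -> reach b (src r b) ->
  ispath p (src r b) -> ispath q (src r b) ->
  mon F p q (src r b) - mon F (p ++ r) (q ++ r) b \in I.
Proof.
move=> bB; elim: r p q => [|e r IH] p q /=; first by rewrite !cats0 subrr rpred0.
move=> /andP[/eqP er rp] be pp qp.
have eb : reach (erange e) b by rewrite er; apply: ispath_reach.
have ee : reach (erange e) (esource e) by apply: reach_trans be.
rewrite mon_expand; last by apply/forallPn; exists e; rewrite negbK.
rewrite (bigD1 e) //= addrAC; apply: rpredD.
  rewrite er -!cat_rcons; apply: IH => //.
  - by rewrite -er; apply: reach_trans be _; apply: reach_edge.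
  - by rewrite ispath_rcons pp er eqxx.
  - by rewrite ispath_rcons qp er eqxx.
apply: rpred_sum => f /andP[/eqP fe nfe]; apply/videalP; apply: monsP.
- have [] // := @B_exit b f bB; rewrite ?fe //; first exact: reach_edge_trans.
  by move=> ff; case/eqP: nfe; apply: nx; rewrite ?fe.
- by rewrite ispath_rcons fe pp eqxx.
- by rewrite ispath_rcons fe qp eqxx.
Qed.

(** Common powers of the cycle cancel modulo the ideal of [H], so that only
    the difference of the two exponents matters. *)
Lemma mon_reduce b p q k n : b \in B -> ispath p b -> ispath q b ->
  mon F (p ++ cpow b k) q b - mon F (p ++ cpow b (k + n)) (q ++ cpow b n) b \in I /\
  mon F p (q ++ cpow b k) b - mon F (p ++ cpow b n) (q ++ cpow b (k + n)) b \in I.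
Proof.
move=> bB pp qp.
have pathP r j : ispath r b -> ispath (r ++ cpow b j) b.
  by move=> rp; rewrite ispath_cat cpow_src rp cpow_path.
elim: n => [|n [IH1 IH2]]; first by rewrite !addn0 !cats0 !subrr !rpred0.
have step p' q' : ispath p' b -> ispath q' b ->
    mon F p' q' b - mon F (p' ++ cycle_at b) (q' ++ cycle_at b) b \in I.
  move=> p'p q'p; have := @mon_shift b p' q' (cycle_at b) bB (cycle_path b).
  by rewrite cycle_src reach_refl; apply.
rewrite addnS !cpowSr !catA; split.
  have := rpredD IH1 (step _ _ (pathP _ (k + n)%N pp) (pathP _ n qp)).
  by rewrite addrA subrK.
have := rpredD IH2 (step _ _ (pathP _ n pp) (pathP _ (k + n)%N qp)).
by rewrite addrA subrK.
Qed.

Lemma spanned_mod_unit b p q m : b \in B -> first_path b p -> first_path b q -> ok m ->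
  spanned_mod (leavitt_unit b p q m).
Proof.
move=> bB pP qP mo; exists 0; rewrite ?rpred0 // subr0.
by apply: lin_span_in; exists b, p, q, m.
Qed.

Lemma spanned_mod_base b p q : b \in B -> ispath p b -> ispath q b -> spanned_mod (mon F p q b).
Proof.
move=> bB pp qp; case: (B_ok bB) => [[cb okm]|[sb okm]]; last first.
  have fpP r : ispath r b -> first_path b r.
    by move=> rp; rewrite /first_path rp; apply/allP=> e _; move/forallP: sb.
  have := @spanned_mod_unit b p q 0 bB (fpP _ pp) (fpP _ qp); rewrite okm eqxx => /(_ isT).
  by rewrite /= cats0.
have [p0 [n [p0P ->]]] := path_factor nx cb pp.
have [q0 [k [q0P ->]]] := path_factor nx cb qp.
have p0p : ispath p0 b by case/andP: p0P.
have q0p : ispath q0 b by case/andP: q0P.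
have flip (x y : L) : x - y \in I -> y - x \in I by rewrite -rpredN opprB.
case: (leqP k n) => [kn|nk].
  have [+ _] := @mon_reduce b p0 q0 (n - k) k bB p0p q0p.
  rewrite subnK // => /flip /spanned_mod_cong; apply.
  exact: (@spanned_mod_unit b p0 q0 (Posz (n - k)) bB p0P q0P (okm _)).
have [_ +] := @mon_reduce b p0 q0 (k - n) n bB p0p q0p.
rewrite subnK; last exact: ltnW.
move=> /flip /spanned_mod_cong; apply.
have := @spanned_mod_unit b p0 q0 (Negz (k - n).-1) bB p0P q0P (okm _).
by rewrite /leavitt_unit prednK // subn_gt0.
Qed.

(** Expanding at a vertex on no cycle strictly shrinks the set of reachable
    vertices. The process ends at a sink, in [H], or on a cycle, where
    [mon_shift] moves the meeting vertex to the base. *)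
Lemma spanned_mod_mon p q w : w \in H' -> ispath p w -> ispath q w -> spanned_mod (mon F p q w).
Proof.
have [k] := ubnP #|[pred v | reach w v]|; elim: k w p q => // k IH w p q wk wH' pp qp.
have [wH|wH] := boolP (w \in H); first by apply/spanned_mod_ideal/videalP; apply: monsP.
have [cw|cw] := boolP (cyclic w).
  have [b bB [/reachP[r rp rw] bw]] := B_cyclic wH' wH cw.
  move: pp qp bw; rewrite -rw => pp qp bw.
  have := @mon_shift b p q r bB rp bw pp qp; move=> /spanned_mod_cong; apply.
  by apply: spanned_mod_base; rewrite // ispath_cat rp ?pp ?qp.
have [sw|sw] := boolP (sink w); first by apply: spanned_mod_base => //; apply: B_sink.
rewrite mon_expand //; apply: (subspace_sum (W := [set x | spanned_mod x])).
  exact: spanned_mod_subspace.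
move=> e /eqP ew; apply: IH.
- by rewrite -ew in cw wk; apply: leq_trans (reach_lt cw) _.
- by apply: hH'; rewrite ew.
- by rewrite ispath_rcons ew pp eqxx.
- by rewrite ispath_rcons ew qp eqxx.
Qed.

Lemma spanned_mod_videal (x : L) : x \in J -> spanned_mod x.
Proof.
move/videalP; apply: (lin_span_min (W := [set x | spanned_mod x]));
  first exact: spanned_mod_subspace.
by move=> y [p [q [w [wH' pp qp ->]]]]; apply: spanned_mod_mon.
Qed.

Lemma leavitt_entry_lin b p q c (x y : L) :
  leavitt_entry b p q (c *: x + y) = c *: leavitt_entry b p q x + leavitt_entry b p q y.
Proof. by rewrite /leavitt_entry /base_act act_linear. Qed.

Let base (i : 'I_#|B|) : V := enum_val i.

Lemma leavitt_units : matrix_units J I (fun i => first_path (base i)) ok tau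
  (fun i => leavitt_unit (base i)) (fun i => leavitt_entry (base i)).
Proof.
have bB i : base i \in B := enum_valP i.
have bE i j : (base i == base j) = (i == j) by rewrite (inj_eq enum_val_inj).
split=> //.
- by move=> b p q c x y; apply: leavitt_entry_lin.
- by move=> b; exists [::].
- exact: videalS.
- move=> b p q m pP qP mo; have [p1 [q1 [p1p q1p ->]]] := leavitt_unit_mon m pP qP.
  by apply/videalP; apply: monsP => //; case: (B_sub (bB b)).
- move=> x /spanned_mod_videal [y yI xy]; exists y => //; apply: lin_spanS xy.
  move=> z [b [p [q [m [bB' [pP qP] mo ->]]]]].
  exists (enum_rank_in bB' b), p, q, m; rewrite /base enum_rankK_in //.
- move=> b p q x pP qP /videalP; apply:
    (lin_span_min (W := [set x | leavitt_entry (base b) p q x = 0])).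
    split=> [|c y z /= y0 z0]; first exact: act_0.
    by rewrite leavitt_entry_lin y0 z0 scaler0 addr0.
  move=> _ [p1 [q1 [w [wH p1p q1p ->]]]] /=.
  rewrite /leavitt_entry act_apart //; first by case/andP: qP.
  have [_] := B_sub (bB b); apply: contra => wb; exact: (hereditary_reach hH wb).
- move=> b d p q p' q' m pP qP p'P q'P mo; rewrite /leavitt_entry.
  have [bd|bd] := eqVneq b d; last by rewrite act_leavitt_unit_apart ?bE.
  move: p'P q'P; rewrite -bd => p'P q'P; rewrite act_leavitt_unit // delta_first //= eq_sym
    [q' == q]eq_sym.
  by rewrite eq_sym; case: eqP => _; case: eqP => _; rewrite ?mul0r ?mul1r.
- move=> b d p q p' q' m x pP qP p'P q'P mo; rewrite /leavitt_entry /base_act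
    (act_mul _ tau0 tauD).
  have [bd|bd] := eqVneq b d; last first.
    by have /= := act_leavitt_unit_apart m (bB b) (bB d); rewrite /base_act => ->;
      rewrite ?bE // [act _ _ _ _](act_delta0 (base b) x).
  move: p'P q'P; rewrite -bd => p'P q'P.
  have := @act_leavitt_unit (base b) p' q' q m (bB b) p'P q'P qP mo; rewrite /base_act => ->.
  rewrite act_mulr eq_sym /=; by case: eqP => _ //; rewrite mulr0.
Qed.

End LeavittUnits.

(** * Powers of the Laurent variable *)

Section LaurentPowers.
Variable F : fieldType.
Local Notation K := {fraction {poly F}}.
Local Notation X := (tofrac ('X : {poly F})).
Implicit Types (m n : int).

Lemma tofracX_neq0 : X != 0 :> K.
Proof. by rewrite tofrac_eq0 polyX_eq0. Qed.

Lemma tofracXn k : tofrac ('X^k : {poly F}) = X ^+ k.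
Proof. by elim: k => [|k IH]; rewrite ?expr0 ?tofrac1 // !exprS tofracM IH. Qed.

Lemma laurent_pow_subproof m : X ^ m \in @laurent_pred F.
Proof.
apply/laurentP; case: m => k; first by exists 'X^k, 0%N; rewrite expr0 tofrac1 divr1 tofracXn.
by exists 1, k.+1; rewrite tofrac1 div1r tofracXn.
Qed.

Definition laurent_pow m : laurent F := exist _ (X ^ m) (laurent_pow_subproof m).

Lemma laurent_pow0 : laurent_pow 0 = 1.
Proof. exact: val_inj. Qed.

Lemma laurent_powD m n : laurent_pow (m + n) = laurent_pow m * laurent_pow n.
Proof. by apply: val_inj; rewrite /= expfzDr // tofracX_neq0. Qed.

Lemma val_laurent_sum (T : Type) (s : seq T) (a : T -> F) (f : T -> int) :
  val (\sum_(i <- s) a i *: laurent_pow (f i)) = \sum_(i <- s) tofrac (a i)%:P * X ^ (f i).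
Proof. by rewrite raddf_sum. Qed.

(** Multiplication by a large power of the variable clears the negative
    exponents and reduces the claim to polynomials. *)
Lemma laurent_pow_free (s : seq int) (a : int -> F) : uniq s -> all xpredT s ->
  \sum_(m <- s) a m *: laurent_pow m = 0 -> forall m, m \in s -> a m = 0.
Proof.
move=> us _ s0 m0 m0s; pose N := (\sum_(m <- s) `|m|)%N.
have Nm m : m \in s -> exists k : nat, m + N%:Z = k%:Z.
  move=> ms; have le : (`|m| <= N)%N by rewrite /N (big_rem m) //= leq_addr.
  exists (absz (m + N%:Z)); rewrite gez0_abs //;
    apply: (@Order.POrderTheory.le_trans _ _ (m + `|m|)).
    by rewrite -[X in X <= _](addNr m) addrC Num.Theory.lerD2l -Num.Theory.normrN
      Num.Theory.ler_norm.
  by rewrite Num.Theory.lerD2l -abszE lez_nat.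
have := congr1 val s0; rewrite val_laurent_sum => /(congr1 (fun x => x * X ^ N%:Z)).
rewrite mul0r mulr_suml => E.
have {}E : tofrac (\sum_(m <- s) (a m)%:P * 'X^(absz (m + N%:Z))) = 0 :> K.
  rewrite -[RHS]E (big_morph _ (@tofracD _) (@tofrac0 _)) [LHS]big_seq [RHS]big_seq.
  apply: eq_bigr => m /Nm[k kE]; rewrite -mulrA -expfzDr ?tofracX_neq0 // kE.
  by rewrite tofracM tofracXn.
have /(congr1 (fun p : {poly F} => p`_(absz (m0 + N%:Z)))) :
    \sum_(m <- s) (a m)%:P * 'X^(absz (m + N%:Z)) = 0 :> {poly F}.
  by apply/eqP; rewrite -tofrac_eq0 E.
rewrite coef0 coef_sum (bigD1_seq m0) //= coefCM coefXn eqxx mulr1 big_seq_cond big1 ?addr0 //.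
move=> m /andP[ms mm0]; rewrite coefCM coefXn.
have [k kE] := Nm _ ms; have [k0 k0E] := Nm _ m0s.
rewrite kE k0E /=; case: eqP => [kk|_]; last by rewrite mulr0.
by case/eqP: mm0; apply: (addIr N%:Z); rewrite kE k0E kk.
Qed.

Lemma laurent_pow_gen (r : laurent F) : exists (s : seq int) (a : int -> F),
  all xpredT s /\ r = \sum_(m <- s) a m *: laurent_pow m.
Proof.
have [p [n rE]] := laurentP _ (valP r).
exists [seq (i%:Z - n%:Z) | i <- iota 0 (size p)], (fun m => p`_(absz (m + n%:Z))).
split; first by apply/allP.
apply: val_inj; rewrite rE big_map val_laurent_sum.
have -> : tofrac p = \sum_(i <- iota 0 (size p)) tofrac (p`_i)%:P * X ^ i%:Z.
  rewrite -{1}[p]coefK poly_def (big_morph _ (@tofracD _) (@tofrac0 _)).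
  have -> : iota 0 (size p) = index_iota 0 (size p) by rewrite /index_iota subn0.
  rewrite big_mkord; apply: eq_bigr => i _.
  by rewrite -mul_polyC tofracM tofracXn.
rewrite mulr_suml; apply: eq_bigr => i _.
by rewrite subrK /= -mulrA expfzDr ?tofracX_neq0 // tofracXn exprnN.
Qed.

Lemma one_free (s : seq int) (a : int -> F) : uniq s -> all (pred1 0) s ->
  \sum_(m <- s) a m *: (1 : F^o) = 0 -> forall m, m \in s -> a m = 0.
Proof.
move=> us /allP os s0 m ms; move: s0; rewrite (bigD1_seq m) //= big_seq_cond big1.
  by rewrite addr0 => /= <-; rewrite /GRing.scale /= mulr1.
move=> n /andP[ns /eqP nm]; case: nm.
by rewrite (eqP (os _ ns)) (eqP (os _ ms)).
Qed.

Lemma one_gen (r : F^o) : exists (s : seq int) (a : int -> F),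
  all (pred1 0) s /\ r = \sum_(m <- s) a m *: (1 : F^o).
Proof.
exists [:: 0], (fun=> r); split=> //=.
by rewrite big_seq1 /GRing.scale /= mulr1.
Qed.

End LaurentPowers.

(** Otherwise [g] and its product with the variable would both be scalars. *)
Lemma laurent_rank_one (F : fieldType) (g : laurent F) (c0 c1 : F) :
  g * laurent_pow F 0 * g = c0 *: g -> g * laurent_pow F 1 * g = c1 *: g -> g = 0.
Proof.
move=> c0E c1E; apply: contrapT => /eqP g0.
have gval : val g != 0 by rewrite -(inj_eq val_inj) in g0.
have gc0 : val g = tofrac c0%:P.
  apply: (mulIf gval); have := congr1 val c0E.
  by rewrite laurent_pow0 mulr1.
have gc1 : val g * tofrac 'X = tofrac c1%:P.
  by apply: (mulIf gval); apply: (congr1 val c1E).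
have : c0%:P * 'X = c1%:P :> {poly F}.
  by apply/eqP; rewrite -tofrac_eq tofracM -gc0 gc1.
move/(congr1 (fun r : {poly F} => r`_1)); rewrite coefMX !coefC /= => c00.
by move: gval; rewrite gc0 c00 polyC0 tofrac0 eqxx.
Qed.

(** * Growth and disjoint cycles *)

(** The function with constant value one is fixed by [v] at every maximal
    path that starts at [v]. *)
Lemma vert_neq0 (F : fieldType) (G : digraph) (v : vertex G) : vert F v != 0.
Proof.
pose tau (m : int) : F^o := 1.
have tauD m n : tau (m + n) = tau m * tau n by rewrite /tau mulr1.
have := act_vert (F := F) (tau := tau) (fun=> 0) erefl tauD v (fun=> 1) (follow v).
rewrite maximal_follow sdom_follow eqxx /=; apply: contra_eqN => /eqP ->.
by rewrite act_0 // eq_sym oner_eq0.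
Qed.

Section GrowthOfProducts.
Variables (F : fieldType) (A : nuAlgType F).
Implicit Types (S W : set A) (x y : A).

Lemma productsM S n m x y : lin_span (products S n) x -> lin_span (products S m) y ->
  lin_span (products S (n + m)) (x ** y).
Proof.
move=> xn; move: y; apply: lin_span_min.
  by apply: nmul_subspacel; apply: lin_span_subspace.
move=> y yS /=; move: x xn; apply:
  (lin_span_min (W := [set x | lin_span (products S (n + m)) (x ** y)])).
  by apply: nmul_subspacer; apply: lin_span_subspace.
move=> x [x0 [s [sn Sx0 Ss ->]]] /=; move: yS => [y0 [t [tm Sy0 St ->]]].
apply: lin_span_in; exists x0, (s ++ y0 :: t); split=> //.
- by rewrite size_cat /= -addSn; apply: leq_add.
- by move=> z; rewrite mem_cat inE => /or3P[/Ss|/eqP->|/St].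
rewrite foldl_cat /=; elim/last_ind: t {tm St} => //= t z IH.
by rewrite !foldl_rcons nmulA IH.
Qed.

Lemma productsS S n m : (n <= m)%N -> lin_span (products S n) `<=` lin_span (products S m).
Proof.
move=> nm; apply: lin_spanS => _ [x [s [sn Sx Ss ->]]].
by exists x, s; split=> //; apply: leq_trans nm.
Qed.

Lemma generates_products S x : generates S -> exists n, lin_span (products S n) x.
Proof.
move=> gS; pose B := [set x | exists n, lin_span (products S n) x].
have sS n := lin_span_subspace (products S n).
have BT : B = setT.
  apply: gS.
  - split=> [|c y z [n yn] [m zm]]; first by exists 0%N; apply: subspace0.
    exists (maxn n m); apply: (sS _).2.
      by apply: productsS yn; rewrite leq_maxl.
    by apply: productsS zm; rewrite leq_maxr.
  - by move=> y z [n yn] [m zm]; exists (n + m)%N; apply: productsM.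
  - by move=> y Sy; exists 1%N; apply: lin_span_in; exists y, [::].
by have : B x by rewrite BT.
Qed.

Lemma has_dim_independent W d m (z : 'I_m -> A) : has_dim W d -> (forall i, W (z i)) ->
  (forall c : 'I_m -> F, \sum_i c i *: z i = 0 -> forall i, c i = 0) -> (m <= d)%N.
Proof.
move=> [b [_ WE]] zW zfree.
have /choice[a aE] : forall i, exists c : 'I_d -> F, z i = \sum_j c j *: b j.
  by move=> i; have := zW i; rewrite WE.
pose M : 'M[F]_(m, d) := \matrix_(i, j) a i j.
suff : row_free M by rewrite -row_leq_rank => /leq_trans; apply; apply: rank_leq_col.
rewrite -kermx_eq0; apply/eqP/row_matrixP => i0; rewrite row0.
have kM : row i0 (kermx M) *m M = 0 by rewrite -row_mul mulmx_ker row0.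
apply/rowP=> i; rewrite [RHS]mxE; apply: (zfree (fun i => row i0 (kermx M) 0 i)).
under eq_bigr => k _ do rewrite aE scaler_sumr.
rewrite exchange_big /= big1 // => j _.
have := congr1 (fun X : 'rV_d => X 0 j) kM; rewrite !mxE => kMj.
under eq_bigr => k _ do rewrite scalerA.
rewrite -scaler_suml; under eq_bigr => k _ do rewrite -[a k j](mxE matrix_key (fun k j => a k j)).
by rewrite kMj scale0r.
Qed.

End GrowthOfProducts.

Section ExponentialGrowth.

Lemma poly_bound (p : {poly rat}) : exists C D : nat, forall n, (0 < n)%N ->
  p.[n%:R] <= (C * n ^ D)%:R.
Proof.
exists (Num.truncn (\sum_(i < size p) `|p`_i|)).+1, (size p) => n n0.
rewrite horner_coef natrM.
apply: (@Order.POrderTheory.le_trans _ _ ((\sum_(i < size p) `|p`_i|) * (n ^ size p)%:R)).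
  rewrite mulr_suml; apply: Num.Theory.ler_sum => i _.
  apply: (Order.POrderTheory.le_trans (Num.Theory.ler_norm _)).
  rewrite Num.Theory.normrM; apply: Num.Theory.ler_wpM2l; first exact: Num.Theory.normr_ge0.
  rewrite -natrX Num.Theory.normr_nat Num.Theory.ler_nat.
  by apply: leq_pexp2l => //; apply: ltnW.
apply: Num.Theory.ler_wpM2r; first exact: Num.Theory.ler0n.
apply: Order.POrderTheory.ltW; apply: Num.Theory.truncnS_gt.
Qed.

Lemma exp_beats_poly (C D : nat) : exists k, (C * k.+1 ^ D < 2 ^ k)%N.
Proof.
(* With [k.+1 = 2 ^ j] the claim follows from [C + j * D + 1 <= 2 ^ j -
    1]. For [j = 2 * i] the right side grows at least like the square of
    [i] and the left side is linear in [i]. *)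
pose i := (C + 2 * D).+1; pose j := (2 * i)%N.
have ij : (C + j * D + 1 <= 2 ^ j - 1)%N.
  have h : (i.+1 ^ 2 <= 2 ^ j)%N by rewrite /j mulnC expnM leq_exp2r // ltn_expl.
  apply: leq_trans (leq_sub2r 1 h).
  rewrite /j /i; nia.
exists (2 ^ j - 1)%N.
rewrite -subSn ?expn_gt0 // subn1 /= -expnM.
apply: (@leq_trans (2 ^ (C + j * D))); last by rewrite leq_exp2l // (leq_trans _ ij) // leq_addr.
by rewrite expnD ltn_pmul2r ?expn_gt0 // ltn_expl.
Qed.

End ExponentialGrowth.

Section DisjointCycles.
Variables (F : fieldType) (G : digraph).
Local Notation V := (vertex G).
Local Notation E := (edge G).
Local Notation L := (leavitt F G).

(** Two closed paths at the same vertex with different first edges generate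
    a free monoid. Two words of the same length satisfy [w^* w' = 0] unless
    they are equal, and [w^* w = v] is not zero, so the [2 ^ k] words of
    length [k] are linearly independent, while they lie in the span of
    products whose length is linear in [k]. *)
Lemma growth_disjoint_cycles : polynomial_growth L -> disjoint_cycles G.
Proof.
move=> [S [_ gS [p pP]]] e f ef /reachP[a0 a0p a0s] /reachP[b0 b0p b0s].
apply: contrapT => /eqP nef; pose v := esource e.
pose a (c : bool) := if c then e :: a0 else f :: b0.
have ap c : ispath (a c) v by case: c; rewrite /= /v ?a0s ?a0p ?eqxx // ef b0s b0p eqxx.
have asrc c : src (a c) v = v by case: c.
pose word (w : seq bool) := flatten (map a w).
have wp w : ispath (word w) v /\ src (word w) v = v.
  elim: w => //= c w [IHp IHs]; rewrite /word /= -/(word w) ispath_cat src_cat IHs IHp ap asrc.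
  by [].
have orth w w' : size w = size w' ->
    ghost_path F (word w) v ** real_path F (word w') v = if w == w' then vert F v else 0.
  elim: w w' => [|c w IH] [|c' w'] //= => [_|[ww]]; first by rewrite vert_idem.
  have [wp1 ws1] := wp w; have [wp2 ws2] := wp w'.
  rewrite /word /= -!/(word _) ghost_path_cat // real_path_cat // ws1 ws2.
  rewrite -nmulA [ghost_path F (a c) v ** _]nmulA eqseq_cons.
  have [<-|cc] := eqVneq c c'; first by rewrite ghost_path_real_path // vert_real_path // ws2
    eqxx IH.
  have -> : ghost_path F (a c) v ** real_path F (a c') v = 0.
    case: c c' cc => [] [] //= _; rewrite -nmulA [ghost _ _ ** _]nmulA ghost_arrow.
      by rewrite (negbTE nef) nmul0r nmulr0.
    by rewrite eq_sym (negbTE nef) nmul0r nmulr0.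
  by rewrite nmul0r nmulr0.
have [N NP] : exists N, [/\ (0 < N)%N, lin_span (products S N) (vert F v) &
    forall c, lin_span (products S N) (real_path F (a c) v)].
  have [n0 h0] := generates_products (vert F v) gS.
  have [n1 h1] := generates_products (real_path F (a true) v) gS.
  have [n2 h2] := generates_products (real_path F (a false) v) gS.
  exists (n0 + n1 + n2).+1; split=> //.
    by apply: productsS h0; rewrite -addnA ltnW // ltnS leq_addr.
  case.
    by apply: productsS h1; rewrite ltnW // ltnS -addnA addnCA leq_addr.
  by apply: productsS h2; rewrite ltnW // ltnS leq_addl.
case: NP => N0 vN aN.
have wN w : lin_span (products S ((size w).+1 * N)) (real_path F (word w) v).
  elim: w => [|c w IH]; first by rewrite mul1n.
  have [wp1 ws1] := wp w.
  by rewrite /word /= -/(word w) real_path_cat // ws1 mulSn; apply: productsM.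
have [C [D CD]] := poly_bound p.
have [k kP] := exp_beats_poly (C * N ^ D) D.
have [d [dW dp]] := pP (k.+1 * N)%N.
have : (2 ^ k <= d)%N.
  have <- : #|{: k.-tuple bool}| = (2 ^ k)%N by rewrite card_tuple card_bool.
  apply: (has_dim_independent (z := fun i => real_path F (word (enum_val i : k.-tuple bool)) v)
    dW).
    by move=> i /=; have := wN (enum_val i : k.-tuple bool); rewrite size_tuple.
  move=> c c0 i; have := congr1
    (fun x => ghost_path F (word (enum_val i : k.-tuple bool)) v ** x) c0.
  rewrite nmulr0 nmul_sumr (bigD1 i) //= big1 => [|j ji].
    rewrite -nscalerAr orth // eqxx addr0 => /eqP;
      rewrite scaler_eq0 (negbTE (vert_neq0 F v)) orbF.
    by move/eqP.
  rewrite -nscalerAr orth ?size_tuple //; case: eqP => [/val_inj/enum_val_inj ij|_].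
    by rewrite ij eqxx in ji.
  by rewrite scaler0.
apply/negP; rewrite -ltnNge; apply: leq_ltn_trans kP.
rewrite -(Num.Theory.ler_nat rat); apply: Order.POrderTheory.le_trans dp _.
have := CD (k.+1 * N)%N; rewrite muln_gt0 N0 => /(_ isT).
by rewrite expnMn -mulnA [(N ^ D * _)%N]mulnC.
Qed.

End DisjointCycles.

(** * The layers of the graph *)

Section Layers.
Variable G : digraph.
Local Notation V := (vertex G).
Local Notation E := (edge G).
Implicit Types (H : {set V}) (b d u v w : V) (e : E).

Definition below H u := [exists x, [&& x \in H, cyclic x, reach x u & ~~ reach u x]].

(** Removes from [H] the maximal cycles and everything that leads to one of
    them. *)
Definition lower H : {set V} :=
  [set v in H | [forall u, cyclic u && reach v u ==> below H u]]%SET.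

(** The choice made by [pick] depends only on the set of candidates, so all
    the vertices of a cycle get the same representative. *)
Definition class_rep b := odflt b [pick x | reach b x && reach x b].
Definition top_bases H : {set V} :=
  [set b in H | [&& cyclic b, ~~ below H b & class_rep b == b]]%SET.
Definition layer j : {set V} := iter j lower [set: V]%SET.

Lemma lowerP H v :
  reflect (v \in H /\ forall u, cyclic u -> reach v u -> below H u) (v \in lower H).
Proof.
rewrite inE; apply: (iffP andP) => -[vH h]; split=> //.
  by move=> u cu vu; move/forallP/(_ u): h; rewrite cu vu.
by apply/forallP=> u; apply/implyP=> /andP[cu vu]; apply: h.
Qed.

Lemma belowP H u :
  reflect (exists x, [/\ x \in H, cyclic x, reach x u & ~~ reach u x]) (below H u).
Proof.
by apply: (iffP existsP) => -[x]; [move=> /and4P[] | move=> [? ? ? ?]]; exists x => //;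
  apply/and4P.
Qed.

Lemma lower_sub H : lower H \subset H.
Proof. by apply/fintype.subsetP=> v /lowerP[]. Qed.

Lemma hereditary_lower H : hereditary H -> hereditary (lower H).
Proof.
move=> hH e /lowerP[eH h]; apply/lowerP; split; first exact: hH.
by move=> u cu ru; apply: h => //; apply: reach_edge_trans.
Qed.

Lemma hereditary_layer j : hereditary (layer j).
Proof. by elim: j => [|j IH]; [apply: hereditaryT | apply: hereditary_lower]. Qed.

Lemma sink_lower H v : sink v -> v \in H -> v \in lower H.
Proof.
move=> /sinkP sv vH; apply/lowerP; split=> // u cu /reach_step[vu|[e /sv //]].
by move: cu; rewrite -vu => /cyclicP[e /sv].
Qed.

Lemma sink_layer v j : sink v -> v \in layer j.
Proof. by move=> sv; elim: j => [|j IH]; [rewrite inE | apply: sink_lower]. Qed.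

Lemma below_class H u w : reach u w -> reach w u -> below H u -> below H w.
Proof.
move=> uw wu /belowP[x [xH cx xu ux]]; apply/belowP; exists x; split=> //.
  exact: reach_trans uw.
by apply: contra ux; apply: reach_trans.
Qed.

Lemma class_rep_reach b : reach b (class_rep b) && reach (class_rep b) b.
Proof.
by rewrite /class_rep; case: pickP => [x|_] //=; rewrite reach_refl.
Qed.

Lemma class_rep_eq b d : reach b d -> reach d b -> class_rep b = class_rep d.
Proof.
move=> bd db; rewrite /class_rep.
have bx : (fun x => reach b x && reach x b) =1 (fun x => reach d x && reach x d).
  move=> x; apply/andP/andP=> -[h1 h2]; split.
  - exact: reach_trans db h1.
  - exact: reach_trans h2 bd.
  - exact: reach_trans bd h1.
  - exact: reach_trans h2 db.
rewrite (eq_pick bx); case: pickP => //= /(_ d); by rewrite reach_refl.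
Qed.

Lemma top_bases_cyclic H w : hereditary H -> w \in H -> w \notin lower H -> cyclic w ->
  exists2 b, b \in top_bases H & reach w b /\ reach b w.
Proof.
move=> hH wH wl cw; have /andP[wr rw] := class_rep_reach w.
have [u [cu wu ub]] : exists u, [/\ cyclic u, reach w u & ~~ below H u].
  apply: contrapT => nu; case/negP: wl; apply/lowerP; split=> // u cu wu.
  by apply: contrapT => ub; apply: nu; exists u; split=> //; apply/negP.
have uw : reach u w.
  by apply: contraR ub => uw; apply/belowP; exists w.
exists (class_rep w); last by [].
rewrite inE (hereditary_reach hH wr wH) (cyclic_class rw wr cw) (class_rep_eq rw wr) eqxx andbT
  /=.
by apply: contra ub; apply: below_class; [apply: reach_trans wu | apply: reach_trans uw _].
Qed.

Lemma top_basesP H b : b \in top_bases H ->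
  [/\ b \in H, cyclic b, class_rep b = b & forall x, x \in H -> cyclic x -> reach x b -> reach
    b x].
Proof.
rewrite inE => /and4P[bH cb bb /eqP br]; split=> // x xH cx xb.
by apply: contraR bb => bx; apply/belowP; exists x.
Qed.

Lemma top_bases_lower H b : b \in top_bases H -> b \notin lower H.
Proof.
rewrite inE => /and4P[bH cb bb _]; apply/negP => /lowerP[_ /(_ b cb (reach_refl b))].
exact/negP.
Qed.

(** A cycle reached from an exit of the cycle of [b] is strictly below [b]. *)
Lemma top_bases_exit H b e : hereditary H -> b \in top_bases H -> reach b (esource e) ->
  reach (esource e) b -> erange e \in lower H \/ reach (erange e) (esource e).
Proof.
move=> hH /top_basesP[bH cb _ bmax] be eb.
have [ee|ee] := boolP (reach (erange e) (esource e)); [by right | left].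
have br : reach b (erange e) by apply: reach_trans be _; apply: reach_edge.
apply/lowerP; split; first exact: hereditary_reach hH br bH.
move=> u cu ru; apply/belowP; exists b; split=> //; first exact: reach_trans ru.
by apply: contra ee => ub; apply: reach_trans ru _; apply: reach_trans be.
Qed.

Lemma top_bases_indep H b d : b \in top_bases H -> d \in top_bases H -> reach b d -> b = d.
Proof.
move=> /top_basesP[bH cb br _] /top_basesP[_ _ dr dmax] bd.
by rewrite -br -dr; apply: class_rep_eq => //; apply: dmax.
Qed.

Definition acyclic_on H := [forall v in H, ~~ cyclic v].

(** A vertex on a cycle that reaches as many vertices as possible lies on a
    top cycle. *)
Lemma top_bases_nonempty H : hereditary H -> ~~ acyclic_on H -> exists b, b \in top_bases H.
Proof.
move=> hH /forall_inPn[v0 v0H]; rewrite negbK => cv0.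
pose P v := (v \in H) && cyclic v; pose f v := #|[pred x | reach v x]|.
have Pv0 : P v0 by rewrite /P v0H.
case: (@arg_maxnP _ v0 P f Pv0) => u /andP[uH cu] umax.
have ul : u \notin lower H.
  apply/negP=> /lowerP[_ /(_ u cu (reach_refl u))] /belowP[x [xH cx xu ux]].
  have := umax x; rewrite /P xH cx => /(_ isT); apply/negP; rewrite -ltnNge.
  apply: proper_card; apply/properP; split.
    by apply/fintype.subsetP=> y; rewrite !inE; apply: reach_trans.
  by exists x; rewrite !inE ?reach_refl.
by have [b bH _] := top_bases_cyclic hH uH ul cu; exists b.
Qed.

(** Each layer that contains a cycle loses a top cycle in the next one. *)
Lemma layers_terminate : exists s, acyclic_on (layer s) /\
  forall j, (j < s)%N -> ~~ acyclic_on (layer j).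
Proof.
have ex : exists s, acyclic_on (layer s).
  apply: contrapT => na.
  have lt j : (#|layer j| + j <= #|V|)%N.
    elim: j => [|j IH]; first by rewrite addn0 max_card.
    apply: leq_trans IH; rewrite addnS -addSn leq_add2r.
    have [|b bH] := @top_bases_nonempty (layer j) (@hereditary_layer j).
      by apply/negP=> aj; apply: na; exists j.
    apply: proper_card; apply/properP; split; first exact: lower_sub.
    by exists b; [case/top_basesP: bH | apply: top_bases_lower].
  by have := lt #|V|.+1; rewrite addnS ltnNge leq_addl.
exists (ex_minn ex); case: ex_minnP => s sa smin; split=> // j js.
by apply/negP=> /smin; rewrite leqNgt js.
Qed.

End Layers.

(** * The chain of ideals *)

Section Chain.
Variables (F : fieldType) (G : digraph).
Hypothesis nx : disjoint_cycles G.
Local Notation V := (vertex G).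
Local Notation E := (edge G).
Local Notation L := (leavitt F G).
Implicit Types (b d u v w : V) (e f : E) (p q : seq E) (x y z : L).

(** The chain is built from the top: it descends from the whole algebra to
    the ideal of the vertices that reach no cycle. *)
Definition chain j : nuIdeal L := videal F (@hereditary_layer G j).

Local Notation tb j := (top_bases (layer G j)).

Lemma chain_units j : matrix_units (chain j) (chain j.+1)
  (fun i : 'I_#|tb j| => first_path (enum_val i)) xpredT (@laurent_pow F)
  (fun i => leavitt_unit F (enum_val i)) (fun i => leavitt_entry (@laurent_pow F) (enum_val i)).
Proof.
apply: leavitt_units => //.
- exact: laurent_pow0.
- exact: laurent_powD.
- exact: laurent_pow_free.
- exact: laurent_pow_gen.
- exact: lower_sub.
- by move=> b bB; split; [case/top_basesP: bB | apply: top_bases_lower].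
- by move=> w wH wl sw; case/negP: wl; apply: sink_lower.
- by move=> w wH wl cw; apply: top_bases_cyclic => //; apply: hereditary_layer.
- by move=> b e; apply: top_bases_exit; apply: hereditary_layer.
- exact: top_bases_indep.
- by move=> b /top_basesP[_ cb _ _]; left.
Qed.

(** In the last layer there is no cycle left, and its sinks serve as bases. *)
Lemma socle_units s : acyclic_on (layer G s) ->
  matrix_units (chain s) (videal F (@hereditary0 G))
  (fun i : 'I_#|[set b in layer G s | sink b]%SET| => first_path (enum_val i)) (pred1 0)
  (fun=> 1 : F^o)
  (fun i => leavitt_unit F (enum_val i)) (fun i => leavitt_entry (fun=> 1 : F^o) (enum_val i)).
Proof.
move=> /forall_inP ac; apply: leavitt_units => //.
- by move=> m n; rewrite mulr1.
- exact: one_free.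
- exact: one_gen.
- exact: finset.sub0set.
- by move=> b; rewrite !inE => /andP[].
- by move=> w wH _ sw; rewrite inE wH.
- by move=> w /ac /negbTE ->.
- move=> b e; rewrite inE => /andP[_ /sinkP sb] /reach_step[be|[f /sb //]].
  by case: (sb e).
- move=> b d; rewrite inE => /andP[_ /sinkP sb] _ /reach_step[//|[f /sb //]].
- by move=> b; rewrite inE => /andP[_ sb]; right.
Qed.

Lemma chain_factor j : sum_of_mx_blocks (laurent F) (factor_alg (chain j) (chain j.+1)).
Proof. exact/factor_blocks_quot/(matrix_units_factor (chain_units j)). Qed.

Lemma chain_socle s : acyclic_on (layer G s) -> sum_of_mx_blocks F^o (ideal_alg (chain s)).
Proof.
move=> /socle_units/matrix_units_factor; apply: factor_blocks_ideal; exact: videal0.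
Qed.

Lemma chain_decreasing j k : (j <= k)%N -> {subset chain k <= chain j}.
Proof.
move=> jk; apply: videalS; rewrite -(subnK jk); elim: (k - j)%N => // n IH.
exact: fintype.subset_trans (lower_sub _) IH.
Qed.

Lemma chain_strict j : ~~ acyclic_on (layer G j) -> ~ {subset chain j <= chain j.+1}.
Proof.
move=> /(top_bases_nonempty (@hereditary_layer G j))[b bB] sub.
have bH : b \in layer G j by case/top_basesP: bB.
have := mu_ideal (chain_units j) (b := enum_rank_in bB b) (p := [::]) (q := [::]).
move=> /(_ (vert F b) isT isT (sub _ (vert_videal _ _ bH))).
have := mu_ent (chain_units j) (b := enum_rank_in bB b) (d := enum_rank_in bB b)
  (p := [::]) (q := [::]) (p' := [::]) (q' := [::]) (m := 0) isT isT isT isT isT.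
rewrite !eqxx /= enum_rankK_in // /mon /= vert_idem => -> /eqP.
by rewrite laurent_pow0 oner_eq0.
Qed.

End Chain.

(** * Ideals preserved by automorphisms *)

Section Automorphisms.
Variables (F : fieldType) (A : nuAlgType F).
Implicit Types (phi : A -> A) (x y : A).

Lemma nu_isomorphismB phi x y : nu_isomorphism phi -> phi (x - y) = phi x - phi y.
Proof. by case=> plin _ _; rewrite addrC -scaleN1r plin scaleN1r addrC. Qed.

Lemma nu_isomorphism_inv phi : nu_isomorphism phi ->
  exists2 psi, nu_isomorphism psi & cancel psi phi.
Proof.
case=> plin pmul [psi pK Kp]; exists psi => //; split.
- by move=> c x y; apply: (can_inj pK); rewrite plin !Kp.
- by move=> x y; apply: (can_inj pK); rewrite pmul !Kp.
- by exists phi.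
Qed.

Lemma preim_subspace phi (W : set A) : nu_isomorphism phi -> is_subspace W ->
  is_subspace (phi @^-1` W).
Proof.
move=> piso sW; have [plin _ _] := piso; split=> [|c x y Wx Wy] /=.
  by rewrite -(subrr 0) nu_isomorphismB // subrr; apply: subspace0.
by rewrite plin; apply: sW.2.
Qed.

Definition invariant (I : {pred A}) :=
  forall phi, nu_isomorphism phi -> forall x, x \in I -> phi x \in I.

(** Inclusion of the image for the inverse automorphism gives the equality. *)
Lemma invariant_image (I : {pred A}) phi : invariant I -> nu_isomorphism phi ->
  phi @` [set x | x \in I] = [set x | x \in I].
Proof.
move=> Iinv piso; apply/seteqP; split=> [_ [x xI <-]|x xI] /=; first exact: Iinv.
have [psi psiso psiK] := nu_isomorphism_inv piso.
by exists (psi x); rewrite ?psiK //; apply: Iinv.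
Qed.

Section Preimage.
Variables (phi : A -> A) (piso : nu_isomorphism phi) (K : nuIdeal A).

Definition preim_pred : {pred A} := fun x => phi x \in K.

Lemma preim_closed : submod_closed preim_pred.
Proof.
have [p0 pD] := preim_subspace piso (ideal_subspace K).
by split=> [|c x y xK yK]; [apply: p0 | apply: pD].
Qed.

Lemma preim_absorbl x y : y \in preim_pred -> x ** y \in preim_pred.
Proof. by case: piso => _ pmul _ yK; rewrite -[_ \in _]/(phi _ \in K) pmul; apply: absorbl. Qed.
Lemma preim_absorbr x y : x \in preim_pred -> x ** y \in preim_pred.
Proof. by case: piso => _ pmul _ yK; rewrite -[_ \in _]/(phi _ \in K) pmul; apply: absorbr. Qed.

Definition preim_ideal : nuIdeal A := NuIdeal preim_closed preim_absorbl preim_absorbr.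

End Preimage.

(** Among matrices over [F] these are the matrices of rank at most one. *)
Definition rank_one : set A := [set x | forall y, exists c : F, x ** y ** x = c *: x].

Lemma rank_one_invariant phi x : nu_isomorphism phi -> rank_one x -> rank_one (phi x).
Proof.
move=> piso x1 y; have [plin pmul [psi pK Kp]] := piso.
have [c xc] := x1 (psi y); exists c.
by rewrite -{1}[y]Kp -!pmul xc -[c *: x]addr0 plin
  -{1}(subrr 0) nu_isomorphismB // subrr addr0.
Qed.

(** Refers to nothing but the algebra and the ideals, so an automorphism
    that preserves [J] permutes the ideals [K] with this property. *)
Definition dedekind_mod (J K : nuIdeal A) := forall v x y, v \in J -> x \in J -> y \in J ->
  corner_inverse v x y -> y ** x - v \in K.

Lemma dedekind_preim (J K : nuIdeal A) phi (piso : nu_isomorphism phi) :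
  invariant J -> dedekind_mod J K -> dedekind_mod J (preim_ideal piso K).
Proof.
move=> Jinv JK v x y vJ xJ yJ [vv [vx xv] [vy yv] xy].
have [_ pmul _] := piso.
rewrite -[_ \in _]/(phi _ \in K) nu_isomorphismB // pmul.
by apply: JK; rewrite ?Jinv //; split; rewrite -?pmul ?vv ?vx ?xv ?vy ?yv ?xy.
Qed.

End Automorphisms.

(** * Invariance of the chain *)

Section Invariance.
Variables (F : fieldType) (G : digraph).
Hypothesis nx : disjoint_cycles G.
Local Notation V := (vertex G).
Local Notation E := (edge G).
Local Notation L := (leavitt F G).
Implicit Types (b u v w : V) (e f : E) (p q : seq E) (x y z : L).

(** No edge leaves a sink, so a monomial that starts and ends there is the
    sink itself. *)
Lemma sink_corner b y : sink b -> exists c : F, vert F b ** y ** vert F b = c *: vert F b.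
Proof.
move=> sb; have := videalT y; move/videalP.
pose W := [set y | exists c : F, vert F b ** y ** vert F b = c *: vert F b].
apply: (lin_span_min (W := W)).
  split=> [|c x z [a ax] [d dz]]; first by exists 0; rewrite nmulr0 nmul0r scale0r.
  exists (c * a + d); rewrite nmulDr nmulDl -nscalerAr -nscalerAl ax dz.
  by rewrite scalerA scalerDl.
move=> _ [p [q [w [_ pp qp ->]]]]; rewrite /W /= /mon nmulA vert_real_path // -nmulA
  ghost_path_vert //.
case: (b =P src p w) => [/esym pb|_]; last by exists 0; rewrite nmul0r scale0r.
case: (b =P src q w) => [/esym qb|_]; last by exists 0; rewrite nmulr0 scale0r.
move: pb qb pp qp => pb qb; rewrite (sink_path sb pb) (sink_path sb qb) /= => _ _.
have wb : w = b by have := pb; rewrite (sink_path sb pb).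
by exists 1; rewrite wb vert_idem scale1r.
Qed.

Lemma sink_rank_one b p q : sink b -> rank_one (mon F p q b).
Proof.
move=> sb y; have [c cE] := sink_corner (ghost_path F q b ** y ** real_path F p b) sb.
exists c; rewrite /mon -[in LHS](ghost_path_end F q) -[in LHS](real_path_end F p).
have -> : real_path F p b ** vert F b ** (vert F b ** ghost_path F q b) ** y **
  (real_path F p b ** vert F b ** (vert F b ** ghost_path F q b))
  = real_path F p b ** (vert F b ** (ghost_path F q b ** y ** real_path F p b) ** vert F b) **
    ghost_path F q b.
  by rewrite !nmulA -[_ ** vert F b ** vert F b]nmulA vert_idem
    -[_ ** vert F b ** vert F b]nmulA vert_idem.
by rewrite cE -nscalerAr real_path_end -nscalerAl.
Qed.

Lemma socle_rank_one s x : acyclic_on (layer G s) -> x \in chain F G s ->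
  lin_span (@rank_one F L) x.
Proof.
move=> ac /(mu_span (socle_units F nx ac))[y /videal0 -> ]; rewrite subr0.
apply: lin_spanS => _ [i [p [q [m [_ _ /eqP -> ->]]]]].
apply: sink_rank_one; have := enum_valP i; by rewrite inE => /andP[].
Qed.

(** An entry [g] of [x] in a Laurent block satisfies the hypotheses of
    [laurent_rank_one], by sandwiching units with exponents [0] and [1]
    between two copies of [x]. *)
Lemma rank_one_chain j x : rank_one x -> x \in chain F G j -> x \in chain F G j.+1.
Proof.
move=> x1 xj; have mu := chain_units F nx j; apply: (mu_kernel mu) => // i p q pP qP.
have h m : exists c : F, leavitt_entry (@laurent_pow F) (enum_val i) p q x * laurent_pow F m *
    leavitt_entry (@laurent_pow F) (enum_val i) p q x
      = c *: leavitt_entry (@laurent_pow F) (enum_val i) p q x.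
  have [c cE] := x1 (leavitt_unit F (enum_val i) q p m); exists c.
  by rewrite -(mu_sandwich mu) // cE (entZ mu).
have [c0 c0E] := h 0; have [c1 c1E] := h 1.
exact: laurent_rank_one c0E c1E.
Qed.

(** The last ideal of the chain is the span of the elements of rank one. *)
Lemma chain_socle_invariant s : acyclic_on (layer G s) -> invariant (chain F G s).
Proof.
move=> ac phi piso x /(socle_rank_one ac).
apply: (lin_span_min (W := phi @^-1` [set x | x \in chain F G s])).
  by apply: preim_subspace => //; apply: ideal_subspace.
move=> y /(rank_one_invariant piso) y1 /=; elim: {ac} s => [|s IH]; last exact: rank_one_chain.
exact: videalT.
Qed.

Lemma reach_exit u v (x : V) : reach x u -> reach v x -> reach x v -> ~~ reach u v ->
  exists e, [/\ reach v (esource e), reach (esource e) v, ~~ reach (erange e) v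
    & reach (erange e) u].
Proof.
move=> /reachP[p pp <-]; elim: p pp => [|e p IH] /=; first by move=> _ _ ->.
move=> /andP[/eqP ep pp] ve ev uv; have [ev'|ev'] := boolP (reach (erange e) v).
  apply: IH; rewrite -?ep //; apply: reach_trans ve _; exact: reach_edge.
by exists e; split=> //; rewrite ep; apply: ispath_reach.
Qed.

Section Lower.
Variables (H : {set V}) (hH : hereditary H) (K : nuIdeal L).
Hypothesis K_sink : forall v, sink v -> vert F v \in K.
Hypothesis K_dedekind : dedekind_mod (videal F hH) K.

Lemma vert_reach u w : reach u w -> vert F u \in K -> vert F w \in K.
Proof.
move=> /reachP[p pp pu] uK; rewrite -(ghost_path_real_path F pp).
have -> : ghost_path F p w ** real_path F p w = ghost_path F p w ** vert F u ** real_path F p w.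
  by rewrite -nmulA vert_real_path // pu eqxx.
by apply: absorbr; apply: absorbl.
Qed.

(** Let [c] be the cycle at the source [v] of the exit [e]. From [c^* c =
    v] the hypothesis yields [c c^* = v] modulo [K]. As [c] starts with
    another edge, [e^* c = 0], so multiplying by [e^*] puts [e^*] in [K],
    and then [e^* e], the range of [e]. *)
Lemma vert_exit e : esource e \in H -> cyclic (esource e) -> ~~ reach (erange e) (esource e) ->
  vert F (erange e) \in K.
Proof.
move=> eH /cyclicP[f fe /reachP[c0 c0p c0s]] er; pose u := esource e; pose c := f :: c0.
have cp : ispath c u by rewrite /c /= c0s eqxx c0p.
have cs : src c u = u by [].
have uJ : vert F u \in videal F hH by apply: vert_videal.
have cJ : ghost_path F c u \in videal F hH by rewrite -ghost_path_end; apply: absorbr.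
have cJ' : real_path F c u \in videal F hH by rewrite -real_path_end; apply: absorbl.
have lc : vert F u ** real_path F c u = real_path F c u by rewrite vert_real_path // cs eqxx.
have cl : ghost_path F c u ** vert F u = ghost_path F c u by rewrite ghost_path_vert // cs eqxx.
have := K_dedekind uJ cJ cJ' (And4 (vert_idem F u) (conj (ghost_path_end F c u) cl) (conj lc
  (real_path_end F c u)) (ghost_path_real_path F cp)).
move/(absorbl (ghost F e)); rewrite nmulBr nmulA.
have ef : e != f by apply: contra er => /eqP->; apply/reachP; exists c0; rewrite // fe.
have -> : ghost F e ** real_path F c u = 0 by rewrite ghost_real_path // (negbTE ef).
rewrite nmul0r sub0r ghost_vert_src rpredN => /(absorbr (arrow F e)).
by rewrite ghost_arrow eqxx.
Qed.

(** Every path from a higher cycle down to [u] takes an exit of that cycle. *)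
Lemma vert_below u : below H u -> vert F u \in K.
Proof.
move=> /belowP[x [xH cx xu ux]].
have [e [xe ex er eu]] := reach_exit xu (reach_refl x) (reach_refl x) ux.
apply: (vert_reach eu); apply: vert_exit.
- exact: hereditary_reach hH xe xH.
- exact: cyclic_class ex xe cx.
- by apply: contra er => ee; apply: reach_trans ee ex.
Qed.

(** Expanding a vertex on no cycle leads in the end to sinks and to cycles,
    which are all below other cycles. *)
Lemma vert_lower v : v \in lower H -> vert F v \in K.
Proof.
have [k] := ubnP #|[pred x | reach v x]|; elim: k v => // k IH v vk vl.
have [cv|cv] := boolP (cyclic v).
  by apply: vert_below; case/lowerP: vl => _; apply; rewrite ?reach_refl.
have [sv|sv] := boolP (sink v); first exact: K_sink.
rewrite vert_sum //; apply: rpred_sum => e /eqP ev.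
rewrite -arrow_vert_rng; apply: absorbr; apply: absorbl; apply: IH.
- by rewrite -ev in cv vk; apply: leq_trans (reach_lt cv) _.
- by apply: (hereditary_lower hH); rewrite ev.
Qed.

End Lower.

Lemma chain_dedekind j : dedekind_mod (chain F G j) (chain F G j.+1).
Proof. exact/factor_blocks_corner/(matrix_units_factor (chain_units F nx j)). Qed.

(** Together with [chain_dedekind] this describes each term of the chain as
    the smallest ideal with a property that automorphisms preserve. *)
Lemma chain_min j s (K : nuIdeal L) : {subset chain F G s <= K} ->
  dedekind_mod (chain F G j) K -> {subset chain F G j.+1 <= K}.
Proof.
move=> sK jK; apply: videal_min => v; apply: vert_lower jK v => v sv.
by apply/sK/vert_videal/sink_layer.
Qed.

Lemma chain_invariant s j : acyclic_on (layer G s) -> (j <= s)%N -> invariant (chain F G j).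
Proof.
move=> ac; elim: j => [_ phi _ x _|j IH js]; first exact: videalT.
move=> phi piso; apply: (@chain_min j s (preim_ideal piso (chain F G j.+1))).
  move=> x xs; rewrite -[_ \in _]/(phi x \in _); apply: (chain_decreasing js).
  exact: chain_socle_invariant.
apply: dedekind_preim; last exact: chain_dedekind.
exact/IH/ltnW.
Qed.

End Invariance.

Theorem theorem1 (F : fieldType) (G : digraph) :
  polynomial_growth (leavitt F G) ->
  exists (s : nat) (I : nat -> nuIdeal (leavitt F G)),
    [/\ forall i, (i < s)%N ->
          {subset I i <= I i.+1} /\ ~ {subset I i.+1 <= I i},
        forall x : leavitt F G, x \in I s,
        sum_of_mx_blocks F^o (ideal_alg (I 0%N)),
        forall i, (i < s)%N ->
          sum_of_mx_blocks (laurent F) (factor_alg (I i.+1) (I i)) &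
        forall i, (i <= s)%N ->
          forall phi : leavitt F G -> leavitt F G, nu_isomorphism phi ->
            phi @` [set x | x \in I i] = [set x | x \in I i]].
Proof.
move=> /growth_disjoint_cycles nx; have [s [ac cyc]] := layers_terminate G.
exists s, (fun i => chain F G (s - i)); split.
- move=> i si; have -> : (s - i = (s - i.+1).+1)%N by rewrite subnSK.
  split; first exact: chain_decreasing.
  by apply: chain_strict => //; apply: cyc; rewrite ltn_subrL // (leq_trans _ si).
- by move=> x; rewrite subnn; apply: videalT.
- by rewrite subn0; apply: chain_socle.
- move=> i si; have -> : (s - i = (s - i.+1).+1)%N by rewrite subnSK.
  exact: chain_factor.
- move=> i si phi piso; apply: invariant_image => //.
  by apply: (chain_invariant nx ac); apply: leq_subr.
Qed.
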